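(* Let $\alpha_0 = 1.62420\ldots$ denote the unique solution of the equation $\sqrt{4-\alpha^2} = \frac{2}{\alpha}\arcsin\frac{\alpha}{2}$ on the interval $(0,2)$. Suppose that $\varphi_\alpha(z) = z_1^2 + \alpha z_1 z_2 + z_2^2$ for $\alpha \geq 0$. Then (i) $\varphi_\alpha$ is never norm attaining in $H^1(\mathbb{T}^2)$ (i.e. for no $\alpha\geq 0$); (ii) $\varphi_\alpha$ is a Hilbert point in $H^1(\mathbb{T}^2)$ if and only if $\alpha=0$ or $\alpha=\alpha_0$; (iii) $\varphi_\alpha$ is norm attaining in $W(\mathbb{T}^2)$ if and only if $0 \leq \alpha \leq 1/2$; (iv) $\varphi_\alpha$ is a Hilbert point in $W(\mathbb{T}^2)$ if and only if $0 \leq \alpha \leq 1/2$ or $\alpha=2$.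
   Context: $\mathbb{T}$ is the unit circle in the complex plane, and $\mathbb{T}^2=\mathbb{T}\times\mathbb{T}$ carries the product of normalized Lebesgue arc length measures. For $1\leq p<\infty$, the Hardy space $H^p(\mathbb{T}^2)$ is the closure in $L^p(\mathbb{T}^2)$ of the set of polynomials in two complex variables, with the $L^p$ norm. Functions in $H^2(\mathbb{T}^2)$ are identified in the usual way with their holomorphic extensions to the polydisc $\mathbb{D}^2$. The weak product space $W(\mathbb{T}^2) = H^2(\mathbb{T}^2)\odot H^2(\mathbb{T}^2)$ is the Banach space of all functions $f$ (on $\mathbb{D}^2$) that have a weak factorization $f = \sum_{j=1}^\infty g_j h_j$ with $g_j,h_j$ in $H^2(\mathbb{T}^2)$ and $\sum_{j=1}^\infty \|g_j\|_{H^2(\mathbb{T}^2)}\|h_j\|_{H^2(\mathbb{T}^2)}<\infty$; its norm $\|f\|_{W(\mathbb{T}^2)}$ is the infimum of the latter sum over all weak factorizations of $f$. Put $H = H^2(\mathbb{T}^2)$, with inner product $\langle\cdot,\cdot\rangle$, and let $X$ be either $H^1(\mathbb{T}^2)$ or $W(\mathbb{T}^2)$. In both cases $H$ is a dense subspace of $X$ and the embedding has norm $1$. A nonzero $\varphi$ in $H$ is called norm attaining in $X$ if $\|\varphi\|_X = \|\varphi\|_{H}$. A nonzero $\varphi$ in $H$ is called a Hilbert point in $X$ if $\|\varphi+f\|_X \geq \|\varphi\|_X$ holds whenever $f$ is in $H$ and $\langle f,\varphi\rangle=0$. *)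

(* Defs.v *)
From HB Require Import structures.
From mathcomp Require Import all_boot all_order all_algebra polyXY.
From mathcomp Require Import complex.
From mathcomp Require Import all_classical all_reals all_analysis.

Set Implicit Arguments.
Unset Strict Implicit.
Unset Printing Implicit Defensive.

Import Order.TTheory GRing.Theory Num.Theory.
Import numFieldNormedType.Exports Normc.

Local Open Scope classical_set_scope.
Local Open Scope ring_scope.

(* A function on the torus T^2 is represented by any function on C * C; only
   its values at the points (e^(i s), e^(i t)) matter, and equality of such
   functions is to be understood almost everywhere. *)

Section Torus.
Variable R : realType.
Local Notation C := R[i].
Implicit Types (f g : C * C -> C) (z : C * C) (p : R).

Lemma twopi_gt0 : 0 < 2 * pi :> R.
Proof. by rewrite mulr_gt0// pi_gt0. Qed.

(* Normalized arc length, in the angular parameter. *)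
Definition arc_measure := uniform_prob twopi_gt0.

Definition torus_measure := (arc_measure \x arc_measure)%E.

Definition expi (t : R) : C := Complex (cos t) (sin t).

Definition torus_point (t : R * R) : C * C := (expi t.1, expi t.2).

Definition Lp_norm p f : \bar R :=
  Lnorm torus_measure p%:E (fun t => (normc (f (torus_point t)))%:E).

Definition in_Lp p f : Prop :=
  [/\ measurable_fun [set: R * R] (fun t => complex.Re (f (torus_point t))),
      measurable_fun [set: R * R] (fun t => complex.Im (f (torus_point t))) &
      (Lp_norm p f < +oo)%E].

Definition torus_integral f : C :=
  Complex (Rintegral torus_measure setT (fun t => complex.Re (f (torus_point t))))
          (Rintegral torus_measure setT (fun t => complex.Im (f (torus_point t)))).

Definition inner f g : C := torus_integral (fun z => f z * conjc (g z)).

Definition hardy p f : Prop :=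
  in_Lp p f /\
  forall e : R, 0 < e -> exists P : {poly {poly C}},
    (Lp_norm p (fun z => f z - P.[z.1, z.2])%R < e%:E)%E.

(* f vanishes as an element of L^p. *)
Definition torus_zero f : Prop :=
  {ae torus_measure, forall t, f (torus_point t) = 0}.

Definition bidisc : set (C * C) := [set z | `|z.1| < 1 /\ `|z.2| < 1].

(* For f in a Hardy space, the holomorphic extension to the bidisc is given by
   the Cauchy integral of f (equivalently, by the power series whose
   coefficients are the Fourier coefficients of f). *)
Definition hol_ext f z : C :=
  torus_integral
    (fun w => f w / ((1 - z.1 * conjc w.1) * (1 - z.2 * conjc w.2))).

Definition weak_cost (g h : nat -> C * C -> C) : \bar R :=
  (\sum_(0 <= j <oo) (Lp_norm 2 (g j) * Lp_norm 2 (h j)))%E.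

(* The factors are boundary functions, while F lives on the bidisc. *)
Definition weak_factorization (F : C * C -> C) (g h : nat -> C * C -> C) : Prop :=
  [/\ forall j, hardy 2 (g j),
      forall j, hardy 2 (h j),
      (weak_cost g h < +oo)%E &
      forall z, bidisc z ->
        series (fun j => hol_ext (g j) z * hol_ext (h j) z : C^o) @ \oo
          --> (F z : C^o)].

(* +oo when F has no weak factorization. *)
Definition weak_norm (F : C * C -> C) : \bar R :=
  ereal_inf [set x | exists g h : nat -> C * C -> C, weak_factorization F g h /\ x = weak_cost g h].

(* The norms of H^1(T^2) and W(T^2), on the boundary functions of H^2(T^2). *)
Definition H1_norm f : \bar R := Lp_norm 1 f.
Definition W_norm f : \bar R := weak_norm (hol_ext f).

Definition norm_attaining (normX : (C * C -> C) -> \bar R) (phi : C * C -> C) :=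
  [/\ hardy 2 phi, ~ torus_zero phi & normX phi = Lp_norm 2 phi].

Definition hilbert_point (normX : (C * C -> C) -> \bar R) (phi : C * C -> C) :=
  [/\ hardy 2 phi, ~ torus_zero phi &
      forall f, hardy 2 f -> inner f phi = 0 ->
        (normX phi <= normX (fun z => phi z + f z)%R)%E].

Definition phi_ (a : R) z : C :=
  z.1 ^+ 2 + (real_complex R a) * z.1 * z.2 + z.2 ^+ 2.

Definition alpha_eq (a : R) : Prop :=
  Num.sqrt (4 - a ^+ 2) = 2 / a * asin (a / 2).

End Torus.

(* Main.v *)
Require Import Defs.
From HB Require Import structures.
From mathcomp Require Import all_boot all_order all_algebra polyXY.
From mathcomp Require Import complex ring lra zify.
From mathcomp Require Import all_classical all_reals all_analysis measurable_realfun.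
Set Implicit Arguments.
Unset Strict Implicit.
Unset Printing Implicit Defensive.
Import Order.TTheory GRing.Theory Num.Theory.
Import numFieldNormedType.Exports Normc.
Local Open Scope classical_set_scope.
Local Open Scope ring_scope.

(** With [w = z1 / z2 = exp (i x)] one has [phi_a = z1 z2 (a + 2 cos x)], so
    everything about [phi_a] on the torus is an integral over one angle.

    In H^1. The norm is the mean of [|a + 2 cos x|], and it equals the L^2 norm
    only if this modulus is constant, which the fourth moment excludes
    ([phi_not_norm_attaining_H1]). By duality [phi] is a Hilbert point exactly
    when the projection of [sgn phi] to H^2 is a multiple of [phi]. For
    [a = 2 sin t] this projection is [(2 / pi) (cos t (z1^2 + z2^2) + t z1 z2)],
    so the condition is [a cos t = t], that is [sin (2 t) = t], which is the
    equation of [alpha0]. That it suffices is a pairing with [sgn phi], for which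
    [hardy_annihilator] replaces an arbitrary orthogonal direction by monomials
    ([phi_hilbert_point_H1]). That it is necessary is seen along the single
    direction [a (z1^2 + z2^2) - 2 z1 z2]: a perturbation of [phi_a] in this
    direction is again a symmetric quadratic form, hence its sign is known, and
    convexity gives [a cos t >= t] or [a cos t <= t] according to the side of
    [a] on which [2 sin t] lies ([hilbert_point_H1_sign]). For [a >= 2] these
    inequalities fail near [t = pi / 2].

    In W. The dual norm of a symbol [psi = b (z1^2 + z2^2) + c z1 z2], with [b] and
    [c] nonnegative, is the norm of its Hankel form, namely the larger of
    [sqrt (2 b^2 + c^2)] and [b + c]. Symbols for which it is at most 1 give the
    lower bounds [|<f, psi>| <= ||f||_W] ([weak_norm_lower]); upper bounds come
    from explicit factorizations with at most two terms ([weak_norm_le2]). The symbol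
    [phi / ||phi||] is admissible exactly for [a <= 1/2], and then [phi] is both
    norm attaining and a Hilbert point. For [a > 1/2] the factorization that
    interpolates between [1 * phi_(1/2)] and [(z1 + z2)^2], or [(z1 + z2)^2] plus
    a multiple of [z1 z2] when [a >= 2], beats the L^2 norm. The Hankel form of
    [phi] has norm [1 + a] there and is normed by [(z1 + z2)^2]; hence a
    multiple of [(z1 + z2)^2], of weak norm at most [(2 + a^2) / (1 + a)], has the
    same projection as [phi] onto the span of [phi]. The symbols [(2/3, 1/3)]
    and [(0, 1)] show that [phi] itself has a larger norm unless [a = 2].

    The lower bound must be extracted from a series of products that converges
    only pointwise on the bidisc. Second differences at real points of size [r]
    read off the Taylor coefficients of degree two up to errors [O(r^3)] that are
    uniform relative to the products of the L^2 norms ([second_diff_product]),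
    so they can be summed before [r] tends to 0. *)

(** * The equation for alpha0 *)

Section Alpha0.
Variable R : realType.
Implicit Types x u v t : R.

(** The inverse factorial, by recursion so that it reduces to a short product of
    inverses: the unary numeral of 13! would be out of reach. *)
Fixpoint inv_fact (n : nat) : R :=
  if n is m.+1 then inv_fact m / n%:R else 1.

Let sin_poly (n : nat) : {poly R} :=
  \sum_(k < n) ((-1) ^+ k * inv_fact k.*2.+1) *: 'X^(k.*2.+1).
Let cos_poly (n : nat) : {poly R} :=
  \sum_(k < n) ((-1) ^+ k * inv_fact k.*2) *: 'X^(k.*2).

Lemma deriv_sin_poly n : (sin_poly n)^`() = cos_poly n.
Proof.
rewrite /sin_poly /cos_poly raddf_sum; apply: eq_bigr => k _ /=.
rewrite derivZ derivXn /= -scalerMnr scalerMnl -[_ *+ _]mulr_natr.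
by rewrite -!mulrA mulVf ?mulr1// pnatr_eq0.
Qed.

Lemma deriv_cos_poly n : (cos_poly n.+1)^`() = - sin_poly n.
Proof.
rewrite /sin_poly /cos_poly raddf_sum big_ord_recl /= derivZ expr0 derivC.
rewrite scaler0 add0r -sumrN; apply: eq_bigr => k _ /=.
rewrite derivZ derivXn -scalerMnr scalerMnl -mulr_natr doubleS -scaleNr.
rewrite -[bump 0 k]/(k.+1) exprS mulN1r !mulNr -!mulrA.
by rewrite mulVf ?mulr1// pnatr_eq0.
Qed.

Lemma le_of_derive_ge0 (f df : R -> R) :
  (forall x, is_derive x 1 f (df x)) -> (forall x, 0 <= x -> 0 <= df x) ->
  forall x, 0 <= x -> f 0 <= f x.
Proof.
move=> fdf df0 x x0; have [c cx] := MVT_segment x0 (fun y _ => fdf y)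
  (continuous_subspaceT (fun y => differentiable_continuous
     ((derivable1_diffP _ _).1 (@ex_derive _ _ _ _ _ _ _ (fdf y))))).
rewrite subr0 => /eqP; rewrite subr_eq => /eqP ->.
by rewrite lerDr mulr_ge0// df0// (itvP cx).
Qed.

Lemma sin_poly0 n : (sin_poly n).[0] = 0.
Proof.
rewrite /sin_poly horner_sum big1// => k _.
by rewrite hornerZ hornerXn expr0n mulr0.
Qed.

Lemma cos_poly0 n : (cos_poly n.+1).[0] = 1.
Proof.
rewrite /cos_poly big_ord_recl hornerD horner_sum big1 => [|k _].
  by rewrite hornerZ hornerXn addr0 !expr0 !mulr1.
by rewrite hornerZ hornerXn expr0n mulr0.
Qed.

(** The partial sums of the alternating series bracket the functions: integrating
    one inequality from 0 gives the next one. *)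
Lemma sin_cos_taylor n x : 0 <= x ->
  0 <= (-1) ^+ n.+1 * (cos x - (cos_poly n.+1).[x]) /\
  0 <= (-1) ^+ n.+1 * (sin x - (sin_poly n.+1).[x]).
Proof.
have sin_step k : (forall x, 0 <= x ->
    0 <= (-1) ^+ k * (cos x - (cos_poly k).[x])) ->
  forall x, 0 <= x -> 0 <= (-1) ^+ k * (sin x - (sin_poly k).[x]).
  move=> H y0 x0.
  have := @le_of_derive_ge0 (fun x => (-1) ^+ k *: (sin x - (sin_poly k).[x]))
    (fun x => (-1) ^+ k *: (cos x - (cos_poly k).[x])) _ H y0 x0.
  rewrite sin0 sin_poly0 subrr scaler0; apply => y.
  by rewrite -deriv_sin_poly; exact: is_deriveZ.
have cos_step k : (forall x, 0 <= x ->
    0 <= (-1) ^+ k * (sin x - (sin_poly k).[x])) ->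
  forall x, 0 <= x -> 0 <= (-1) ^+ k.+1 * (cos x - (cos_poly k.+1).[x]).
  move=> H y0 x0.
  have := @le_of_derive_ge0
    (fun x => (-1) ^+ k.+1 *: (cos x - (cos_poly k.+1).[x]))
    (fun x => (-1) ^+ k *: (sin x - (sin_poly k).[x])) _ H y0 x0.
  rewrite cos0 cos_poly0 subrr scaler0; apply => y.
  have -> : (-1) ^+ k *: (sin y - (sin_poly k).[y]) =
      (-1) ^+ k.+1 *: (- sin y - (cos_poly k.+1)^`().[y]) :> R.
    by rewrite deriv_cos_poly hornerN -opprD exprS mulN1r scalerN scaleNr opprK.
  exact: is_deriveZ.
elim: n x => [|n IH]; last first.
  have H := cos_step n.+1 (fun x hx => (IH x hx).2).
  by move=> x x0; split; [exact: H|exact: (sin_step n.+2 H)].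
have H x : 0 <= x -> 0 <= (-1) ^+ 1 * (cos x - (cos_poly 1).[x]).
  rewrite /cos_poly big_ord1 /= expr0 mul1r scale1r hornerC => _.
  by rewrite expr1 mulN1r opprB subr_ge0 cos_le1.
by move=> x x0; split; [exact: H|exact: (sin_step 1%N H)].
Qed.

Lemma sin_taylor_lower x : 0 <= x ->
  x * (1 - x ^+ 2 / 6 * (1 - x ^+ 2 / 20 * (1 - x ^+ 2 / 42 *
    (1 - x ^+ 2 / 72 * (1 - x ^+ 2 / 110))))) <= sin x.
Proof.
move=> x0; have [_] := sin_cos_taylor 5 x0.
rewrite /sin_poly !big_ord_recr big_ord0 !(hornerD, hornerZ, hornerXn, horner0) /=.
rewrite -[0.*2]/0%N -[1.*2]/2%N -[2.*2]/4%N -[3.*2]/6%N -[4.*2]/8%N -[5.*2]/10%N /=.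
lra.
Qed.

Lemma sin_taylor_upper x : 0 <= x ->
  sin x <= x * (1 - x ^+ 2 / 6 * (1 - x ^+ 2 / 20 * (1 - x ^+ 2 / 42 *
    (1 - x ^+ 2 / 72 * (1 - x ^+ 2 / 110 * (1 - x ^+ 2 / 156)))))).
Proof.
move=> x0; have [_] := sin_cos_taylor 6 x0.
rewrite /sin_poly !big_ord_recr big_ord0 !(hornerD, hornerZ, hornerXn, horner0) /=.
rewrite -[0.*2]/0%N -[1.*2]/2%N -[2.*2]/4%N -[3.*2]/6%N -[4.*2]/8%N -[5.*2]/10%N -[6.*2]/12%N /=.
lra.
Qed.

(** The solution is t = 0.947747..., with 2 sin t = 1.624206...; the fraction lies
    just below it and is chosen with a small denominator. *)
Lemma theta_lower : 399 / 421 <= sin (2 * (399 / 421)) :> R /\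
  162 * 10 ^+ 3 + 420 <= 2 * sin (399 / 421) * 10 ^+ 5 :> R.
Proof.
split.
  by apply: le_trans (sin_taylor_lower _); lra.
have : (162 * 10 ^+ 3 + 420) / 2 / 10 ^+ 5 <= sin (399 / 421) :> R.
  by apply: le_trans (sin_taylor_lower _); lra.
lra.
Qed.

(** The companion fraction just above the solution. *)
Lemma theta_upper : sin (2 * (526 / 555)) <= 526 / 555 :> R /\
  2 * sin (526 / 555) * 10 ^+ 5 < 162 * 10 ^+ 3 + 421 :> R.
Proof.
split.
  by apply: le_trans (sin_taylor_upper _) _; lra.
have : sin (526 / 555) < (162 * 10 ^+ 3 + 421) / 2 / 10 ^+ 5 :> R.
  by apply: le_lt_trans (sin_taylor_upper _) _; lra.
lra.
Qed.

(** By Rolle applied to [sin (2 x) - x] on [0, u] and [u, v], two solutions would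
    give two points where [cos (2 x) = 1/2] in an interval on which it is injective. *)
Lemma sin_double_uniq u v :
  0 < u < pi / 2 -> sin (2 * u) = u -> 0 < v < pi / 2 -> sin (2 * v) = v ->
  u = v.
Proof.
wlog uv : u v / u <= v => [W u0 us v0 vs|].
  by have [h|/ltW h] := leP u v; [exact: W|exact/esym/W].
move=> /andP[u0 up] us /andP[v0 vp] vs.
move: uv; rewrite le_eqVlt => /orP[/eqP //|uv].
have step x y : x < y -> sin (2 * x) = x -> sin (2 * y) = y ->
    exists2 z, x < z < y & cos (2 * z) = 1 / 2.
  move=> xy xs ys.
  have df (z : R) :
      is_derive z 1 (fun x : R => sin (2 *: x) - x) (2 * cos (2 * z) - 1).
    apply: is_deriveB; apply: (@is_derive_eq _ _ _ _ _ _ _ _ (is_derive1_comp _ _)).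
    by rewrite mulrC [_%:A]mulr1.
  have [||z zxy /@derive_val] := Rolle xy (fun z _ => @ex_derive _ _ _ _ _ _ _ (df z)).
  - apply: continuous_subspaceT => z.
    exact/differentiable_continuous/derivable1_diffP/(@ex_derive _ _ _ _ _ _ _ (df z)).
  - by rewrite -[2 *: x]/(2 * x) -[2 *: y]/(2 * y) xs ys !subrr.
  rewrite (@derive_val _ _ _ _ _ _ _ (df z)) => e.
  by exists z; [rewrite !(itvP zxy)|lra].
have [z1 /andP[z1l z1r] c1] : exists2 z, 0 < z < u & cos (2 * z) = 1 / 2.
  by apply: step => //; rewrite mulr0 sin0.
have [z2 /andP[z2l z2r] c2] := step _ _ uv us vs.
have : 2 * z1 = 2 * z2 by apply: cos_inj; rewrite ?c1 ?c2// in_itv/=; lra.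
lra.
Qed.

Lemma le_sin_01 x u : 0 <= x -> x <= u -> u <= 1 -> sin x <= sin u :> R.
Proof.
have pi1 : 1 <= pi / 2 :> R := pihalf_ge1 R.
move=> x0; rewrite le_eqVlt => /orP[/eqP -> //|xy] y1.
by apply: ltW; rewrite ltr_sin// in_itv/=; lra.
Qed.

Lemma exists_theta0 : exists t, [/\ 0 < t < pi / 2, sin (2 * t) = t &
  162 * 10 ^+ 3 + 420 <= 2 * sin t * 10 ^+ 5 < 162 * 10 ^+ 3 + 421].
Proof.
have n0 : 0 < 399 / 421 :> R by lra.
have n1 : 526 / 555 < 1 :> R by lra.
have n2 : 399 / 421 <= 526 / 555 :> R by lra.
have [l1 l2] := theta_lower; have [u1 u2] := theta_upper.
set a : R := 399 / 421 in n0 n2 l1 l2 *.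
set b : R := 526 / 555 in n1 n2 u1 u2 *.
pose f (x : R) : R := sin (2 *: x) - x.
have cf : {within `[a, b], continuous f}.
  apply: continuous_subspaceT => z; apply: continuousB; last exact: cvg_id.
  apply: (@continuous_comp _ _ _ (fun x : R => 2 *: x)).
    exact: scaler_continuous.
  exact: continuous_sin.
have f0 : Num.min (f a) (f b) <= 0 <= Num.max (f a) (f b).
  by rewrite ge_min le_max !subr_le0 !subr_ge0 l1 u1 orbT.
have [t tI /eqP] := IVT n2 cf f0.
rewrite subr_eq0 => /eqP ts; exists t; move: tI; rewrite in_itv/= => /andP[tl tu].
have t0 : 0 < t := lt_le_trans n0 tl; have t1 : t < 1 := le_lt_trans tu n1.
split => //; first by rewrite t0 (lt_le_trans t1)// pihalf_ge1.
apply/andP; split.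
  by apply: (le_trans l2); rewrite ler_pM2r ?ler_pM2l// ?le_sin_01// ltW.
apply: le_lt_trans u2; rewrite ler_pM2r ?ler_pM2l// ?le_sin_01// ltW//.
Qed.

Lemma alpha_eq_sin u : 0 < u < pi / 2 -> alpha_eq (2 * sin u) <-> sin (2 * u) = u.
Proof.
move=> /andP[u0 up].
have s0 : 0 < sin u by apply: sin_gt0_pihalf; rewrite u0.
have c0 : 0 < cos u by apply: cos_gt0_pihalf; lra.
rewrite /alpha_eq [2 * _ / 2]mulrC mulKf ?pnatr_eq0// sinK; last by rewrite in_itv/=; lra.
have -> : 4 - (2 * sin u) ^+ 2 = (2 * cos u) ^+ 2.
  by rewrite exprMn exprMn cos2sin2; ring.
rewrite sqrtr_sqr gtr0_norm ?mulr_gt0//.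
rewrite [2 * u]mulr_natl sin_mulr2n -[(cos u * sin u) *+ 2]mulr_natl.
have -> : 2 / (2 * sin u) * u = u / sin u by field; rewrite gt_eqF.
have s1 : sin u != 0 by rewrite gt_eqF.
split=> e.
  by rewrite mulrA e divfK.
by apply: (mulIf s1); rewrite divfK// -mulrA.
Qed.

Lemma exists_alpha0 : exists t, [/\ 0 < t < pi / 2, sin (2 * t) = t &
  [/\ 0 < 2 * sin t < 2, alpha_eq (2 * sin t),
  forall a, 0 < a < 2 -> alpha_eq a -> a = 2 * sin t &
  162 * 10 ^+ 3 + 420 <= 2 * sin t * 10 ^+ 5 < 162 * 10 ^+ 3 + 421]].
Proof.
have [t [t0 ts tn]] := exists_theta0; exists t; split => //; split => //.
- by lra.
- exact/alpha_eq_sin.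
move=> a a0 ae.
have a1 : -1 < a / 2 < 1 by lra.
have aE : a = 2 * sin (asin (a / 2)).
  rewrite asinK ?in_itv/=; last by lra.
  by rewrite mulrC divfK.
have b0 : 0 < asin (a / 2) < pi / 2.
  rewrite asin_ltpi2 ?andbT; last by lra.
  rewrite -(@ltr_sin R) ?in_itv/= ?asin_geNpi2 ?asin_lepi2 ?ltW//; try lra.
  by rewrite sin0 asinK ?in_itv/=; lra.
rewrite aE; congr (2 * sin _); apply: sin_double_uniq => //.
by apply/alpha_eq_sin; rewrite -?aE.
Qed.
End Alpha0.

(** * Bounded measurable functions *)

Section BoundedMeasurable.
Context d (T : measurableType d) (R : realType).
Implicit Types h k : T -> R.

Definition bounded_measurable h :=
  measurable_fun [set: T] h /\ exists M : R, forall x, `|h x| <= M.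

Lemma bounded_measurable_cst (r : R) : bounded_measurable (fun=> r).
Proof. by split; [exact: measurable_cst|exists `|r|]. Qed.

Lemma bounded_measurableD h k : bounded_measurable h -> bounded_measurable k ->
  bounded_measurable (fun x => h x + k x).
Proof.
move=> [mh [M hM]] [mk [N kN]]; split; first exact: measurable_funD.
by exists (M + N) => x; rewrite (le_trans (ler_normD _ _))// lerD.
Qed.

Lemma bounded_measurableN h : bounded_measurable h ->
  bounded_measurable (fun x => - h x).
Proof.
move=> [mh [M hM]]; split; first exact: measurableT_comp.
by exists M => x; rewrite normrN.
Qed.

Lemma bounded_measurableB h k : bounded_measurable h -> bounded_measurable k ->
  bounded_measurable (fun x => h x - k x).
Proof. by move=> bh bk; apply: bounded_measurableD => //; exact: bounded_measurableN. Qed.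

Lemma bounded_measurableM h k : bounded_measurable h -> bounded_measurable k ->
  bounded_measurable (fun x => h x * k x).
Proof.
move=> [mh [M hM]] [mk [N kN]]; split; first exact: measurable_funM.
by exists (M * N) => x; rewrite normrM ler_pM.
Qed.

Lemma bounded_measurable_integrable (mu : {measure set T -> \bar R}) D h :
  measurable D -> (mu D < +oo)%E -> bounded_measurable h ->
  mu.-integrable D (EFin \o h).
Proof.
move=> mD Dfin [mh [M hM]]; apply: measurable_bounded_integrable => //.
  exact: measurable_funTS.
exists M; split; first exact: num_real.
by move=> N MN x _; exact: le_trans (hM x) (ltW MN).
Qed.

End BoundedMeasurable.

(** * Periodic functions of one angle *)

Section OneDim.
Variable R : realType.
Notation mu := (@lebesgue_measure R).
Implicit Types (h : R -> R) (a b c : R).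

Lemma bounded_measurable_shift h c : bounded_measurable (h : measurableTypeR R -> R) ->
  bounded_measurable ((fun x => h (x + c)) : measurableTypeR R -> R).
Proof.
move=> [mh [M hM]]; split; last by exists M.
apply: measurableT_comp => //; exact: measurable_funD.
Qed.

Lemma lebesgue_measure_itv_fin a b : (mu `[a, b] < +oo)%E.
Proof. by rewrite lebesgue_measure_itv/=; case: ifPn => // _; rewrite -EFinB ltry. Qed.

(** Translation invariance: both measures agree on half-open intervals. *)
Lemma lebesgue_measure_shift c (A : set (measurableTypeR R)) : measurable A ->
  pushforward mu ((fun x => x + c) : _ -> measurableTypeR R) A = mu A.
Proof.
move=> mA; apply/esym.
have mphi : measurable_fun setT ((fun x => x + c) : measurableTypeR R -> measurableTypeR R).
  exact: measurable_funD.
pose mphi_mixin := isMeasurableFun.Build _ _ _ _ _ mphi.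
pose phi : {mfun _ >-> _} := HB.pack_for {mfun measurableTypeR R >-> measurableTypeR R}
  ((fun x => x + c) : measurableTypeR R -> measurableTypeR R) mphi_mixin.
apply: (@lebesgue_measure_unique R (pushforward mu phi)) => //= _ [[a b]] _ <-.
rewrite /pushforward/=.
rewrite (_ : _ @^-1` _ = `]a - c, b - c]%classic); last first.
  by apply/seteqP; split => x /=; rewrite !in_itv/= ltrBlDr lerBrDr.
rewrite !lebesgue_measure_itv/= !lte_fin ltrD2r -!EFinB.
by rewrite (_ : b - c - (a - c) = b - a)//; ring.
Qed.

Lemma Rintegral_shift h a b c : bounded_measurable (h : measurableTypeR R -> R) ->
  (\int[mu]_(x in `[a, b]) h (x + c) = \int[mu]_(x in `[a + c, b + c]) h x)%R.
Proof.
move=> bh; have [mh _] := bh; rewrite /Rintegral; congr fine.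
have pre : (fun x => x + c) @^-1` `[a + c, b + c] = `[a, b]%classic.
  by apply/seteqP; split => x /=; rewrite !in_itv/= !lerD2r.
have mphi : measurable_fun setT ((fun x => x + c) : measurableTypeR R -> measurableTypeR R).
  exact: measurable_funD.
rewrite -pre -(integral_pushforward mphi (f := EFin \o h))//=.
- by apply: eq_measure_integral => A mA _; exact: lebesgue_measure_shift.
- exact/measurable_EFinP.
rewrite pre; apply: bounded_measurable_integrable => //; first exact: lebesgue_measure_itv_fin.
exact: bounded_measurable_shift.
Qed.

Lemma Rintegral_itv_cat h a b c : bounded_measurable (h : measurableTypeR R -> R) ->
  a <= b -> b <= c ->
  (\int[mu]_(x in `[a, c]) h x =
   \int[mu]_(x in `[a, b]) h x + \int[mu]_(x in `[b, c]) h x)%R.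
Proof.
move=> bh ab bc.
have int x y : mu.-integrable `[x, y] (EFin \o h).
  by apply: bounded_measurable_integrable => //; exact: lebesgue_measure_itv_fin.
have int' : mu.-integrable `]b, c] (EFin \o h).
  by apply: integrableS (int b c) => //; exact: subset_itv_oc_cc.
have := @Rintegral_itvB R h (BLeft a) (BRight c) b (int a c).
rewrite !bnd_simp => /(_ ab bc) /eqP; rewrite subr_eq => /eqP ->.
by rewrite Rintegral_itv_obnd_cbnd// addrC.
Qed.

Definition arc_int h : R := Rintegral (@arc_measure R) setT h.

Lemma arc_measure_setT : @arc_measure R setT = 1%E.
Proof. exact: (@probability_setT _ _ _ (uniform_prob (twopi_gt0 R))). Qed.

Lemma arc_bounded_integrable h : bounded_measurable (h : measurableTypeR R -> R) ->
  (@arc_measure R).-integrable setT (EFin \o h).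
Proof.
by move=> bh; apply: bounded_measurable_integrable => //; rewrite [X in (X < _)%E]arc_measure_setT ltry.
Qed.

Lemma bounded_measurable_itv_integrable h a b :
  bounded_measurable (h : measurableTypeR R -> R) ->
  mu.-integrable `[a, b] (EFin \o h).
Proof. by move=> bh; apply: bounded_measurable_integrable => //; exact: lebesgue_measure_itv_fin. Qed.

Lemma arc_intE h : bounded_measurable (h : measurableTypeR R -> R) ->
  arc_int h = (2 * pi)^-1 * (\int[mu]_(x in `[0%R, (2 * pi)%R]) h x)%R.
Proof.
have pi0 : 0 < 2 * pi :> R := twopi_gt0 R.
have ge0E k : bounded_measurable (k : measurableTypeR R -> R) ->
    (forall x, 0 <= k x) ->
    arc_int k = (2 * pi)^-1 * (\int[mu]_(x in `[0%R, (2 * pi)%R]) k x)%R.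
  move=> bk k0; have [mk _] := bk.
  have ik := bounded_measurable_itv_integrable 0 (2 * pi) bk.
  rewrite /arc_int /Rintegral (@integral_uniform R 0 (2 * pi)); last 2 first.
  - exact/measurable_EFinP.
  - by move=> x; rewrite lee_fin.
  by rewrite subr0 fineM// (integrable_fin_num _ ik).
move=> bh; have [mh [M hM]] := bh.
have M0 : 0 <= M := le_trans (normr_ge0 _) (hM 0).
have bM := bounded_measurable_cst (measurableTypeR R) M.
(* adding the bound reduces the statement to nonnegative functions *)
have := ge0E _ (bounded_measurableD bh bM).
have hM0 x : 0 <= h x + M by have := hM x; rewrite ler_norml => /andP[? _]; lra.
move=> /(_ hM0); rewrite /arc_int RintegralD//; try exact: arc_bounded_integrable.
rewrite RintegralD//; try exact: bounded_measurable_itv_integrable.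
have -> : (\int[@arc_measure R]_(x in setT) M)%R = M.
  rewrite Rintegral_cst// [fine _](_ : _ = 1) ?mulr1//.
  exact: (congr1 fine arc_measure_setT).
have -> : (\int[mu]_(x in `[0%R, (2 * pi)%R]) M)%R = M * (2 * pi).
  by rewrite Rintegral_cst//= lebesgue_measure_itv/= lte_fin pi0/= subr0.
have pi1 : 2 * pi != 0 :> R by rewrite gt_eqF.
have cancel (x p : R) : p != 0 -> p^-1 * (x + M * p) = p^-1 * x + M.
  by move=> p0; field.
rewrite (cancel _ _ pi1); exact: addIr.
Qed.

(** Cut the shifted period at [2 pi] and move the part beyond it back by a period. *)
Lemma arc_int_shift_nneg h c : bounded_measurable (h : measurableTypeR R -> R) ->
  (forall x, h (x + 2 * pi) = h x) -> 0 <= c <= 2 * pi ->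
  arc_int (fun x => h (x + c)) = arc_int h.
Proof.
move=> bh per /andP[c0 c2].
rewrite !arc_intE//; last exact: bounded_measurable_shift.
congr (_ * _); rewrite Rintegral_shift// add0r (addrC _ c).
rewrite (@Rintegral_itv_cat _ _ (2 * pi))//; last by rewrite lerDr.
rewrite (@Rintegral_itv_cat _ 0 c)// [RHS]addrC; congr (_ + _).
have := @Rintegral_shift h 0 c (2 * pi) bh; rewrite add0r => <-.
by apply: eq_Rintegral => x _; rewrite per.
Qed.

Lemma periodic_int (f : R -> R) (k : int) x :
  (forall x, f (x + 2 * pi) = f x) -> f (x + k%:~R * (2 * pi)) = f x.
Proof.
move=> per.
have P n y : f (y + n%:R * (2 * pi)) = f y.
  elim: n y => [|n IH] y; first by rewrite mul0r addr0.
  by rewrite -natr1 mulrDl addrA mul1r per IH.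
case: k => n; first exact: P.
by rewrite NegzE mulrNz mulNr -[in RHS](subrK (n.+1%:~R * (2 * pi)) x) P.
Qed.

Lemma arc_int_shift h c : bounded_measurable (h : measurableTypeR R -> R) ->
  (forall x, h (x + 2 * pi) = h x) -> arc_int (fun x => h (x + c)) = arc_int h.
Proof.
move=> bh per; have pi0 : 0 < 2 * pi :> R := twopi_gt0 R.
pose k := Num.floor (c / (2 * pi)).
have k1 : k%:~R * (2 * pi) <= c by rewrite -ler_pdivlMr// floor_le_tmp.
have k2 : c < (k%:~R + 1) * (2 * pi).
  by rewrite -ltr_pdivrMr// -[1]/(1%:~R) -intrD floorD1_gt.
rewrite -(@arc_int_shift_nneg _ (c - k%:~R * (2 * pi)) bh per); last first.
  by rewrite subr_ge0 k1 ltW// ltrBlDl -[X in _ + X]mul1r -mulrDl.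
congr arc_int; apply/funext => x.
by rewrite -[RHS](periodic_int k _ per) -addrA subrK.
Qed.

Lemma arc_int_cst c : arc_int (fun=> c) = c.
Proof.
rewrite /arc_int Rintegral_cst// [fine _](_ : _ = 1) ?mulr1//.
exact: (congr1 fine arc_measure_setT).
Qed.

Lemma Rintegral_FTC (f F : R -> R) a b : a <= b -> continuous f ->
  (forall x : R, is_derive x 1 F (f x)) ->
  (\int[mu]_(x in `[a, b]) f x)%R = F b - F a.
Proof.
move=> ab cf dF; move: ab; rewrite le_eqVlt => /orP[/eqP ->|ab].
  by rewrite subrr set_itv1 Rintegral_set1.
have cF : continuous F.
  by move=> x; apply/differentiable_continuous/derivable1_diffP; exact: ex_derive.
rewrite /Rintegral (@continuous_FTC2 _ _ F)//.
- exact: continuous_subspaceT.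
- split.
  + by move=> x _; exact: ex_derive.
  + by apply: cvg_at_right_filter; exact: cF.
  + by apply: cvg_at_left_filter; exact: cF.
- by move=> x _; rewrite derive1E; exact: derive_val.
Qed.

Lemma is_derive_sinM (m x : R) : is_derive x 1 (fun x : R => sin (m * x)) (m * cos (m * x)).
Proof.
have d : is_derive x 1 (fun x : R => sin (m *: x)) (m * cos (m * x)) => //.
apply: (@is_derive_eq _ _ _ _ _ _ _ _ (is_derive1_comp _ _)).
by rewrite mulrC [_%:A]mulr1.
Qed.

Lemma is_derive_cosM (m x : R) : is_derive x 1 (fun x : R => cos (m * x)) (- (m * sin (m * x))).
Proof.
have d : is_derive x 1 (fun x : R => cos (m *: x)) (- (m * sin (m * x))) => //.
apply: (@is_derive_eq _ _ _ _ _ _ _ _ (is_derive1_comp _ _)).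
by rewrite [_%:A]mulr1 mulNr mulrC.
Qed.

Lemma bounded_measurable_cos : bounded_measurable (cos : measurableTypeR R -> R).
Proof.
split; last by exists 1; exact: cos_max.
by apply: continuous_measurable_fun; exact: continuous_cos.
Qed.

Lemma bounded_measurable_sin : bounded_measurable (sin : measurableTypeR R -> R).
Proof.
split; last by exists 1; exact: sin_max.
by apply: continuous_measurable_fun; exact: continuous_sin.
Qed.

Lemma continuous_cosM (m : R) : continuous (fun x : R => cos (m * x)).
Proof.
by move=> x; apply/differentiable_continuous/derivable1_diffP;
  exact: (@ex_derive _ _ _ _ _ _ _ (is_derive_cosM m x)).
Qed.

Lemma continuous_sinM (m : R) : continuous (fun x : R => sin (m * x)).
Proof.
by move=> x; apply/differentiable_continuous/derivable1_diffP;
  exact: (@ex_derive _ _ _ _ _ _ _ (is_derive_sinM m x)).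
Qed.

Lemma Rintegral_cosM (m : R) a b : m != 0 -> a <= b ->
  (\int[mu]_(x in `[a, b]) cos (m * x))%R = (sin (m * b) - sin (m * a)) / m.
Proof.
move=> m0 ab.
have dF (x : R) : is_derive x 1 (fun x : R => m^-1 *: sin (m * x)) (cos (m * x)).
  have d := is_derive_sinM m x.
  by apply: is_derive_eq; rewrite scalerA mulVf// scale1r.
by rewrite (Rintegral_FTC ab (@continuous_cosM m) dF) -mulrBr mulrC.
Qed.

Lemma Rintegral_sinM (m : R) a b : m != 0 -> a <= b ->
  (\int[mu]_(x in `[a, b]) sin (m * x))%R = (cos (m * a) - cos (m * b)) / m.
Proof.
move=> m0 ab.
have dF (x : R) : is_derive x 1 (fun x : R => (- m^-1) *: cos (m * x)) (sin (m * x)).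
  have d := is_derive_cosM m x.
  by apply: is_derive_eq; rewrite scaleNr scalerN opprK scalerA mulVf// scale1r.
rewrite (Rintegral_FTC ab (@continuous_sinM m) dF).
by rewrite -mulrBr mulrC mulrN -mulNr opprB.
Qed.

Lemma cos_2pi x : cos (x + 2 * pi) = cos x :> R.
Proof. by rewrite mulr_natl cosD2pi. Qed.

Lemma sin_2pi x : sin (x + 2 * pi) = sin x :> R.
Proof. by rewrite mulr_natl sinD2pi. Qed.

Lemma bounded_measurable_cosM (m : R) :
  bounded_measurable ((fun x => cos (m * x)) : measurableTypeR R -> R).
Proof.
split; last by exists 1 => x; exact: cos_max.
by apply: continuous_measurable_fun; exact: continuous_cosM.
Qed.

Lemma bounded_measurable_sinM (m : R) :
  bounded_measurable ((fun x => sin (m * x)) : measurableTypeR R -> R).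
Proof.
split; last by exists 1 => x; exact: sin_max.
by apply: continuous_measurable_fun; exact: continuous_sinM.
Qed.

Lemma arc_int_cosM (k : int) : arc_int (fun x => cos (k%:~R * x)) = (k == 0)%:R.
Proof.
have [->|k0] := eqVneq k 0.
  by rewrite -[RHS]arc_int_cst; congr arc_int; apply/funext => x; rewrite mul0r cos0.
have kR : k%:~R != 0 :> R by rewrite intr_eq0.
rewrite arc_intE; last exact: bounded_measurable_cosM.
rewrite Rintegral_cosM//; last exact: ltW (twopi_gt0 R).
rewrite -[_ * (2 * pi)]add0r (periodic_int _ _ sin_2pi) mulr0.
by rewrite subrr mul0r mulr0.
Qed.

Lemma arc_int_sinM (k : int) : arc_int (fun x => sin (k%:~R * x)) = 0.
Proof.
have [->|k0] := eqVneq k 0.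
  by rewrite -[RHS]arc_int_cst; congr arc_int; apply/funext => x; rewrite mul0r sin0.
have kR : k%:~R != 0 :> R by rewrite intr_eq0.
rewrite arc_intE; last exact: bounded_measurable_sinM.
rewrite Rintegral_sinM//; last exact: ltW (twopi_gt0 R).
rewrite -[_ * (2 * pi)]add0r (periodic_int _ _ cos_2pi) mulr0.
by rewrite subrr mul0r mulr0.
Qed.
End OneDim.

(** * Fourier coefficients of the sign of a shifted cosine *)

Section SignIntegrals.
Variable R : realType.
Notation mu := (@lebesgue_measure R).
Implicit Types (h : R -> R) (a b c : R).

(** Endpoints are negligible, which disposes of the zeros of the sign function. *)
Lemma eq_Rintegral_oo (f g : R -> R) a b :
  bounded_measurable (f : measurableTypeR R -> R) ->
  bounded_measurable (g : measurableTypeR R -> R) ->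
  (forall x, a < x < b -> f x = g x) ->
  (\int[mu]_(x in `[a, b]) f x = \int[mu]_(x in `[a, b]) g x)%R.
Proof.
move=> bf bg fg.
have E h : bounded_measurable (h : measurableTypeR R -> R) ->
    (\int[mu]_(x in `[a, b]) h x = \int[mu]_(x in `]a, b[) h x)%R.
  move=> bh; have ih := bounded_measurable_itv_integrable a b bh.
  rewrite -Rintegral_itv_obnd_cbnd; last first.
    by apply: integrableS ih => //; exact: subset_itv_oc_cc.
  rewrite Rintegral_itv_bndo_bndc//.
  by apply: integrableS ih => //; exact: subset_itv_oo_cc.
rewrite !E//; apply: eq_Rintegral => x; rewrite inE/= in_itv/=; exact: fg.
Qed.

(** The sign of [phi_a / (z1 z2)] for [a = 2 sin t]; this choice of parameter puts
    its zeros at [x = pi / 2 + t] and [x = - (pi / 2 + t)]. *)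
Definition sign_cos (t x : R) : R := Num.sg (2 * sin t + 2 * cos x).

Lemma bounded_measurable_sg d (T : measurableType d) (u : T -> R) :
  measurable_fun setT u -> bounded_measurable (fun x => Num.sg (u x)).
Proof.
move=> mu; split.
  apply: (@measurableT_comp _ _ _ _ _ _ (@Num.sg R)) => //.
  apply: nondecreasing_measurable => // x y xy.
  have [x0|x0|x0] := ltgtP x 0; have [y0|y0|y0] := ltgtP y 0;
    rewrite ?(ltr0_sg x0) ?(gtr0_sg x0) ?x0 ?(ltr0_sg y0) ?(gtr0_sg y0) ?y0 ?sgr0;
    lra.
exists 1 => x; rewrite normr_sg; case: (_ != 0) => //=; exact: ler01.
Qed.

Lemma bounded_measurable_sign_cos t :
  bounded_measurable (sign_cos t : measurableTypeR R -> R).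
Proof.
apply: bounded_measurable_sg; apply: measurable_funD => //.
by apply: measurable_funM => //; exact: (bounded_measurable_cos R).1.
Qed.

Lemma sign_cos_2pi t x : sign_cos t (x + 2 * pi) = sign_cos t x.
Proof. by rewrite /sign_cos cos_2pi. Qed.

Lemma sign_cos1 t x : - (pi / 2) < t < pi / 2 ->
  - (pi / 2 + t) < x < pi / 2 + t -> sign_cos t x = 1.
Proof.
move=> /andP[t1 t2] /andP[x1 x2]; apply: gtr0_sg.
have : cos (pi / 2 + t) < cos `|x|.
  rewrite ltr_cos; first by rewrite ltr_norml x1 x2.
  - rewrite in_itv/= normr_ge0 ler_norml; lra.
  - rewrite in_itv/=; lra.
rewrite cos_norm addrC cosDpihalf; lra.
Qed.

Lemma sign_cosN1 t x : - (pi / 2) < t < pi / 2 ->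
  pi / 2 + t < x < - (pi / 2 + t) + 2 * pi -> sign_cos t x = -1.
Proof.
move=> /andP[t1 t2] /andP[x1 x2]; apply: ltr0_sg.
have : cos (pi / 2 - t) < cos `|x - pi|.
  rewrite ltr_cos; first by rewrite ltr_norml; lra.
  - rewrite in_itv/= normr_ge0 ler_norml; lra.
  - rewrite in_itv/=; lra.
have -> : cos `|x - pi| = - cos x.
  by rewrite cos_norm cosB cospi sinpi mulr0 addr0 mulrN1.
rewrite [pi / 2 - t]addrC cosDpihalf sinN; lra.
Qed.

Lemma arc_int_sign_cos t h (H : R -> R) : - (pi / 2) < t < pi / 2 ->
  continuous h -> (forall x : R, is_derive x 1 H (h x)) ->
  bounded_measurable (h : measurableTypeR R -> R) ->
  (forall x, h (x + 2 * pi) = h x) ->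
  arc_int (fun x => sign_cos t x * h x) =
  (2 * pi)^-1 * (2 * H (pi / 2 + t) - H (- (pi / 2 + t))
    - H (- (pi / 2 + t) + 2 * pi)).
Proof.
move=> tb ch dH bh per.
have bs := bounded_measurableM (bounded_measurable_sign_cos t) bh.
set p := pi / 2 + t.
(* start the period at a zero, so that the sign changes only once in it *)
rewrite -(@arc_int_shift _ _ (- p) bs); last first.
  by move=> x; rewrite sign_cos_2pi per.
rewrite arc_intE; last exact: (bounded_measurable_shift (- p) bs).
rewrite (Rintegral_shift _ _ _ bs) add0r; congr (_ * _).
have pi0 := @pi_gt0 R.
have [t1 t2] := andP tb.
rewrite (@Rintegral_itv_cat _ _ _ p) //; try by rewrite /p; lra.
have bNh := bounded_measurableN bh.
rewrite (@eq_Rintegral_oo _ h _ _ bs bh); last first.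
  by move=> x xp; rewrite sign_cos1// mul1r.
rewrite (@eq_Rintegral_oo _ (fun x => - h x) _ _ bs bNh); last first.
  by move=> x xp; rewrite sign_cosN1 ?mulN1r// -/p [- p + _]addrC.
have dNH (x : R) : is_derive x 1 (fun x => - H x) (- h x) by exact: is_deriveN.
have cNh : continuous (fun x => - h x) by move=> x; apply: continuousN; exact: ch.
rewrite (Rintegral_FTC _ ch dH) ?(Rintegral_FTC _ cNh dNH); try by rewrite /p; lra.
by rewrite addrC [2 * pi + _]addrC; ring.
Qed.

Lemma arc_int_sign t : - (pi / 2) < t < pi / 2 ->
  arc_int (sign_cos t) = 2 * t / pi.
Proof.
move=> tb; transitivity (arc_int (fun x => sign_cos t x * (1 : R))).
  by congr arc_int; apply/funext => x; rewrite mulr1.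
rewrite (@arc_int_sign_cos t (fun=> 1) id)//.
- move: (lt0r_neq0 (pi_gt0 R)); generalize (@pi R) => p p0; field; exact: p0.
- by move=> ?; exact: cvg_cst.
- exact: bounded_measurable_cst.
Qed.

Lemma arc_int_sign_cosM1 t : - (pi / 2) < t < pi / 2 ->
  arc_int (fun x => sign_cos t x * cos x) = 2 * cos t / pi.
Proof.
move=> tb; rewrite (@arc_int_sign_cos t cos sin)//.
- rewrite sin_2pi sinN [pi / 2 + t]addrC sinDpihalf.
  move: (lt0r_neq0 (pi_gt0 R)); generalize (@pi R) => p p0; field; exact: p0.
- exact: continuous_cos.
- exact: bounded_measurable_cos.
- exact: cos_2pi.
Qed.

Lemma arc_int_sign_sinM1 t : - (pi / 2) < t < pi / 2 ->
  arc_int (fun x => sign_cos t x * sin x) = 0.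
Proof.
move=> tb.
have dH (x : R) : is_derive x 1 (fun x : R => - cos x) (sin x).
  by apply: is_derive_eq; rewrite opprK.
have bs := bounded_measurable_sin R.
rewrite (arc_int_sign_cos tb (@continuous_sin R) dH bs (@sin_2pi R)).
by rewrite cos_2pi cosN; ring.
Qed.

End SignIntegrals.

Section ArcLinear.
Variable R : realType.
Implicit Types (h k : R -> R) (c : R).

Lemma arc_intZ c h : bounded_measurable (h : measurableTypeR R -> R) ->
  arc_int (fun x => c * h x) = c * arc_int h.
Proof. by move=> bh; rewrite /arc_int RintegralZl//; exact: arc_bounded_integrable. Qed.

Lemma arc_intZr c h : bounded_measurable (h : measurableTypeR R -> R) ->
  arc_int (fun x => h x * c) = arc_int h * c.
Proof. by move=> bh; rewrite /arc_int RintegralZr//; exact: arc_bounded_integrable. Qed.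

Lemma arc_intD h k : bounded_measurable (h : measurableTypeR R -> R) ->
  bounded_measurable (k : measurableTypeR R -> R) ->
  arc_int (fun x => h x + k x) = arc_int h + arc_int k.
Proof. by move=> bh bk; rewrite /arc_int RintegralD//; exact: arc_bounded_integrable. Qed.
End ArcLinear.

(** * Integration over the torus *)

Section TorusInt.
Variable R : realType.
Notation T := (measurableTypeR R * measurableTypeR R)%type.
Implicit Types (u v : T -> R) (h : R -> R).

Definition torus_int u : R := Rintegral (@torus_measure R) setT u.

Definition torus_integrable u : Prop :=
  (@torus_measure R).-integrable setT (EFin \o u).

Lemma torus_measure_setT : @torus_measure R setT = 1%E.
Proof.
rewrite -setXTT.
have := @product_measure1E _ _ _ _ R (uniform_prob (twopi_gt0 R)) (uniform_prob (twopi_gt0 R)) setT setT measurableT measurableT.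
move=> H; apply: (etrans H); transitivity (1 * 1 : \bar R)%E; last exact: mule1.
exact: (congr2 (@mule R) (arc_measure_setT R) (arc_measure_setT R)).
Qed.

Lemma bounded_measurable_torus_integrable u : bounded_measurable u -> torus_integrable u.
Proof.
move=> bu; apply: bounded_measurable_integrable => //.
by rewrite [X in (X < _)%E]torus_measure_setT ltry.
Qed.

Lemma torus_int_cst c : torus_int (fun=> c) = c.
Proof.
rewrite /torus_int Rintegral_cst// [fine _](_ : _ = 1) ?mulr1//.
exact: (congr1 fine torus_measure_setT).
Qed.

Lemma torus_intD u v : torus_integrable u -> torus_integrable v ->
  torus_int (fun x => u x + v x) = torus_int u + torus_int v.
Proof. by move=> iu iv; rewrite /torus_int RintegralD. Qed.

Lemma torus_intZ c u : torus_integrable u ->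
  torus_int (fun x => c * u x) = c * torus_int u.
Proof. by move=> iu; rewrite /torus_int RintegralZl. Qed.

Lemma torus_int_le u v : torus_integrable u -> torus_integrable v ->
  (forall x, u x <= v x) -> torus_int u <= torus_int v.
Proof. by move=> iu iv uv; apply: le_Rintegral. Qed.

Lemma bounded_measurable_slice u y : bounded_measurable u ->
  bounded_measurable (fun x => u (x, y)).
Proof.
move=> [mu [M uM]]; split; last by exists M.
exact: measurable_fun_pair1.
Qed.

Lemma torus_int_fubini u : bounded_measurable u ->
  torus_int u = arc_int (fun y => arc_int (fun x => u (x, y))).
Proof.
move=> bu; have iu := bounded_measurable_torus_integrable bu.
have [mu [M uM]] := bu.
rewrite /torus_int /arc_int {1}/Rintegral.
have := @integral21_prod_meas1 _ _ _ _ R (uniform_prob (twopi_gt0 R)) (uniform_prob (twopi_gt0 R)) (EFin \o u) iu.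
move=> <-.
rewrite /Rintegral; congr fine; apply: eq_integral => y _.
rewrite fineK//; apply: integrable_fin_num => //; apply: arc_bounded_integrable.
exact: bounded_measurable_slice.
Qed.

Lemma bounded_measurable_fst h : bounded_measurable (h : measurableTypeR R -> R) ->
  bounded_measurable (fun t : T => h t.1).
Proof.
move=> [mh [M hM]]; split; last by exists M.
exact: measurableT_comp.
Qed.

Lemma bounded_measurable_snd h : bounded_measurable (h : measurableTypeR R -> R) ->
  bounded_measurable (fun t : T => h t.2).
Proof.
move=> [mh [M hM]]; split; last by exists M.
exact: measurableT_comp.
Qed.

Lemma bounded_measurable_sub h : bounded_measurable (h : measurableTypeR R -> R) ->
  bounded_measurable (fun t : T => h (t.1 - t.2)).
Proof.
move=> [mh [M hM]]; split; last by exists M.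
by apply: measurableT_comp => //; exact: measurable_funB.
Qed.

Lemma bounded_measurable_lin (m n : R) h : bounded_measurable (h : measurableTypeR R -> R) ->
  bounded_measurable (fun t : T => h (m * t.1 + n * t.2)).
Proof.
move=> [mh [M hM]]; split; last by exists M.
by apply: measurableT_comp => //; apply: measurable_funD; apply: measurable_funM.
Qed.

(** Recentring the inner variable turns the phase [m x + n y] into
    [m x + (m + n) y] and frees the other factor of [y]. *)
Lemma arc_int_slice (w : R -> R) (m n : int) h y :
  bounded_measurable (w : measurableTypeR R -> R) ->
  bounded_measurable (h : measurableTypeR R -> R) ->
  (forall x, w (x + 2 * pi) = w x) -> (forall x, h (x + 2 * pi) = h x) ->
  arc_int (fun x => w (m%:~R * x + n%:~R * y) * h (x - y)) =
  arc_int (fun x => w (m%:~R * x + (m + n)%:~R * y) * h x).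
Proof.
move=> [mw [M wM]] bh perw perh.
set g := (fun x => w (m%:~R * x + (m + n)%:~R * y) * h x).
have bg : bounded_measurable (g : measurableTypeR R -> R).
  apply: bounded_measurableM => //; split; last by exists M.
  by apply: measurableT_comp => //; apply: measurable_funD => //; exact: measurable_funM.
have pg x : g (x + 2 * pi) = g x.
  rewrite /g perh mulrDr addrAC; congr (_ * _).
  exact: periodic_int.
rewrite -(arc_int_shift (- y) bg pg); congr arc_int; apply/funext => x.
by rewrite /g; congr (w _ * _); rewrite intrD; ring.
Qed.

(** The mean over the diagonal direction vanishes unless the two frequencies are
    opposite, and then one angle remains. *)
Lemma torus_int_cos (m n : int) h : bounded_measurable (h : measurableTypeR R -> R) ->
  (forall x, h (x + 2 * pi) = h x) ->
  torus_int (fun t => cos (m%:~R * t.1 + n%:~R * t.2) * h (t.1 - t.2)) =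
  (m + n == 0)%:R * arc_int (fun x => cos (m%:~R * x) * h x).
Proof.
move=> bh per; have ccos := bounded_measurable_cos R.
have bc := bounded_measurableM (bounded_measurable_cosM m%:~R) bh.
have bs := bounded_measurableM (bounded_measurable_sinM m%:~R) bh.
set A := arc_int _; pose B := arc_int (fun x => sin (m%:~R * x) * h x).
rewrite torus_int_fubini; last first.
  apply: bounded_measurableM; last exact: bounded_measurable_sub.
  exact: (bounded_measurable_lin _ _ ccos).
have bcst c (f : measurableTypeR R -> R) : bounded_measurable f ->
    bounded_measurable (fun x => c * f x).
  by move=> bf; apply: bounded_measurableM => //; exact: bounded_measurable_cst.
have bck := bcst A _ (bounded_measurable_cosM (m + n)%:~R).
have bsk := bcst (- B) _ (bounded_measurable_sinM (m + n)%:~R).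
transitivity (arc_int (fun y => A * cos ((m + n)%:~R * y) + - B * sin ((m + n)%:~R * y))).
  congr arc_int; apply/funext => y /=.
  rewrite (arc_int_slice m n y ccos bh (@cos_2pi R) per) /A /B.
  rewrite mulNr -mulrN -!arc_intZr// -arc_intD; try (under [X in bounded_measurable X]eq_fun do rewrite mulrC; exact: bcst).
  by congr arc_int; apply/funext => x; rewrite cosD; ring.
rewrite arc_intD// !arc_intZ; try exact: bounded_measurable_cosM;
  try exact: bounded_measurable_sinM.
by rewrite arc_int_cosM arc_int_sinM mulr0 addr0 mulrC.
Qed.

Lemma torus_int_sin (m n : int) h : bounded_measurable (h : measurableTypeR R -> R) ->
  (forall x, h (x + 2 * pi) = h x) ->
  torus_int (fun t => sin (m%:~R * t.1 + n%:~R * t.2) * h (t.1 - t.2)) =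
  (m + n == 0)%:R * arc_int (fun x => sin (m%:~R * x) * h x).
Proof.
move=> bh per; have csin := bounded_measurable_sin R.
have bc := bounded_measurableM (bounded_measurable_cosM m%:~R) bh.
have bs := bounded_measurableM (bounded_measurable_sinM m%:~R) bh.
set B := arc_int _; pose A := arc_int (fun x => cos (m%:~R * x) * h x).
rewrite torus_int_fubini; last first.
  apply: bounded_measurableM; last exact: bounded_measurable_sub.
  exact: (bounded_measurable_lin _ _ csin).
have bcst c (f : measurableTypeR R -> R) : bounded_measurable f ->
    bounded_measurable (fun x => c * f x).
  by move=> bf; apply: bounded_measurableM => //; exact: bounded_measurable_cst.
have bck := bcst B _ (bounded_measurable_cosM (m + n)%:~R).
have bsk := bcst A _ (bounded_measurable_sinM (m + n)%:~R).
transitivity (arc_int (fun y => B * cos ((m + n)%:~R * y) + A * sin ((m + n)%:~R * y))).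
  congr arc_int; apply/funext => y /=.
  rewrite (arc_int_slice m n y csin bh (@sin_2pi R) per) /A /B.
  rewrite -!arc_intZr// -arc_intD; try (under [X in bounded_measurable X]eq_fun do rewrite mulrC; exact: bcst).
  by congr arc_int; apply/funext => x; rewrite sinD; ring.
rewrite arc_intD// !arc_intZ; try exact: bounded_measurable_cosM;
  try exact: bounded_measurable_sinM.
by rewrite arc_int_cosM arc_int_sinM mulr0 addr0 mulrC.
Qed.
End TorusInt.

(** * Complex-valued functions and their integrals *)

Section ComplexBasics.
Variable R : realType.
Notation C := R[i].
Implicit Types x y : C.

Lemma ReD x y : complex.Re (x + y) = complex.Re x + complex.Re y.
Proof. by case: x y => [a b] [c d]. Qed.
Lemma ImD x y : complex.Im (x + y) = complex.Im x + complex.Im y.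
Proof. by case: x y => [a b] [c d]. Qed.
Lemma ReN x : complex.Re (- x) = - complex.Re x.
Proof. by case: x => [a b]. Qed.
Lemma ImN x : complex.Im (- x) = - complex.Im x.
Proof. by case: x => [a b]. Qed.
Lemma ReM x y : complex.Re (x * y) =
  complex.Re x * complex.Re y - complex.Im x * complex.Im y.
Proof. by case: x y => [a b] [c d]. Qed.
Lemma ImM x y : complex.Im (x * y) =
  complex.Re x * complex.Im y + complex.Im x * complex.Re y.
Proof. by case: x y => [a b] [c d]. Qed.
Lemma Re_conj x : complex.Re (conjc x) = complex.Re x.
Proof. by case: x. Qed.
Lemma Im_conj x : complex.Im (conjc x) = - complex.Im x.
Proof. by case: x. Qed.
Lemma complex_ext x y : complex.Re x = complex.Re y ->
  complex.Im x = complex.Im y -> x = y.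
Proof. by case: x y => [a b] [c d] /= -> ->. Qed.

Lemma normc_sqr x : normc x ^+ 2 = complex.Re x ^+ 2 + complex.Im x ^+ 2.
Proof. by case: x => a b /=; rewrite sqr_sqrtr// addr_ge0 ?sqr_ge0. Qed.

Lemma normc_ge0 x : 0 <= normc x.
Proof. by case: x => a b; exact: sqrtr_ge0. Qed.

Lemma normc_conj x : normc (conjc x) = normc x.
Proof. by case: x => a b /=; rewrite sqrrN. Qed.

Lemma normcX x n : normc (x ^+ n) = normc x ^+ n.
Proof. by elim: n => [|n IH]; rewrite ?normc1// !exprS normcM IH. Qed.

Lemma normc_real (r : R) : normc (real_complex R r) = `|r|.
Proof. by rewrite /= expr0n addr0 sqrtr_sqr. Qed.

Lemma Re_normc x : `|complex.Re x| <= normc x.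
Proof.
by rewrite -(ler_pXn2r (_ : (0 < 2)%N)) ?nnegrE ?normc_ge0// normc_sqr
  real_normK ?num_real// lerDl sqr_ge0.
Qed.

Lemma Im_normc x : `|complex.Im x| <= normc x.
Proof.
by rewrite -(ler_pXn2r (_ : (0 < 2)%N)) ?nnegrE ?normc_ge0// normc_sqr
  real_normK ?num_real// lerDr sqr_ge0.
Qed.

Lemma normc_le_ReIm x : normc x <= `|complex.Re x| + `|complex.Im x|.
Proof.
rewrite -(ler_pXn2r (_ : (0 < 2)%N)) ?nnegrE ?normc_ge0 ?addr_ge0// normc_sqr.
rewrite sqrrD !real_normK ?num_real//.
by rewrite addrAC lerDl mulrn_wge0// mulr_ge0.
Qed.

Lemma expiD (s t : R) : expi (s + t) = expi s * expi t.
Proof.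
by apply: complex_ext; rewrite ?ReM ?ImM /= ?cosD ?sinD//; rewrite addrC [X in _ + X]mulrC.
Qed.

Lemma conj_expi (s : R) : conjc (expi s) = expi (- s).
Proof. by rewrite /expi /= cosN sinN. Qed.

Lemma expi0 : expi (0 : R) = 1.
Proof. by rewrite /expi cos0 sin0. Qed.

Lemma expiX (s : R) n : expi s ^+ n = expi (n%:R * s).
Proof.
elim: n => [|n IH]; first by rewrite mul0r expi0.
by rewrite exprS IH -expiD -natr1 mulrDl mul1r addrC.
Qed.

Lemma normc_expi (s : R) : normc (expi s) = 1.
Proof. by rewrite /= cos2Dsin2 sqrtr1. Qed.

End ComplexBasics.

Section ComplexIntegral.
Variable R : realType.
Notation C := R[i].
Notation T := (measurableTypeR R * measurableTypeR R)%type.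
Implicit Types (F G : T -> C) (c : C).

Definition cmeasurable F : Prop :=
  measurable_fun [set: T] (fun t => complex.Re (F t)) /\
  measurable_fun [set: T] (fun t => complex.Im (F t)).

Definition cbounded F : Prop :=
  bounded_measurable (fun t => complex.Re (F t)) /\
  bounded_measurable (fun t => complex.Im (F t)).

Definition cintegrable F : Prop :=
  torus_integrable (fun t => complex.Re (F t)) /\
  torus_integrable (fun t => complex.Im (F t)).

Definition cint F : C :=
  Complex (torus_int (fun t => complex.Re (F t))) (torus_int (fun t => complex.Im (F t))).

Lemma dominated_integrable (u v : T -> R) : measurable_fun setT u ->
  torus_integrable v -> (forall t, `|u t| <= v t) -> torus_integrable u.
Proof.
move=> mu iv uv; apply: (le_integrable measurableT _ _ iv).
  exact/measurable_EFinP.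
by move=> t _ /=; rewrite lee_fin (le_trans (uv t))// ler_norm.
Qed.

Lemma torus_integrableD (u v : T -> R) : torus_integrable u -> torus_integrable v ->
  torus_integrable (fun t => u t + v t).
Proof.
by move=> iu iv; have := integrableD measurableT iu iv; apply: eq_integrable.
Qed.

Lemma torus_integrableZ (r : R) (u : T -> R) : torus_integrable u ->
  torus_integrable (fun t => r * u t).
Proof.
by move=> iu; have := integrableZl measurableT r iu; apply: eq_integrable.
Qed.

Lemma torus_integrableM (h u : T -> R) : bounded_measurable h -> torus_integrable u ->
  torus_integrable (fun t => h t * u t).
Proof.
move=> [mh [M hM]] iu.
have iMu : torus_integrable (fun t => M * `|u t|).
  by apply: torus_integrableZ; exact: integrable_norm.
apply: dominated_integrable iMu _ => [|t].
  by apply: measurable_funM => //; apply/measurable_EFinP; exact: measurable_int iu.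
by rewrite normrM ler_wpM2r.
Qed.

Lemma cbounded_cst c : cbounded (fun=> c).
Proof. by split; exact: bounded_measurable_cst. Qed.

Lemma cboundedD F G : cbounded F -> cbounded G -> cbounded (fun t => F t + G t).
Proof.
move=> [rF iF] [rG iG]; split.
  under [X in bounded_measurable X]eq_fun do rewrite ReD; exact: bounded_measurableD.
under [X in bounded_measurable X]eq_fun do rewrite ImD; exact: bounded_measurableD.
Qed.

Lemma cboundedM F G : cbounded F -> cbounded G -> cbounded (fun t => F t * G t).
Proof.
move=> [rF iF] [rG iG]; split.
  under [X in bounded_measurable X]eq_fun do rewrite ReM.
  by apply: bounded_measurableB; exact: bounded_measurableM.
under [X in bounded_measurable X]eq_fun do rewrite ImM.
by apply: bounded_measurableD; exact: bounded_measurableM.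
Qed.

Lemma cbounded_conj F : cbounded F -> cbounded (fun t => conjc (F t)).
Proof.
move=> [rF iF]; split.
  by under [X in bounded_measurable X]eq_fun do rewrite Re_conj.
under [X in bounded_measurable X]eq_fun do rewrite Im_conj; exact: bounded_measurableN.
Qed.

Lemma cboundedN F : cbounded F -> cbounded (fun t => - F t).
Proof.
move=> bF; under [X in cbounded X]eq_fun do rewrite -mulN1r.
by apply: cboundedM => //; exact: cbounded_cst.
Qed.

Lemma cboundedB F G : cbounded F -> cbounded G -> cbounded (fun t => F t - G t).
Proof. by move=> bF bG; apply: cboundedD => //; exact: cboundedN. Qed.

Lemma cbounded_sum (I : Type) (r : seq I) (P : pred I) (F : I -> T -> C) :
  (forall i, cbounded (F i)) -> cbounded (fun t => \sum_(i <- r | P i) F i t).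
Proof.
move=> bF; elim: r => [|i r IH].
  under [X in cbounded X]eq_fun do rewrite big_nil; exact: cbounded_cst.
under [X in cbounded X]eq_fun do rewrite big_cons.
by case: (P i) => //; exact: cboundedD.
Qed.

Lemma cbounded_real (h : T -> R) : bounded_measurable h ->
  cbounded (fun t => real_complex R (h t)).
Proof. by move=> bh; split => //; exact: bounded_measurable_cst. Qed.

Lemma cbounded_integrable F : cbounded F -> cintegrable F.
Proof. by move=> [rF iF]; split; exact: bounded_measurable_torus_integrable. Qed.

Lemma cintegrableD F G : cintegrable F -> cintegrable G -> cintegrable (fun t => F t + G t).
Proof.
move=> [rF iF] [rG iG]; split.
  under [X in torus_integrable X]eq_fun do rewrite ReD; exact: torus_integrableD.
under [X in torus_integrable X]eq_fun do rewrite ImD; exact: torus_integrableD.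
Qed.

Lemma cintegrableM F G : cbounded F -> cintegrable G -> cintegrable (fun t => F t * G t).
Proof.
move=> [rF iF] [rG iG]; split.
  under [X in torus_integrable X]eq_fun do rewrite ReM -mulNr.
  by apply: torus_integrableD; apply: torus_integrableM => //; exact: bounded_measurableN.
under [X in torus_integrable X]eq_fun do rewrite ImM.
by apply: torus_integrableD; exact: torus_integrableM.
Qed.

Lemma cintD F G : cintegrable F -> cintegrable G ->
  cint (fun t => F t + G t) = cint F + cint G.
Proof.
move=> [rF iF] [rG iG]; rewrite /cint; apply: complex_ext; rewrite /= ?ReD ?ImD -torus_intD//.
- by congr torus_int; apply/funext => t; rewrite ReD.
- by congr torus_int; apply/funext => t; rewrite ImD.
Qed.

Lemma cintZ c F : cintegrable F -> cint (fun t => c * F t) = c * cint F.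
Proof.
move=> [rF iF]; rewrite /cint; apply: complex_ext.
  rewrite ReM /= -mulNr -!torus_intZ// -torus_intD; try exact: torus_integrableZ.
  by congr torus_int; apply/funext => t; rewrite ReM mulNr.
rewrite ImM /= -!torus_intZ// -torus_intD; try exact: torus_integrableZ.
by congr torus_int; apply/funext => t; rewrite ImM.
Qed.

Lemma cint_cst c : cint (fun=> c) = c.
Proof. by rewrite /cint !torus_int_cst; case: c. Qed.

Lemma cint_sum (I : Type) (r : seq I) (F : I -> T -> C) :
  (forall i, cintegrable (F i)) ->
  cintegrable (fun t => \sum_(i <- r) F i t) /\
  cint (fun t => \sum_(i <- r) F i t) = \sum_(i <- r) cint (F i).
Proof.
move=> iF; elim: r => [|i r [IH1 IH2]].
  rewrite (_ : (fun _ => _) = fun=> 0); last by apply/funext => t; rewrite big_nil.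
  by rewrite big_nil cint_cst; split => //; exact: cbounded_integrable (cbounded_cst _).
rewrite (_ : (fun _ => _) = fun t => F i t + \sum_(j <- r) F j t); last first.
  by apply/funext => t; rewrite big_cons.
by split; [exact: cintegrableD|rewrite cintD// big_cons IH2].
Qed.

Lemma torus_int_norm_le (u v : T -> R) : torus_integrable u -> torus_integrable v ->
  (forall t, `|u t| <= v t) -> `|torus_int u| <= torus_int v.
Proof.
move=> iu iv uv; apply: le_trans (le_normr_Rintegral _ iu) _ => //.
by apply: torus_int_le => //; exact: integrable_norm.
Qed.

(** Bounding the real and imaginary parts separately costs a factor 2, but it
    avoids the choice of a unimodular multiplier. *)
Lemma cint_norm_le F (v : T -> R) : cintegrable F -> torus_integrable v ->
  (forall t, normc (F t) <= v t) -> normc (cint F) <= 2 * torus_int v.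
Proof.
move=> [rF iF] iv Fv; apply: le_trans (normc_le_ReIm _) _.
rewrite mulr_natl mulr2n lerD//; apply: torus_int_norm_le => // t.
  exact: le_trans (Re_normc _) (Fv t).
exact: le_trans (Im_normc _) (Fv t).
Qed.

End ComplexIntegral.

(** * Monomials on the torus *)

Section Monomials.
Variable R : realType.
Notation C := R[i].
Notation T := (measurableTypeR R * measurableTypeR R)%type.

Definition trig (m n : int) (t : T) : C := expi (m%:~R * t.1 + n%:~R * t.2).

Lemma trigM m n k l t : trig m n t * trig k l t = trig (m + k) (n + l) t.
Proof. by rewrite /trig -expiD; congr expi; rewrite !intrD; ring. Qed.

Lemma conj_trig m n t : conjc (trig m n t) = trig (- m) (- n) t.
Proof. by rewrite /trig conj_expi; congr expi; rewrite !intrN; ring. Qed.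

Lemma monomial_trig (a b : nat) t :
  (torus_point t).1 ^+ a * (torus_point t).2 ^+ b = trig a b t.
Proof. by rewrite /= !expiX -expiD. Qed.

Lemma cbounded_trig m n : cbounded (trig m n).
Proof.
split; first exact: (bounded_measurable_lin _ _ (bounded_measurable_cos R)).
exact: (bounded_measurable_lin _ _ (bounded_measurable_sin R)).
Qed.

Lemma cbounded_z1 : cbounded (fun t : T => (torus_point t).1).
Proof.
split; first exact: (bounded_measurable_fst (bounded_measurable_cos R)).
exact: (bounded_measurable_fst (bounded_measurable_sin R)).
Qed.

Lemma cbounded_z2 : cbounded (fun t : T => (torus_point t).2).
Proof.
split; first exact: (bounded_measurable_snd (bounded_measurable_cos R)).
exact: (bounded_measurable_snd (bounded_measurable_sin R)).
Qed.

(** The only monomials that see a function of the angle difference are those of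
    total degree 0. *)
Lemma cint_trigM m n (h : R -> R) :
  bounded_measurable (h : measurableTypeR R -> R) ->
  (forall x, h (x + 2 * pi) = h x) ->
  cint (fun t => trig m n t * real_complex R (h (t.1 - t.2))) =
  (m + n == 0)%:R * Complex (arc_int (fun x => cos (m%:~R * x) * h x))
                            (arc_int (fun x => sin (m%:~R * x) * h x)).
Proof.
move=> bh per; apply: complex_ext.
  transitivity (torus_int (fun t : T =>
      cos (m%:~R * t.1 + n%:~R * t.2) * h (t.1 - t.2))).
    by congr torus_int; apply/funext => t; rewrite ReM /= mulr0 subr0.
  rewrite (torus_int_cos m n bh per) ReM.
  by case: (m + n == 0); rewrite /= ?mul1r ?mul0r ?subr0.
transitivity (torus_int (fun t : T =>
    sin (m%:~R * t.1 + n%:~R * t.2) * h (t.1 - t.2))).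
  by congr torus_int; apply/funext => t; rewrite ImM /= mulr0 add0r.
rewrite (torus_int_sin m n bh per) ImM.
by case: (m + n == 0); rewrite /= ?mul1r ?mul0r ?addr0.
Qed.

Lemma cint_trig m n : cint (trig m n) = ((m == 0) && (n == 0))%:R.
Proof.
transitivity (cint (fun t => trig m n t * real_complex R 1)).
  by congr cint; apply/funext => t; rewrite mulr1.
rewrite (@cint_trigM m n (fun=> 1) (bounded_measurable_cst _ 1) (fun=> erefl)).
under [X in arc_int X]eq_fun do rewrite mulr1.
under [X in Complex _ (arc_int X)]eq_fun do rewrite mulr1.
rewrite arc_int_cosM arc_int_sinM.
have [->|m0] := eqVneq m 0; last by rewrite mulr0.
by rewrite add0r mulr1.
Qed.

End Monomials.

(** * The norms of L^1 and L^2 *)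

Section SquareIntegrable.
Variable R : realType.
Notation C := R[i].
Notation T := (measurableTypeR R * measurableTypeR R)%type.
Implicit Types (F G : T -> C) (c : C).

Definition sq_integrable F : Prop :=
  cmeasurable F /\ torus_integrable (fun t => normc (F t) ^+ 2).

Definition sqnorm F : R := torus_int (fun t => normc (F t) ^+ 2).

Lemma sqnorm_ge0 F : 0 <= sqnorm F.
Proof. by apply: Rintegral_ge0 => t _; rewrite sqr_ge0. Qed.

Lemma cmeasurable_normc F : cmeasurable F -> measurable_fun setT (fun t => normc (F t)).
Proof.
move=> [rF iF].
have -> : (fun t => normc (F t)) =
    (fun t => Num.sqrt (complex.Re (F t) ^+ 2 + complex.Im (F t) ^+ 2)).
  by apply/funext => t; case: (F t).
apply: (@measurableT_comp _ _ _ _ _ _ (@Num.sqrt R)).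
  by apply: continuous_measurable_fun; exact: sqrt_continuous.
by apply: measurable_funD; exact: measurable_funX.
Qed.

Lemma bounded_measurable_normc F : cbounded F -> bounded_measurable (fun t => normc (F t)).
Proof.
move=> [[mr [M rM]] [mi [N iN]]]; split; first exact: cmeasurable_normc.
exists (M + N) => t; rewrite ger0_norm ?normc_ge0//.
by rewrite (le_trans (normc_le_ReIm _))// lerD.
Qed.

Lemma bounded_measurableX d (S : measurableType d) (h : S -> R) n :
  bounded_measurable h -> bounded_measurable (fun x => h x ^+ n).
Proof.
move=> bh; elim: n => [|n IH]; first exact: bounded_measurable_cst.
under [X in bounded_measurable X]eq_fun do rewrite exprS; exact: bounded_measurableM.
Qed.

Lemma cbounded_sq_integrable F : cbounded F -> sq_integrable F.
Proof.
move=> bF; split; first by case: bF => [[? _] [? _]].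
by apply: bounded_measurable_torus_integrable; apply: bounded_measurableX;
  exact: bounded_measurable_normc.
Qed.

Lemma sq_integrable_normc F : sq_integrable F -> torus_integrable (fun t => normc (F t)).
Proof.
move=> [mF iF].
have i1 : torus_integrable (fun t => 1 + normc (F t) ^+ 2).
  apply: torus_integrableD => //.
  exact/bounded_measurable_torus_integrable/bounded_measurable_cst.
apply: dominated_integrable i1 _ => [|t]; first exact: cmeasurable_normc.
rewrite ger0_norm ?normc_ge0//; have := sqr_ge0 (normc (F t) - 1); nra.
Qed.

Lemma sq_integrable_cintegrable F : sq_integrable F -> cintegrable F.
Proof.
move=> iF; have i1 := sq_integrable_normc iF; case: (iF) => [[mr mi] _].
split; apply: dominated_integrable i1 _ => // t; [exact: Re_normc|exact: Im_normc].
Qed.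

(** The variance of the modulus is nonnegative. *)
Lemma torus_int_normc_le F : sq_integrable F ->
  torus_int (fun t => normc (F t)) <= Num.sqrt (sqnorm F).
Proof.
move=> iF; have i1 := sq_integrable_normc iF; have [_ i2] := iF.
set m := torus_int _.
have m0 : 0 <= m by apply: Rintegral_ge0 => t _; exact: normc_ge0.
rewrite -(ger0_norm m0) -sqrtr_sqr ler_sqrt ?sqnorm_ge0//.
have ic : torus_integrable (fun=> - m ^+ 2).
  exact/bounded_measurable_torus_integrable/bounded_measurable_cst.
have i3 : torus_integrable (fun t => 2 * m * normc (F t) + - m ^+ 2).
  by apply: torus_integrableD => //; exact: torus_integrableZ.
have : torus_int (fun t => 2 * m * normc (F t) + - m ^+ 2) <= sqnorm F.
  apply: torus_int_le => // t; have := sqr_ge0 (normc (F t) - m); nra.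
rewrite torus_intD//; last exact: torus_integrableZ.
rewrite torus_intZ// torus_int_cst -/m; nra.
Qed.

Lemma measurable_sq_normc F : cmeasurable F ->
  measurable_fun setT (fun t => normc (F t) ^+ 2).
Proof. by move=> mF; apply: measurable_funX; exact: cmeasurable_normc. Qed.

Lemma Lp_norm2_def (f : C * C -> C) : Lp_norm 2 f =
  ((\int[@torus_measure R]_t ((normc (f (torus_point t)) ^+ 2)%:E)) `^ 2^-1)%E.
Proof.
rewrite /Lp_norm unlock; congr (_ `^ _)%E; apply: eq_integral => t _.
by rewrite /= ger0_norm ?normc_ge0// powR_mulrn ?normc_ge0.
Qed.

Lemma Lp_norm2E (f : C * C -> C) : sq_integrable (f \o @torus_point R) ->
  Lp_norm 2 f = (Num.sqrt (sqnorm (f \o @torus_point R)))%:E.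
Proof.
move=> [_ i2]; rewrite Lp_norm2_def poweR12_sqrt; last first.
  by apply: integral_ge0 => t _; rewrite lee_fin sqr_ge0.
by rewrite /sqnorm /torus_int /Rintegral -[X in sqrte X]fineK ?(integrable_fin_num _ i2).
Qed.

Lemma in_Lp2P (f : C * C -> C) : in_Lp 2 f <-> sq_integrable (f \o @torus_point R).
Proof.
split=> [[mr mi fin]|i2]; last first.
  by case: (i2) => [[mr mi] _]; split => //; rewrite Lp_norm2E// ltry.
split => //; apply/integrableP; split.
  by apply/measurable_EFinP; exact: measurable_sq_normc.
move: fin; rewrite Lp_norm2_def => /lty_poweRy fin.
apply: le_lt_trans (fin _); last by rewrite invr_eq0 pnatr_eq0.
rewrite le_eqVlt; apply/orP; left; apply/eqP; apply: eq_integral => t _.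
by rewrite /= ger0_norm// sqr_ge0.
Qed.

Lemma Lp_norm1E (f : C * C -> C) : sq_integrable (f \o @torus_point R) ->
  Lp_norm 1 f = (torus_int (fun t => normc (f (torus_point t))))%:E.
Proof.
move=> /sq_integrable_normc i1; rewrite /Lp_norm Lnorm1 /torus_int /Rintegral.
rewrite fineK ?(integrable_fin_num _ i1)//; apply: eq_integral => t _.
by rewrite /= ger0_norm ?normc_ge0.
Qed.

End SquareIntegrable.

(** * Symmetric quadratic forms and the Hardy space *)

Section Quadratics.
Variable R : realType.
Notation C := R[i].
Notation T := (measurableTypeR R * measurableTypeR R)%type.
Implicit Types (a b c : R) (f : C * C -> C).

Lemma torus_int_diff (h : R -> R) : bounded_measurable (h : measurableTypeR R -> R) ->
  (forall x, h (x + 2 * pi) = h x) ->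
  torus_int (fun t => h (t.1 - t.2)) = arc_int h.
Proof.
move=> bh per; have := torus_int_cos 0 0 bh per.
rewrite eqxx mul1r => e; transitivity (arc_int (fun x => cos (0%:~R * x) * h x)).
  rewrite -e; congr torus_int; apply/funext => t.
  by rewrite !mul0r addr0 cos0 mul1r.
by congr arc_int; apply/funext => x; rewrite mul0r cos0 mul1r.
Qed.

Lemma arc_int_cos_poly (n : nat) (u : nat -> R) :
  arc_int (fun x => \sum_(k < n.+1) u k * cos (k%:R * x)) = u 0%N.
Proof.
have bk (k : nat) : bounded_measurable ((fun x => u k * cos (k%:R * x)) : measurableTypeR R -> R).
  by apply: bounded_measurableM (bounded_measurable_cst _ _) (bounded_measurable_cosM _).
have bs m : bounded_measurable
    ((fun x => \sum_(k < m) u k * cos (k%:R * x)) : measurableTypeR R -> R).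
  elim: m => [|m IH].
    by under [X in bounded_measurable X]eq_fun do rewrite big_ord0; exact: bounded_measurable_cst.
  by under [X in bounded_measurable X]eq_fun do rewrite big_ord_recr; exact: bounded_measurableD.
elim: n => [|n IH].
  rewrite (_ : (fun _ => _) = fun=> u 0%N) ?arc_int_cst//.
  by apply/funext => x; rewrite big_ord1 mul0r cos0 mulr1.
rewrite (_ : (fun _ => _) = fun x => \sum_(k < n.+1) u k * cos (k%:R * x)
    + u n.+1 * cos (n.+1%:R * x)); last by apply/funext => x; rewrite big_ord_recr.
rewrite arc_intD// IH arc_intZ; last exact: bounded_measurable_cosM.
by rewrite (arc_int_cosM _ n.+1) mulr0 addr0.
Qed.

Lemma cos2x (x : R) : cos (2 * x) = 2 * cos x ^+ 2 - 1.
Proof. by rewrite mulr_natl cos_mulr2n mulr_natl. Qed.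

Lemma cos3x (x : R) : cos (3 * x) = 4 * cos x ^+ 3 - 3 * cos x.
Proof.
rewrite (_ : 3 * x = 2 * x + x); last by ring.
rewrite cosD cos2x [2 * x]mulr_natl sin_mulr2n.
transitivity ((2 * cos x ^+ 2 - 1) * cos x - 2 * cos x * sin x ^+ 2); first ring.
by rewrite sin2cos2; ring.
Qed.

Lemma cos4x (x : R) : cos (4 * x) = 8 * cos x ^+ 4 - 8 * cos x ^+ 2 + 1.
Proof.
by rewrite (_ : 4 * x = 2 * (2 * x)) ?cos2x; ring.
Qed.

Lemma bounded_measurable_affine_cos b c :
  bounded_measurable ((fun x => c + 2 * b * cos x) : measurableTypeR R -> R).
Proof.
apply: bounded_measurableD; first exact: bounded_measurable_cst.
by apply: bounded_measurableM; [exact: bounded_measurable_cst|exact: bounded_measurable_cos].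
Qed.

Lemma bounded_measurable_norm d (S : measurableType d) (h : S -> R) :
  bounded_measurable h -> bounded_measurable (fun x => `|h x|).
Proof.
move=> [mh [M hM]]; split; first exact: measurableT_comp.
by exists M => x; rewrite normr_id.
Qed.

Lemma arc_int_affine_cosM a b c d :
  arc_int (fun x : R => (c + 2 * b * cos x) * (d + 2 * a * cos x)) = c * d + 2 * a * b.
Proof.
pose u (k : nat) : R := if k is 0%N then c * d + 2 * a * b else
  if k is 1%N then 2 * a * c + 2 * b * d else 2 * a * b.
rewrite -[RHS](arc_int_cos_poly 2 u); congr arc_int; apply/funext => x.
by rewrite !big_ord_recr big_ord0 /= mul0r cos0 mul1r cos2x; ring.
Qed.

(** A quadratic form that is symmetric with real coefficients is, up to the
    unimodular factor [z1 z2], a function of the difference of the angles. *)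
Definition sym_quad b c (z : C * C) : C :=
  real_complex R b * (z.1 ^+ 2 + z.2 ^+ 2) + real_complex R c * z.1 * z.2.

Lemma phiE a : phi_ a = sym_quad 1 a.
Proof. by apply/funext => z; rewrite /phi_ /sym_quad rmorph1 mul1r addrAC. Qed.

Lemma sym_quad_trig b c t : sym_quad b c (torus_point t) =
  trig 1 1 t * real_complex R (c + 2 * b * cos (t.1 - t.2)).
Proof.
have z1 : (torus_point t).1 = trig 1 0 t by rewrite /trig mul1r mul0r addr0.
have z2 : (torus_point t).2 = trig 0 1 t by rewrite /trig mul1r mul0r add0r.
have z11 : trig 1 0 t * trig 0 1 t = trig 1 1 t by rewrite trigM.
have z20 : trig 1 0 t ^+ 2 = trig 1 1 t * expi (t.1 - t.2).
  by rewrite expr2 trigM /trig -expiD; congr expi; rewrite mul0r; ring.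
have z02 : trig 0 1 t ^+ 2 = trig 1 1 t * expi (- (t.1 - t.2)).
  by rewrite expr2 trigM /trig -expiD; congr expi; rewrite mul0r; ring.
rewrite /sym_quad z1 z2 z20 z02 -mulrA z11 -mulrDr.
have -> : expi (t.1 - t.2) + expi (- (t.1 - t.2)) = real_complex R (2 * cos (t.1 - t.2)).
  by apply: complex_ext; rewrite ?ReD ?ImD /= ?cosN ?sinN ?subrr// mulr_natl.
rewrite rmorphD mulrDr [X in X + _]mulrCA [X in _ + X]mulrC addrC; congr (_ + _ * _).
by rewrite -rmorphM mulrCA mulrA.
Qed.

Lemma normc_trig m n (t : T) : normc (trig m n t) = 1.
Proof. exact: normc_expi. Qed.

Lemma normc_sym_quad b c t :
  normc (sym_quad b c (torus_point t)) = `|c + 2 * b * cos (t.1 - t.2)|.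
Proof. by rewrite sym_quad_trig normcM normc_trig mul1r normc_real. Qed.

Lemma cbounded_sym_quad b c : cbounded (sym_quad b c \o @torus_point R).
Proof.
have -> : sym_quad b c \o @torus_point R =
    fun t => trig 1 1 t * real_complex R (c + 2 * b * cos (t.1 - t.2)).
  by apply/funext => t; exact: sym_quad_trig.
apply: cboundedM; first exact: cbounded_trig.
apply: cbounded_real; exact: (bounded_measurable_sub (bounded_measurable_affine_cos b c)).
Qed.

Lemma affine_cos_2pi b c (x : R) : c + 2 * b * cos (x + 2 * pi) = c + 2 * b * cos x.
Proof. by rewrite cos_2pi. Qed.

Lemma H1_norm_sym_quad b c :
  H1_norm (sym_quad b c) = (arc_int (fun x => `|c + 2 * b * cos x|))%:E.
Proof.
rewrite /H1_norm Lp_norm1E; last exact/cbounded_sq_integrable/cbounded_sym_quad.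
congr EFin; rewrite -torus_int_diff.
- by congr torus_int; apply/funext => t; rewrite normc_sym_quad.
- exact/bounded_measurable_norm/bounded_measurable_affine_cos.
- by move=> x; rewrite affine_cos_2pi.
Qed.

Lemma sqnorm_sym_quad b c : sqnorm (sym_quad b c \o @torus_point R) = c ^+ 2 + 2 * b ^+ 2.
Proof.
transitivity (arc_int (fun x : R => (c + 2 * b * cos x) * (c + 2 * b * cos x))).
  rewrite -torus_int_diff.
  - congr torus_int; apply/funext => t.
    by rewrite [normc _]normc_sym_quad real_normK ?num_real// expr2.
  - by apply: bounded_measurableM; exact: bounded_measurable_affine_cos.
  - by move=> x; rewrite affine_cos_2pi.
by rewrite arc_int_affine_cosM; ring.
Qed.

Lemma Lp_norm2_sym_quad b c :
  Lp_norm 2 (sym_quad b c) = (Num.sqrt (c ^+ 2 + 2 * b ^+ 2))%:E.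
Proof.
by rewrite Lp_norm2E ?sqnorm_sym_quad//; exact/cbounded_sq_integrable/cbounded_sym_quad.
Qed.

Lemma conjcM (x y : C) : conjc (x * y) = conjc x * conjc y.
Proof. exact: (rmorphM (@conjc R)). Qed.

Lemma inner_sym_quad a b c d :
  inner (sym_quad b c) (sym_quad a d) = real_complex R (c * d + 2 * a * b).
Proof.
rewrite -(arc_int_affine_cosM a b c d).
pose h (x : R) : R := (c + 2 * b * cos x) * (d + 2 * a * cos x).
have bh : bounded_measurable (h : measurableTypeR R -> R).
  by apply: bounded_measurableM; exact: bounded_measurable_affine_cos.
have ph x : h (x + 2 * pi) = h x by rewrite /h !affine_cos_2pi.
transitivity (cint (fun t : T => real_complex R (h (t.1 - t.2)))).
  congr cint; apply/funext => t; rewrite !sym_quad_trig conjcM conj_trig.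
  rewrite mulrACA trigM !subrr {1}/trig !mul0r addr0 expi0 mul1r conjc_real.
  by rewrite -rmorphM.
apply: complex_ext; rewrite /=; last exact: torus_int_cst.
exact: torus_int_diff.
Qed.

Lemma poly_trig (P : {poly {poly C}}) (t : T) :
  P.[(torus_point t).1, (torus_point t).2] =
  \sum_(i < size P) \sum_(j < size P`_i) (P`_i`_j * trig i j t).
Proof.
rewrite (horner_coef P) horner_sum; apply: eq_bigr => i _.
rewrite hornerM -polyC_exp hornerC horner_coef mulr_suml; apply: eq_bigr => j _.
by rewrite -mulrA -monomial_trig [X in _ * X]mulrC.
Qed.

Lemma cbounded_poly (P : {poly {poly C}}) :
  cbounded (fun t : T => P.[(torus_point t).1, (torus_point t).2]).
Proof.
rewrite (_ : (fun _ => _) = fun t => \sum_(i < size P) \sum_(j < size P`_i)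
    (P`_i`_j * trig i j t)); last by apply/funext => t; exact: poly_trig.
apply: cbounded_sum => i; apply: cbounded_sum => j.
by apply: cboundedM; [exact: cbounded_cst|exact: cbounded_trig].
Qed.

Lemma sqnorm0 : sqnorm (fun=> 0 : C) = 0.
Proof.
rewrite /sqnorm -[RHS](torus_int_cst (0 : R)); congr torus_int.
by apply/funext => t; rewrite normc0 expr0n.
Qed.

Definition polynomial_fun f : Prop :=
  exists P : {poly {poly C}}, forall z, f z = P.[z.1, z.2].

Lemma polynomial_hardy f : polynomial_fun f -> hardy 2 f.
Proof.
move=> [P fP]; split.
  apply/in_Lp2P/cbounded_sq_integrable.
  by rewrite (_ : _ \o _ = fun t : T => P.[(torus_point t).1, (torus_point t).2]);
    [exact: cbounded_poly|apply/funext => t; exact: fP].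
move=> e e0; exists P.
have E : (fun z : C * C => f z - P.[z.1, z.2]) = fun=> 0.
  by apply/funext => z; rewrite fP subrr.
rewrite E Lp_norm2E; last exact/cbounded_sq_integrable/cbounded_cst.
by rewrite [sqnorm _]sqnorm0 sqrtr0 lte_fin.
Qed.

Lemma polynomial_sym_quad b c : polynomial_fun (sym_quad b c).
Proof.
exists ((real_complex R b)%:P%:P * ('X ^+ 2 + 'X%:P ^+ 2)
   + (real_complex R c)%:P%:P * 'X * 'X%:P) => z.
by rewrite !hornerE /= /sym_quad.
Qed.

Lemma hardy_sym_quad b c : hardy 2 (sym_quad b c).
Proof. exact/polynomial_hardy/polynomial_sym_quad. Qed.

Lemma torus_zero_sqnorm f : torus_zero f -> in_Lp 2 f ->
  sqnorm (f \o @torus_point R) = 0.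
Proof.
move=> z0 /in_Lp2P [mf _]; rewrite /sqnorm /torus_int /Rintegral.
rewrite (ae_eq_integral (cst 0%E))//.
- by rewrite integral0.
- by apply/measurable_EFinP; exact: measurable_sq_normc.
- case: z0 => N [mN N0 sub]; exists N; split => // t /= h; apply: sub => /= ft.
  by apply: h => _; rewrite /= ft normc0 expr0n.
Qed.

Lemma sq_integrableD (F G : T -> C) : sq_integrable F -> sq_integrable G ->
  sq_integrable (fun t => F t + G t).
Proof.
move=> [[mrF miF] iF] [[mrG miG] iG].
have mFG : cmeasurable (fun t => F t + G t).
  split; [under [X in measurable_fun _ X]eq_fun do rewrite ReD|
          under [X in measurable_fun _ X]eq_fun do rewrite ImD];
    exact: measurable_funD.
split => //.
have i2 := torus_integrableD (torus_integrableZ 2 iF) (torus_integrableZ 2 iG).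
apply: dominated_integrable i2 _ => [|t]; first exact: measurable_sq_normc.
rewrite ger0_norm ?sqr_ge0//.
have := le_normcD (F t) (G t); have := normc_ge0 (F t + G t).
have := sqr_ge0 (normc (F t) - normc (G t)); nra.
Qed.

(** A bounded function that is orthogonal to the monomials is orthogonal to
    the whole Hardy space, by density of the polynomials. *)
Lemma hardy_annihilator (K : T -> C) f : cbounded K ->
  (forall a b : nat, cint (fun t => trig a b t * K t) = 0) ->
  hardy 2 f -> cint (fun t => f (torus_point t) * K t) = 0.
Proof.
move=> bK K0 [/in_Lp2P if2 dense].
have [_ [M KM]] := bounded_measurable_normc bK.
have M0 : 0 <= M := le_trans (normr_ge0 _) (KM (0, 0)).
apply: eq0_normc; apply/eqP; rewrite eq_le normc_ge0 andbT.
apply/ler_addgt0Pl => e e0; rewrite addr0.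
have e1 : 0 < e / (2 * (M + 1)) by rewrite divr_gt0// mulr_gt0// ltr_wpDl.
have [P Pe] := dense _ e1.
pose p (t : T) := P.[(torus_point t).1, (torus_point t).2].
have bp : cbounded p := cbounded_poly P.
have pK0 : cint (fun t => p t * K t) = 0.
  rewrite (_ : (fun _ => _) = fun t => \sum_(i < size P) \sum_(j < size P`_i)
      (P`_i`_j * (trig i j t * K t))); last first.
    apply/funext => t; rewrite /p poly_trig mulr_suml; apply: eq_bigr => i _.
    by rewrite mulr_suml; apply: eq_bigr => j _; rewrite mulrA.
  have bt i j : cbounded (fun t => trig i j t * K t).
    by apply: cboundedM => //; exact: cbounded_trig.
  have bct (i j : nat) : cbounded (fun t => P`_i`_j * (trig i j t * K t)).
    by apply: cboundedM => //; exact: cbounded_cst.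
  rewrite (cint_sum _ _).2 => [|i]; last first.
    by apply: cbounded_integrable; apply: cbounded_sum.
  rewrite big1// => i _; rewrite (cint_sum _ _).2 => [|j]; last exact: cbounded_integrable.
  rewrite big1// => j _.
  by rewrite cintZ ?K0 ?mulr0//; exact: cbounded_integrable.
have id2 : sq_integrable (fun t => f (torus_point t) + - p t).
  by apply: sq_integrableD => //; apply/cbounded_sq_integrable/cboundedN.
have idc := sq_integrable_cintegrable id2.
have -> : (fun t => f (torus_point t) * K t) =
    (fun t => K t * (f (torus_point t) + - p t) + p t * K t).
  by apply/funext => t; ring.
rewrite cintD; [|exact: cintegrableM|by apply/cbounded_integrable/cboundedM].
rewrite pK0 addr0.
have in1 := sq_integrable_normc id2.
apply: le_trans (cint_norm_le (v := fun t => M * normc (f (torus_point t) + - p t)) _ _ _) _.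
- exact: cintegrableM.
- exact: torus_integrableZ.
- by move=> t; rewrite normcM ler_wpM2r ?normc_ge0// -[normc (K t)]ger0_norm ?normc_ge0.
rewrite torus_intZ//.
have : torus_int (fun t => normc (f (torus_point t) + - p t)) < e / (2 * (M + 1)).
  apply: le_lt_trans (torus_int_normc_le id2) _.
  by move: Pe; rewrite Lp_norm2E// lte_fin.
rewrite ltr_pdivlMr ?mulr_gt0// ?ltr_wpDl//.
have : 0 <= torus_int (fun t => normc (f (torus_point t) + - p t)).
  by apply: Rintegral_ge0 => t _; exact: normc_ge0.
set I := torus_int _; nra.
Qed.

End Quadratics.

(** * Hilbert points and norm attaining forms in H^1 *)

Section H1.
Variable R : realType.
Notation C := R[i].
Notation T := (measurableTypeR R * measurableTypeR R)%type.
Implicit Types (a b c : R).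

Lemma arc_int_affine_cos b c : arc_int (fun x : R => c + 2 * b * cos x) = c.
Proof.
transitivity (c * 1 + 2 * 0 * b); last by ring.
rewrite -arc_int_affine_cosM; congr arc_int; apply/funext => x; ring.
Qed.

Lemma arc_int_affine_cos_cos b c :
  arc_int (fun x : R => cos x * (c + 2 * b * cos x)) = b.
Proof.
transitivity (c * 0 + 2 * (1 / 2) * b); last by field.
rewrite -arc_int_affine_cosM; by congr arc_int; apply/funext => x; field.
Qed.

Lemma arc_int_affine_cos_sin b c :
  arc_int (fun x : R => sin x * (c + 2 * b * cos x)) = 0.
Proof.
have bs (r m : R) : bounded_measurable ((fun x => r * sin (m * x)) : measurableTypeR R -> R).
  by apply: bounded_measurableM (bounded_measurable_cst _ _) (bounded_measurable_sinM _).
transitivity (arc_int (fun x => c * sin (1%:~R * x) + b * sin (2%:~R * x))).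
  congr arc_int; apply/funext => x.
  by rewrite mul1r [2%:~R * x]mulr_natl sin_mulr2n; ring.
rewrite arc_intD; [|exact: bs|exact: bs].
by rewrite !arc_intZ ?arc_int_sinM ?mulr0 ?addr0//; exact: bounded_measurable_sinM.
Qed.

Lemma sym_quad_nonzero b c : 0 < c ^+ 2 + 2 * b ^+ 2 ->
  ~ torus_zero (@sym_quad R b c).
Proof.
move=> bc0 z0; move: bc0; have [h _] := hardy_sym_quad b c.
by rewrite -sqnorm_sym_quad torus_zero_sqnorm// ltxx.
Qed.

(** If [c] is the L^2 norm and [u] the modulus, equality of the norms means that
    [(u - c)^2] has mean 0; as [(u^2 - c^2)^2 <= M^2 (u - c)^2], the mean of the
    left-hand side would vanish, but it is [8 a^2 + 2]. *)
Lemma phi_not_norm_attaining_H1 a : 0 <= a -> ~ norm_attaining (@H1_norm R) (phi_ a).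
Proof.
move=> a0 [_ _]; rewrite phiE H1_norm_sym_quad Lp_norm2_sym_quad expr1n.
rewrite [in Num.sqrt _]mulr1.
set c := Num.sqrt _ => cE; have {cE} e := EFin_inj cE.
have c0 : 0 <= c := sqrtr_ge0 _.
have c2 : c ^+ 2 = a ^+ 2 + 2 by rewrite sqr_sqrtr// addr_ge0// sqr_ge0.
pose x (s : R) : R := a + 2 * 1 * cos s.
have bx : bounded_measurable (x : measurableTypeR R -> R).
  exact: bounded_measurable_affine_cos.
have bnx : bounded_measurable ((fun s => `|x s|) : measurableTypeR R -> R).
  exact: bounded_measurable_norm.
have bcst (r : R) : bounded_measurable ((fun=> r) : measurableTypeR R -> R).
  exact: bounded_measurable_cst.
have bx2 : bounded_measurable ((fun s => x s * x s) : measurableTypeR R -> R).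
  exact: bounded_measurableM.
have I2 : arc_int (fun s => x s * x s) = c ^+ 2.
  by rewrite arc_int_affine_cosM c2; ring.
(* the fourth moment sees that the modulus is not constant *)
have I4 : arc_int (fun s => (x s * x s - c ^+ 2) * (x s * x s - c ^+ 2)) = 8 * a ^+ 2 + 2.
  pose u (k : nat) : R := match k with 0%N => 8 * a ^+ 2 + 2 | 1%N => 8 * a
    | 2%N => 8 * a ^+ 2 | 3%N => 8 * a | _ => 2 end.
  rewrite -[RHS](arc_int_cos_poly 4 u); congr arc_int; apply/funext => s.
  rewrite !big_ord_recr big_ord0 /= mul0r cos0 mul1r cos2x cos3x cos4x c2 /x; ring.
pose M := a + 2 + c.
have le s : (x s * x s - c ^+ 2) * (x s * x s - c ^+ 2) <=
    M ^+ 2 * (x s * x s) + (- (2 * M ^+ 2 * c) * `|x s| + M ^+ 2 * c ^+ 2).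
  have xM : `|x s| <= a + 2.
    rewrite /x mulr1 (le_trans (ler_normD _ _))// (ger0_norm a0) lerD2l.
    by rewrite normrM (ger0_norm (ler0n _ 2)) ler_piMr// cos_max.
  have x0 := normr_ge0 (x s).
  have -> : x s * x s = `|x s| ^+ 2 by rewrite real_normK ?num_real// expr2.
  set y := `|x s| in xM x0 *.
  have -> : (y ^+ 2 - c ^+ 2) * (y ^+ 2 - c ^+ 2) = (y + c) ^+ 2 * (y - c) ^+ 2 by ring.
  have -> : M ^+ 2 * y ^+ 2 + (- (2 * M ^+ 2 * c) * y + M ^+ 2 * c ^+ 2) =
    M ^+ 2 * (y - c) ^+ 2 by ring.
  apply: ler_wpM2r; first exact: sqr_ge0.
  have y0 : 0 <= y + c by exact: addr_ge0.
  have yM : y + c <= M by rewrite /M lerD2r.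
  by rewrite ler_pXn2r// nnegrE (le_trans y0).
have bl : bounded_measurable ((fun s => M ^+ 2 * (x s * x s)) : measurableTypeR R -> R).
  exact: bounded_measurableM.
have bm : bounded_measurable ((fun s => - (2 * M ^+ 2 * c) * `|x s|) : measurableTypeR R -> R).
  exact: bounded_measurableM.
have bn : bounded_measurable ((fun s => - (2 * M ^+ 2 * c) * `|x s| + M ^+ 2 * c ^+ 2)
    : measurableTypeR R -> R) by exact: bounded_measurableD.
have bd : bounded_measurable ((fun s => x s * x s - c ^+ 2) : measurableTypeR R -> R).
  exact: bounded_measurableB.
have : arc_int (fun s => (x s * x s - c ^+ 2) * (x s * x s - c ^+ 2)) <=
  arc_int (fun s => M ^+ 2 * (x s * x s) + (- (2 * M ^+ 2 * c) * `|x s| + M ^+ 2 * c ^+ 2)).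
  apply: le_Rintegral => //; apply: arc_bounded_integrable.
    exact: bounded_measurableM.
  exact: bounded_measurableD.
rewrite I4 !arc_intD// !arc_intZ// arc_int_cst I2 e.
have := sqr_ge0 a; set M2 := M ^+ 2; set a2 := a ^+ 2.
have -> : M2 * c ^+ 2 + (- (2 * M2 * c) * c + M2 * c ^+ 2) = 0 by ring.
lra.
Qed.

(** For [a = 2 sin t] the projection of [sgn phi] to the Hardy space is the
    quadratic form with coefficients [2 cos t / pi] for the squares and
    [2 t / pi] for the mixed term; it is a multiple of [phi] precisely when [a cos t = t]. *)
Lemma phi_hilbert_point_H1 t : 0 <= t < pi / 2 -> 2 * sin t * cos t = t ->
  hilbert_point (@H1_norm R) (phi_ (2 * sin t)).
Proof.
move=> /andP[t0 tpi] tE; set a := 2 * sin t.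
have pi0 : 0 < pi :> R := pi_gt0 R.
have tb : - (pi / 2) < t < pi / 2 by lra.
rewrite phiE; split; first exact: hardy_sym_quad.
  by apply: sym_quad_nonzero; have := sqr_ge0 a; rewrite expr1n; lra.
move=> f hf fphi; pose l := 2 * cos t / pi.
pose x (s : R) : R := a + 2 * 1 * cos s.
have bx : bounded_measurable (x : measurableTypeR R -> R).
  exact: bounded_measurable_affine_cos.
pose h (s : R) : R := sign_cos t s + - l * x s.
have bsg := bounded_measurable_sign_cos t.
have blx (r : R) : bounded_measurable ((fun s => r * x s) : measurableTypeR R -> R).
  by apply: bounded_measurableM => //; exact: bounded_measurable_cst.
have bh : bounded_measurable (h : measurableTypeR R -> R).
  by apply: bounded_measurableD => //; exact: blx.
have ph s : h (s + 2 * pi) = h s by rewrite /h /x sign_cos_2pi cos_2pi.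
have pc := bounded_measurable_cos R; have psn := bounded_measurable_sin R.
have split_h (w : R -> R) : bounded_measurable (w : measurableTypeR R -> R) ->
    arc_int (fun s => w s * h s) =
    arc_int (fun s => sign_cos t s * w s) - l * arc_int (fun s => w s * x s).
  move=> bw; have bwx := bounded_measurableM bw bx.
  rewrite -mulNr -arc_intZ// -arc_intD//.
  - by congr arc_int; apply/funext => s; rewrite /h; ring.
  - exact: bounded_measurableM.
  - by apply: bounded_measurableM => //; exact: bounded_measurable_cst.
have h0 : arc_int (fun s => 1 * h s) = 0.
  rewrite split_h; last exact: bounded_measurable_cst.
  have -> : arc_int (fun s => sign_cos t s * 1) = 2 * t / pi.
    by rewrite -arc_int_sign//; congr arc_int; apply/funext => s; rewrite mulr1.
  have -> : arc_int (fun s => 1 * x s) = a.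
    by rewrite -[RHS](arc_int_affine_cos 1 a); congr arc_int; apply/funext => s; rewrite mul1r.
  rewrite /l /a -{1}tE; ring.
have hc : arc_int (fun s => cos s * h s) = 0.
  by rewrite split_h// arc_int_sign_cosM1// arc_int_affine_cos_cos mulr1 subrr.
have hs : arc_int (fun s => sin s * h s) = 0.
  by rewrite split_h// arc_int_sign_sinM1// arc_int_affine_cos_sin mulr0 subrr.
pose K (p : T) := trig (-1) (-1) p * real_complex R (h (p.1 - p.2)).
have bK : cbounded K.
  apply: cboundedM; first exact: cbounded_trig.
  by apply: cbounded_real; exact: (bounded_measurable_sub bh).
(* only the three monomials of degree two survive *)
have K0 (i j : nat) : cint (fun p => trig i j p * K p) = 0.
  transitivity (cint (fun p : T => trig (i%:Z - 1) (j%:Z - 1) p * real_complex R (h (p.1 - p.2)))).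
    by congr cint; apply/funext => p; rewrite /K mulrA trigM.
  rewrite cint_trigM//; case: eqP => [ij|_]; last by rewrite mul0r.
  have {ij} : (i + j = 2)%N by lia.
  have c0 : arc_int (fun s => cos (0%:~R * s) * h s) = 0.
    by rewrite -[RHS]h0; congr arc_int; apply/funext => s; rewrite mul0r cos0.
  have s0 : arc_int (fun s => sin (0%:~R * s) * h s) = 0.
    by rewrite -[RHS](arc_int_cst 0); congr arc_int; apply/funext => s; rewrite mul0r sin0 mul0r.
  have c1 : arc_int (fun s => cos (1%:~R * s) * h s) = 0.
    by rewrite -[RHS]hc; congr arc_int; apply/funext => s; rewrite mul1r.
  have s1 : arc_int (fun s => sin (1%:~R * s) * h s) = 0.
    by rewrite -[RHS]hs; congr arc_int; apply/funext => s; rewrite mul1r.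
  have cN1 : arc_int (fun s => cos ((-1)%:~R * s) * h s) = 0.
    by rewrite -[RHS]hc; congr arc_int; apply/funext => s; rewrite mulN1r cosN.
  have sN1 : arc_int (fun s => sin ((-1)%:~R * s) * h s) = 0.
    rewrite -[RHS](mulr0 (-1)) -hs -arc_intZ; last exact: bounded_measurableM.
    by congr arc_int; apply/funext => s; rewrite mulN1r sinN mulNr mulN1r.
  by case: i => [|[|[|i]]] // _; rewrite ?subrr ?sub0r /= ?c0 ?s0 ?cN1 ?sN1 ?c1 ?s1 mulr0.
have fK := hardy_annihilator bK K0 hf.
have [/in_Lp2P f2 _] := hf.
have fi := sq_integrable_cintegrable f2.
pose S (p : T) := trig (-1) (-1) p * real_complex R (sign_cos t (p.1 - p.2)).
have bS : cbounded S.
  apply: cboundedM; first exact: cbounded_trig.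
  by apply: cbounded_real; exact: (bounded_measurable_sub bsg).
pose q (p : T) := sym_quad 1 a (torus_point p).
have bq : cbounded q := cbounded_sym_quad 1 a.
have fS : cint (fun p => S p * f (torus_point p)) = 0.
  have -> : (fun p => S p * f (torus_point p)) = fun p => f (torus_point p) * K p +
      real_complex R l * (f (torus_point p) * conjc (q p)).
    apply/funext => p; rewrite /S /K /q sym_quad_trig conjcM conj_trig conjc_real.
    by rewrite /h rmorphD rmorphM rmorphN /x; ring.
  have i1 : cintegrable (fun p => f (torus_point p) * conjc (q p)).
    under [X in cintegrable X]eq_fun do rewrite mulrC.
    by apply: cintegrableM => //; exact: cbounded_conj.
  have i2 : cintegrable (fun p => f (torus_point p) * K p).
    by under [X in cintegrable X]eq_fun do rewrite mulrC; exact: cintegrableM.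
  rewrite cintD//; last by apply: cintegrableM => //; exact: cbounded_cst.
  by rewrite cintZ// fK [cint _]fphi mulr0 addr0.
rewrite /H1_norm Lp_norm1E; last exact/cbounded_sq_integrable.
have pf2 : sq_integrable (fun p => q p + f (torus_point p)).
  by apply: sq_integrableD => //; exact: cbounded_sq_integrable.
rewrite Lp_norm1E// lee_fin.
have Sq p : S p * q p = real_complex R (normc (q p)).
  rewrite /S /q normc_sym_quad sym_quad_trig mulrACA trigM addNr /trig !mul0r addr0 expi0 mul1r.
  by rewrite -rmorphM normrEsg /sign_cos mulr1.
have iSf : cintegrable (fun p => S p * f (torus_point p)) by exact: cintegrableM.
have iq : torus_integrable (fun p => normc (q p)).
  exact/sq_integrable_normc/cbounded_sq_integrable.
have -> : torus_int (fun p => normc (sym_quad 1 a (torus_point p))) =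
    torus_int (fun p => normc (q p) + complex.Re (S p * f (torus_point p))).
  by rewrite torus_intD//; [rewrite [X in _ + X](congr1 (@complex.Re R) fS) addr0|case: iSf].
apply: torus_int_le.
- by apply: torus_integrableD => //; case: iSf.
- exact: sq_integrable_normc.
move=> p; apply: le_trans (_ : normc (S p * (q p + f (torus_point p))) <= _).
  apply: le_trans (le_trans (ler_norm _) (Re_normc _)).
  by rewrite mulrDr ReD Sq.
rewrite normcM ler_piMl ?normc_ge0// /S normcM normc_trig mul1r normc_real normr_sg.
by case: (_ != 0); rewrite ?lexx ?ler01.
Qed.

End H1.

Section H1Necessity.
Variable R : realType.
Implicit Types (a b c t : R).

(** Perturbing [phi_a] along the quadratic form with coefficients [a] and [-2],
    which is orthogonal to it, moves the zero set of [a + 2 cos] to that of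
    [2 sin t + 2 cos]; convexity of the absolute value then determines the sign
    of the derivative of the norm in terms of the new zero set. *)
Lemma hilbert_point_H1_sign a t : 0 < a -> 0 <= t < pi / 2 ->
  hilbert_point (@H1_norm R) (phi_ a) ->
  0 <= (a - 2 * sin t) * (a * cos t - t).
Proof.
move=> a0 /andP[t0 tpi] [_ _ hp].
have pi0 : 0 < pi :> R := pi_gt0 R.
have tb : - (pi / 2) < t < pi / 2 by lra.
have s0 : 0 <= sin t by apply: sin_ge0_pi; lra.
(* the step [e] that moves the zero set to that of [2 sin t + 2 cos x] *)
pose d := 2 + 2 * sin t * a.
have d0 : 0 < d by rewrite /d; have := mulr_ge0 s0 (ltW a0); lra.
pose e := (a - 2 * sin t) / d.
pose s := (2 + a ^+ 2) / d.
have se : 1 + e * a = s by rewrite /s /e /d; field; exact: lt0r_neq0.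
have ae : a - 2 * e = s * (2 * sin t) by rewrite /s /e /d; field; exact: lt0r_neq0.
have s_gt0 : 0 < s by rewrite divr_gt0// addr_gt0// exprn_gt0.
pose f := sym_quad (e * a) (- 2 * e) : R[i] * R[i] -> R[i].
have := hp f (hardy_sym_quad _ _).
rewrite phiE inner_sym_quad => /(_ _)/wrap[].
  by rewrite (_ : _ + _ = 0) ?rmorph0//; ring.
have -> : (fun z => sym_quad 1 a z + f z) = sym_quad s (s * (2 * sin t)).
  apply/funext => z; rewrite /f /sym_quad -ae -se !rmorphB !rmorphD rmorph1 !rmorphM rmorphN /=.
  ring.
rewrite !H1_norm_sym_quad lee_fin => le1.
pose sg := sign_cos t.
have bsg : bounded_measurable (sg : measurableTypeR R -> R) := bounded_measurable_sign_cos t.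
have bx := @bounded_measurable_affine_cos R.
have bsx b c : bounded_measurable ((fun x => sg x * (c + 2 * b * cos x)) : measurableTypeR R -> R).
  exact: bounded_measurableM.
have le2 : arc_int (fun x => sg x * (a + 2 * 1 * cos x)) <= arc_int (fun x => `|a + 2 * 1 * cos x|).
  apply: le_Rintegral => //; try apply: arc_bounded_integrable => //.
    exact: bounded_measurable_norm.
  move=> x _; rewrite (le_trans (ler_norm _))// normrM ler_piMl// /sg /sign_cos normr_sg.
  by case: (_ != 0); rewrite ?lexx ?ler01.
have eq3 : arc_int (fun x => `|s * (2 * sin t) + 2 * s * cos x|) =
    arc_int (fun x => sg x * (s * (2 * sin t) + 2 * s * cos x)).
  congr arc_int; apply/funext => x.
  have -> : s * (2 * sin t) + 2 * s * cos x = s * (2 * sin t + 2 * cos x) by ring.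
  by rewrite normrM (gtr0_norm s_gt0) normrEsg mulrCA.
have sgE b c : arc_int (fun x => sg x * (c + 2 * b * cos x)) =
    2 * (c * t + 2 * b * cos t) / pi.
  have bc := bounded_measurable_cos R.
  transitivity (arc_int (fun x => c * sg x + 2 * b * (sg x * cos x))).
    by congr arc_int; apply/funext => x; ring.
  have b1 := bounded_measurableM (bounded_measurable_cst _ c) bsg.
  have b2 := bounded_measurableM bsg bc.
  have b3 := bounded_measurableM (bounded_measurable_cst _ (2 * b)) b2.
  rewrite arc_intD// !arc_intZ// arc_int_sign// arc_int_sign_cosM1//.
  by move: (lt0r_neq0 pi0); generalize (@pi R) => p p0; field; exact: p0.
move: (le_trans le2 le1); rewrite eq3 !sgE ler_pM2r ?invr_gt0// ler_pM2l//.
rewrite -ae -se => le4.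
have {}le4 : 0 <= e * (2 * (a * cos t - t)) by lra.
move: le4; rewrite /e mulrAC pmulr_lge0 ?invr_gt0//.
by rewrite mulrCA pmulr_rge0.
Qed.

Lemma cos_lipschitz (x y : R) : x <= y -> `|cos y - cos x| <= y - x.
Proof.
move=> xy; have [c _ ->] := MVT_segment xy (fun z _ => is_derive_cos z)
  (continuous_subspaceT (@continuous_cos R)).
by rewrite normrM normrN (ger0_norm (_ : 0 <= y - x)) ?subr_ge0// ler_piMl ?subr_ge0// sin_max.
Qed.

(** For [a < 2], letting [2 sin t] tend to [a] from both sides in
    [hilbert_point_H1_sign] forces equality; for [a >= 2] its conclusion is false
    near [t = pi / 2]. The Lipschitz bound for the cosine makes this quantitative. *)
Lemma hilbert_point_H1_only a : 0 < a -> hilbert_point (@H1_norm R) (phi_ a) ->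
  exists t, [/\ 0 < t < pi / 2, a = 2 * sin t & sin (2 * t) = t].
Proof.
move=> a0 hp; have pi0 : 0 < pi :> R := pi_gt0 R.
have pi1 : 1 <= pi / 2 :> R := pihalf_ge1 R.
have sgn := hilbert_point_H1_sign a0 _ hp.
have [a2|a2] := leP 2 a.
  (* near [pi / 2] the sign condition fails *)
  pose e := (2 * (a + 1))^-1.
  have e0 : 0 < e by rewrite invr_gt0; lra.
  have eE : e * (a + 1) = 1 / 2 by rewrite /e; field; lra.
  have e1 : e < 1 by nra.
  have cl : cos (pi / 2 - e) <= e.
    have := @cos_lipschitz (pi / 2 - e) (pi / 2) ltac:(lra).
    by rewrite cos_pihalf sub0r normrN => /(le_trans (ler_norm _)); lra.
  have s1 : sin (pi / 2 - e) < 1.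
    by rewrite -[X in _ < X](@sin_pihalf R) ltr_sin ?in_itv/=; lra.
  have := sgn (pi / 2 - e).
  move=> /(_ ltac:(lra)); rewrite pmulr_rge0; last lra.
  nra.
have a1 : -1 <= a / 2 <= 1 by lra.
pose t := asin (a / 2).
have ta : 2 * sin t = a by rewrite /t asinK ?in_itv/=; lra.
have tpi : t < pi / 2 by apply: asin_ltpi2; lra.
have t0 : 0 < t.
  rewrite -ltr_sin ?in_itv/= ?sin0 ?asin_geNpi2 ?asin_lepi2//; lra.
exists t; split; rewrite ?t0 ?ta//.
have small p q : 0 < p -> 0 < q -> exists m, [/\ 0 < m, m < p & m * (a + 1) < q].
  move=> p0 q0; exists (Num.min (p / 2) (q / (2 * (a + 1)))).
  have a10 : 0 < 2 * (a + 1) by lra.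
  split.
  - by rewrite lt_min !divr_gt0.
  - by rewrite gt_min; apply/orP; left; lra.
  - apply: le_lt_trans (_ : q / (2 * (a + 1)) * (a + 1) < q).
      by rewrite ler_pM2r ?ge_min ?lexx ?orbT//; lra.
    by have -> : q / (2 * (a + 1)) * (a + 1) = q / 2 by [field; lra]; lra.
have key : a * cos t = t.
  apply/eqP; rewrite eq_le; apply/andP; split; rewrite leNgt; apply/negP => lt.
    have [m [m0 mp ma]] := small (pi / 2 - t) (a * cos t - t) ltac:(lra) ltac:(lra).
    have := @cos_lipschitz t (t + m) ltac:(lra).
    have sm : sin t < sin (t + m) by rewrite ltr_sin ?in_itv/=; lra.
    have := sgn (t + m) ltac:(lra).
    rewrite nmulr_rge0; last lra.
    rewrite ler_norml => h /andP[h1 h2]; nra.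
  have [m [m0 mp ma]] := small t (t - a * cos t) ltac:(lra) ltac:(lra).
  have := @cos_lipschitz (t - m) t ltac:(lra).
  have sm : sin (t - m) < sin t by rewrite ltr_sin ?in_itv/=; lra.
  have := sgn (t - m) ltac:(lra).
  rewrite pmulr_rge0; last lra.
  rewrite ler_norml => h /andP[h1 h2]; nra.
by rewrite mulr_natl sin_mulr2n -mulr_natl -[RHS]key -ta; ring.
Qed.

End H1Necessity.

(** * Truncation of the Cauchy kernel *)

Section CauchyKernel.
Variable R : realType.
Notation C := R[i].
Notation T := (measurableTypeR R * measurableTypeR R)%type.
Implicit Types (F G : T -> C) (z : C * C) (r : R).

(** Above the bound [r] the inverse agrees with the nonincreasing function
    [1 / max y r], and monotone functions are measurable. *)
Lemma bounded_measurableV d (S : measurableType d) (u : S -> R) r :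
  measurable_fun setT u -> 0 < r -> (forall x, r <= u x) ->
  bounded_measurable (fun x => (u x)^-1).
Proof.
move=> mu r0 ru; split.
  have -> : (fun x => (u x)^-1) = (fun y => (Num.max y r)^-1) \o u.
    by apply/funext => x /=; rewrite max_l.
  apply: measurableT_comp => //; apply: nonincreasing_measurable => // x y xy.
  have m0 (w : R) : 0 < Num.max w r by rewrite lt_max r0 orbT.
  by rewrite lef_pV2 ?posrE// ge_max !le_max xy lexx orbT.
exists r^-1 => x; have ux0 := lt_le_trans r0 (ru x).
by rewrite ger0_norm ?invr_ge0 ?(ltW ux0)// lef_pV2.
Qed.

Lemma cboundedV F r : cbounded F -> 0 < r -> (forall t, r <= normc (F t)) ->
  cbounded (fun t => (F t)^-1).
Proof.
move=> bF r0 rF.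
have -> : (fun t => (F t)^-1) =
    (fun t => conjc (F t) * real_complex R (normc (F t) ^+ 2)^-1).
  apply/funext => t; rewrite normc_sqr; case: (F t) => a b.
  by apply: complex_ext; rewrite ?ReM ?ImM /= ?mulr0 ?subr0 ?add0r ?mulNr.
apply: cboundedM; first exact: cbounded_conj.
apply: cbounded_real; apply: (@bounded_measurableV _ _ _ (r ^+ 2)).
- by apply: measurable_sq_normc; case: bF => [[? _] [? _]].
- exact: exprn_gt0.
- by move=> t; rewrite ler_pXn2r ?nnegrE ?normc_ge0 ?(ltW r0).
Qed.

Definition cauchy_kernel z (t : T) : C :=
  ((1 - z.1 * conjc (torus_point t).1) * (1 - z.2 * conjc (torus_point t).2))^-1.

Lemma hol_extE f z : hol_ext f z = cint (fun t => f (torus_point t) * cauchy_kernel z t).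
Proof. by []. Qed.

Lemma normc_1B (x : C) r : normc x <= r -> 1 - r <= normc (1 - x).
Proof.
move=> xr; have := le_normcD (1 - x) x; rewrite subrK normc1; lra.
Qed.

Lemma normc_z1 (t : T) : normc (conjc (torus_point t).1) = 1.
Proof. by rewrite normc_conj normc_expi. Qed.
Lemma normc_z2 (t : T) : normc (conjc (torus_point t).2) = 1.
Proof. by rewrite normc_conj normc_expi. Qed.

Lemma kernel_denominator z r t : normc z.1 <= r -> normc z.2 <= r -> r < 1 ->
  (1 - r) ^+ 2 <= normc ((1 - z.1 * conjc (torus_point t).1) *
                         (1 - z.2 * conjc (torus_point t).2)).
Proof.
move=> z1 z2 r1; rewrite normcM expr2 ler_pM//; try lra.
  by apply: normc_1B; rewrite normcM normc_z1 mulr1.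
by apply: normc_1B; rewrite normcM normc_z2 mulr1.
Qed.

Lemma cbounded_cauchy_kernel z r : normc z.1 <= r -> normc z.2 <= r -> r < 1 ->
  cbounded (cauchy_kernel z).
Proof.
move=> z1 z2 r1; apply: (@cboundedV _ ((1 - r) ^+ 2)).
- apply: cboundedM; apply: cboundedB; (try exact: cbounded_cst);
    apply: cboundedM; (try exact: cbounded_cst); apply: cbounded_conj.
    exact: cbounded_z1.
  exact: cbounded_z2.
- by rewrite exprn_gt0// subr_gt0.
- by move=> t; exact: kernel_denominator.
Qed.

Definition kernel_sum N z (t : T) : C :=
  \sum_(k < N) \sum_(l < N) (z.1 ^+ k * z.2 ^+ l * trig (- k%:Z) (- l%:Z) t).

Lemma conjcX (x : C) n : conjc (x ^+ n) = conjc x ^+ n.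
Proof. by elim: n => [|n IH]; rewrite ?conjc1// !exprS conjcM IH. Qed.

Lemma kernel_sumE N z t : kernel_sum N z t =
  (\sum_(k < N) (z.1 * conjc (torus_point t).1) ^+ k) *
  (\sum_(l < N) (z.2 * conjc (torus_point t).2) ^+ l).
Proof.
rewrite /kernel_sum mulr_suml; apply: eq_bigr => k _; rewrite mulr_sumr.
apply: eq_bigr => l _; rewrite !exprMn_comm; try exact: mulrC.
by rewrite -conj_trig -monomial_trig conjcM !conjcX mulrACA.
Qed.

Lemma geometric_sum (x : C) N : (1 - x) * (\sum_(k < N) x ^+ k) = 1 - x ^+ N.
Proof. by rewrite -[1 - x ^+ N]opprB subrX1 -mulNr opprB. Qed.

(** Each geometric series leaves the relative error [a^N] or [b^N]. *)
Lemma kernel_error N z r t : normc z.1 <= r -> normc z.2 <= r -> r < 1 ->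
  normc (cauchy_kernel z t - kernel_sum N z t) <= 3 * r ^+ N / (1 - r) ^+ 2.
Proof.
move=> z1 z2 r1; have r0 : 0 <= r := le_trans (normc_ge0 _) z1.
set a := z.1 * conjc (torus_point t).1; set b := z.2 * conjc (torus_point t).2.
have na : normc a <= r by rewrite normcM normc_z1 mulr1.
have nb : normc b <= r by rewrite normcM normc_z2 mulr1.
have den := kernel_denominator t z1 z2 r1; rewrite -/a -/b in den.
have r2 : 0 < (1 - r) ^+ 2 by rewrite exprn_gt0// subr_gt0.
have den0 : (1 - a) * (1 - b) != 0.
  by apply/eqP => e; move: den; rewrite e normc0 leNgt r2.
have -> : cauchy_kernel z t - kernel_sum N z t =
    (a ^+ N + b ^+ N - a ^+ N * b ^+ N) * ((1 - a) * (1 - b))^-1.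
  apply: (mulIf den0); rewrite mulfVK// mulrBl mulVf// kernel_sumE -/a -/b.
  set A := \sum_(k < N) _; set B := \sum_(k < N) _.
  have eA : (1 - a) * A = 1 - a ^+ N := geometric_sum a N.
  have eB : (1 - b) * B = 1 - b ^+ N := geometric_sum b N.
  have -> : A * B * ((1 - a) * (1 - b)) = ((1 - a) * A) * ((1 - b) * B) by ring.
  rewrite eA eB; ring.
have aN : normc (a ^+ N) <= r ^+ N.
  by rewrite normcX lerXn2r ?nnegrE ?normc_ge0.
have bN : normc (b ^+ N) <= r ^+ N.
  by rewrite normcX lerXn2r ?nnegrE ?normc_ge0.
rewrite normcM ler_pM ?normc_ge0//; last first.
  by rewrite normcV lef_pV2 ?posrE// (lt_le_trans r2).
have abN : normc (a ^+ N * b ^+ N) <= r ^+ N.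
  rewrite normcM -[leRHS]mulr1 ler_pM ?normc_ge0//.
  by rewrite (le_trans bN)// exprn_ile1// ltW.
have := le_normcD (a ^+ N + b ^+ N) (- (a ^+ N * b ^+ N)).
have := le_normcD (a ^+ N) (b ^+ N); rewrite normcN; lra.
Qed.

Definition coef F (k l : nat) : C := cint (fun t => F t * trig (- k%:Z) (- l%:Z) t).

(** Replacing the Cauchy kernel by its partial sum costs O(r^N), uniformly in
    the function as long as its norm is controlled. *)
Lemma hol_ext_trunc f N z r : sq_integrable (f \o @torus_point R) ->
  normc z.1 <= r -> normc z.2 <= r -> r < 1 ->
  normc (hol_ext f z - \sum_(k < N) \sum_(l < N)
      (z.1 ^+ k * z.2 ^+ l * coef (f \o @torus_point R) k l)) <=
  6 * r ^+ N / (1 - r) ^+ 2 * Num.sqrt (sqnorm (f \o @torus_point R)).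
Proof.
move=> f2 z1 z2 r1; set F := f \o _ in f2 *.
have r0 : 0 <= r := le_trans (normc_ge0 _) z1.
have fi := sq_integrable_cintegrable f2.
have bk := cbounded_cauchy_kernel z1 z2 r1.
have ift k l : cintegrable (fun t => F t * trig (- k%:Z) (- l%:Z) t).
  under [X in cintegrable X]eq_fun do rewrite mulrC.
  by apply: cintegrableM => //; exact: cbounded_trig.
have icft (c : C) k l : cintegrable (fun t => c * (F t * trig (- k%:Z) (- l%:Z) t)).
  by apply: cintegrableM => //; exact: cbounded_cst.
have sumE : \sum_(k < N) \sum_(l < N) (z.1 ^+ k * z.2 ^+ l * coef F k l) =
    cint (fun t => kernel_sum N z t * F t).
  transitivity (cint (fun t => \sum_(k < N) \sum_(l < N)
      (z.1 ^+ k * z.2 ^+ l * (F t * trig (- k%:Z) (- l%:Z) t)))); last first.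
    congr cint; apply/funext => t; rewrite mulr_suml; apply: eq_bigr => k _.
    by rewrite mulr_suml; apply: eq_bigr => l _; ring.
  rewrite (cint_sum _ _).2 => [|k]; last by apply: (cint_sum _ _).1 => l.
  apply: eq_bigr => k _; rewrite (cint_sum _ _).2 => [|l //].
  by apply: eq_bigr => l _; rewrite cintZ.
have bks : cbounded (kernel_sum N z).
  apply: cbounded_sum => k; apply: cbounded_sum => l.
  by apply: cboundedM; [exact: cbounded_cst|exact: cbounded_trig].
have -> : hol_ext f z - \sum_(k < N) \sum_(l < N) (z.1 ^+ k * z.2 ^+ l * coef F k l) =
    cint (fun t => (cauchy_kernel z t - kernel_sum N z t) * F t).
  rewrite sumE hol_extE -mulN1r -cintZ; last exact: cintegrableM.
  rewrite -cintD.
  - by congr cint; apply/funext => t; rewrite /F /=; ring.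
  - by under [X in cintegrable X]eq_fun do rewrite mulrC; exact: cintegrableM.
  - by apply: cintegrableM; [exact: cbounded_cst|exact: cintegrableM].
set M := 3 * r ^+ N / (1 - r) ^+ 2.
have M0 : 0 <= M by rewrite divr_ge0 ?mulr_ge0 ?exprn_ge0// subr_ge0 ltW.
have in1 := sq_integrable_normc f2.
apply: le_trans (cint_norm_le (v := fun t => M * normc (F t)) _ _ _) _.
- by apply: cintegrableM => //; exact: cboundedB.
- exact: torus_integrableZ.
- by move=> t; rewrite normcM ler_wpM2r ?normc_ge0//; exact: kernel_error.
rewrite torus_intZ// mulrA.
have -> : 6 * r ^+ N / (1 - r) ^+ 2 = 2 * M by rewrite /M; ring.
by apply: ler_wpM2l; [rewrite mulr_ge0|exact: torus_int_normc_le].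
Qed.

End CauchyKernel.

(** * Holomorphic extensions and Bessel inequality *)

Section HolomorphicExtension.
Variable R : realType.
Notation C := R[i].
Notation T := (measurableTypeR R * measurableTypeR R)%type.
Implicit Types (F G : T -> C) (z : C * C) (r : R).

Lemma coef_trig (i j k l : nat) :
  coef (@trig R i j) k l = (k == i)%:R * (l == j)%:R.
Proof.
rewrite /coef; transitivity (cint (@trig R (i%:Z - k%:Z) (j%:Z - l%:Z))).
  by congr cint; apply/funext => t; rewrite trigM.
rewrite cint_trig !subr_eq0 !eqz_nat (eq_sym i) (eq_sym j).
by case: (k == i); case: (l == j); rewrite /= ?mulr1 ?mulr0.
Qed.

Lemma sum_delta (N i : nat) (u : nat -> C) : (i < N)%N ->
  \sum_(k < N) u k * (k == i :> nat)%:R = u i.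
Proof.
move=> iN; rewrite (bigD1 (Ordinal iN))//= eqxx mulr1 big1 ?addr0// => k ki.
suff /negbTE -> : k != i :> nat by rewrite mulr0.
by apply: contra ki => /eqP e; apply/eqP/val_inj.
Qed.

Lemma exists_small_pow r e m : 0 <= r < 1 -> 0 < e -> exists2 N, (m < N)%N & r ^+ N < e.
Proof.
move=> /andP[r0 r1] e0.
have /cvgrPdist_lt/(_ e e0) : r ^+ n @[n --> \oo] --> (0 : R).
  by apply: cvg_expr; rewrite ger0_norm.
move=> [M _ H]; exists (maxn M m.+1); first by rewrite leq_max ltnSn orbT.
have := H (maxn M m.+1); rewrite /= sub0r normrN ger0_norm ?exprn_ge0//.
by apply; exact: leq_maxl.
Qed.

Lemma bidisc_normc z : bidisc z <-> normc z.1 < 1 /\ normc z.2 < 1.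
Proof.
have E (x : C) : (`|x| < 1) = (normc x < 1).
  by rewrite normc_def -[1]/(real_complex R 1) ltcR; case: x.
by rewrite /bidisc /= !E.
Qed.

(** The truncated Cauchy integral is exact for large [N], and the error of the
    truncation tends to 0. *)
Lemma hol_ext_monomial (i j : nat) z : bidisc z ->
  cint (fun t => trig i j t * cauchy_kernel z t) = z.1 ^+ i * z.2 ^+ j.
Proof.
move=> /bidisc_normc[z1 z2].
pose r := Num.max (normc z.1) (normc z.2).
have r1 : r < 1 by rewrite gt_max z1.
have zr1 : normc z.1 <= r by rewrite le_max lexx.
have zr2 : normc z.2 <= r by rewrite le_max lexx orbT.
have r0 : 0 <= r := le_trans (normc_ge0 _) zr1.
pose f (w : C * C) : C := w.1 ^+ i * w.2 ^+ j.
have fE : f \o @torus_point R = trig i j.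
  by apply/funext => t; rewrite -monomial_trig.
have f2 : sq_integrable (f \o @torus_point R).
  by rewrite fE; apply/cbounded_sq_integrable; exact: cbounded_trig.
have -> : cint (fun t => trig i j t * cauchy_kernel z t) = hol_ext f z.
  by rewrite hol_extE; congr cint; apply/funext => t; rewrite -fE.
apply/eqP; rewrite -subr_eq0; apply/eqP/eq0_normc/eqP.
rewrite eq_le normc_ge0 andbT; apply/ler_addgt0Pl => e e0; rewrite addr0.
pose B := 6 / (1 - r) ^+ 2 * Num.sqrt (sqnorm (f \o @torus_point R)).
have B0 : 0 <= B by rewrite mulr_ge0 ?sqrtr_ge0// divr_ge0 ?sqr_ge0.
have [N mN rN] := @exists_small_pow r (e / (B + 1)) (maxn i j)
  (introT andP (conj r0 r1)) (divr_gt0 e0 (ltr_wpDl B0 ltr01)).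
have [iN jN] : (i < N)%N /\ (j < N)%N.
  by split; apply: leq_ltn_trans mN; rewrite ?leq_maxl ?leq_maxr.
have := hol_ext_trunc N f2 zr1 zr2 r1.
rewrite fE.
have -> : \sum_(k < N) \sum_(l < N) (z.1 ^+ k * z.2 ^+ l * coef (@trig R i j) k l) = f z.
  rewrite /f -(sum_delta (fun k => z.1 ^+ k) iN) mulr_suml; apply: eq_bigr => k _.
  rewrite -(sum_delta (fun l => z.2 ^+ l) jN) mulr_sumr; apply: eq_bigr => l _.
  by rewrite coef_trig mulrACA.
move=> /le_trans; apply.
have -> : 6 * r ^+ N / (1 - r) ^+ 2 * Num.sqrt (sqnorm (@trig R i j)) = r ^+ N * B.
  by rewrite /B fE; ring.
move: rN; rewrite ltr_pdivlMr ?ltr_wpDl// => /ltW; apply: le_trans.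
by rewrite ler_wpM2l ?exprn_ge0// lerDl.
Qed.

Lemma hol_ext_poly (f : C * C -> C) (P : {poly {poly C}}) z :
  (forall w, f w = P.[w.1, w.2]) -> bidisc z -> hol_ext f z = f z.
Proof.
move=> fP bz; rewrite hol_extE fP (horner_coef P) horner_sum.
have [z1 z2] := (bidisc_normc z).1 bz.
have bk : cbounded (cauchy_kernel z).
  by apply: (@cbounded_cauchy_kernel _ _ (Num.max (normc z.1) (normc z.2)));
    rewrite ?le_max ?lexx ?orbT// gt_max z1.
have btk (i j : nat) : cintegrable (fun t => trig i j t * cauchy_kernel z t).
  by apply/cbounded_integrable/cboundedM => //; exact: cbounded_trig.
have bctk (c : C) (i j : nat) : cintegrable (fun t => c * (trig i j t * cauchy_kernel z t)).
  by apply: cintegrableM => //; exact: cbounded_cst.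
transitivity (cint (fun t => \sum_(i < size P) \sum_(j < size P`_i)
    (P`_i`_j * (trig i j t * cauchy_kernel z t)))).
  congr cint; apply/funext => t; rewrite fP poly_trig mulr_suml; apply: eq_bigr => i _.
  by rewrite mulr_suml; apply: eq_bigr => j _; rewrite mulrA.
rewrite (cint_sum _ _).2 => [|i]; last by apply: (cint_sum _ _).1.
apply: eq_bigr => i _; rewrite (cint_sum _ _).2//.
rewrite hornerM -polyC_exp hornerC horner_coef mulr_suml; apply: eq_bigr => j _.
by rewrite cintZ// hol_ext_monomial//; ring.
Qed.

(** Bessel's inequality: subtracting from a function its component along one
    character lowers the squared norm by the square of that coefficient, and
    leaves the coefficients along the other characters unchanged. *)
Lemma bessel (s : seq (nat * nat)) F : uniq s -> sq_integrable F ->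
  \sum_(p <- s) normc (coef F p.1 p.2) ^+ 2 <= sqnorm F.
Proof.
elim: s F => [|[k l] s IH] F; first by rewrite big_nil sqnorm_ge0.
rewrite cons_uniq => /andP[ps us] F2; rewrite big_cons /=.
set c := coef F k l; pose G (t : T) : C := F t + - c * trig k l t.
have bt := @cbounded_trig R k l.
have G2 : sq_integrable G.
  apply: sq_integrableD => //; apply: cbounded_sq_integrable.
  by apply: cboundedM => //; exact: cbounded_cst.
have Fi := sq_integrable_cintegrable F2.
have iFt (m n : int) : cintegrable (fun t => F t * trig m n t).
  under [X in cintegrable X]eq_fun do rewrite mulrC.
  by apply: cintegrableM => //; exact: cbounded_trig.
have eqs : \sum_(p <- s) normc (coef F p.1 p.2) ^+ 2 =
           \sum_(p <- s) normc (coef G p.1 p.2) ^+ 2.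
  apply: eq_big_seq => -[m n] pin; suff -> : coef F m n = coef G m n by [].
  have mn : (m == k)%:R * (n == l)%:R = 0 :> C.
    have : (m, n) != (k, l) by apply: contraNneq ps => <-.
    by rewrite xpair_eqE; case: (m == k); case: (n == l); rewrite /= ?mulr0 ?mul0r.
  have -> : coef G m n = coef F m n + - c * coef (@trig R k l) m n.
    rewrite /coef -cintZ; last first.
      by apply/cbounded_integrable/cboundedM => //; exact: cbounded_trig.
    rewrite -cintD//.
      by congr cint; apply/funext => t; rewrite /G; ring.
    apply: cintegrableM; first exact: cbounded_cst.
    by apply/cbounded_integrable/cboundedM => //; exact: cbounded_trig.
  by rewrite coef_trig mn mulr0 addr0.
have sqG : sqnorm G = sqnorm F - normc c ^+ 2.
  have [_ iF2] := F2.
  pose u (t : T) := complex.Re (conjc c * (F t * trig (- k%:Z) (- l%:Z) t)).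
  have iu0 : cintegrable (fun t => conjc c * (F t * trig (- k%:Z) (- l%:Z) t)).
    by apply: cintegrableM => //; exact: cbounded_cst.
  have iu : torus_integrable u by case: iu0.
  have uE : torus_int u = normc c ^+ 2.
    transitivity (complex.Re (cint (fun t => conjc c * (F t * trig (- k%:Z) (- l%:Z) t)))) => //.
    rewrite cintZ// -/(coef F k l) -/c ReM Re_conj Im_conj normc_sqr; ring.
  have ic : torus_integrable (fun=> normc c ^+ 2).
    exact/bounded_measurable_torus_integrable/bounded_measurable_cst.
  transitivity (torus_int (fun t => normc (F t) ^+ 2 + (-2 * u t + normc c ^+ 2))).
    congr torus_int; apply/funext => t; rewrite /u -conj_trig /G.
    have := normc_trig k l t; set e := trig _ _ _ => ne.
    have {ne} : normc e ^+ 2 = 1 by rewrite ne expr1n.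
    rewrite !normc_sqr !(ReM, ImM, ReD, ImD, ReN, ImN, Re_conj, Im_conj).
    set er := complex.Re e; set ei := complex.Im e; set fr := complex.Re (F t).
    set fi := complex.Im (F t); set cr := complex.Re c; set ci := complex.Im c => ne.
    transitivity (fr ^+ 2 + fi ^+ 2 + (-2 * (cr * (fr * er - fi * - ei) -
       - ci * (fr * - ei + fi * er)) + (cr ^+ 2 + ci ^+ 2) * (er ^+ 2 + ei ^+ 2))).
      ring.
    by rewrite ne mulr1.
  rewrite torus_intD//; last by apply: torus_integrableD => //; exact: torus_integrableZ.
  rewrite torus_intD//; last exact: torus_integrableZ.
  rewrite torus_intZ// uE torus_int_cst; rewrite /sqnorm; ring.
rewrite eqs -lerBrDl; move: (IH G us G2); rewrite sqG; exact.
Qed.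

End HolomorphicExtension.

(** * Hankel forms of quadratic symbols *)

Section CauchySchwarz.
Variable R : realType.

Lemma cauchy_schwarz3 (a1 a2 a3 b1 b2 b3 A B : R) : 0 <= A -> 0 <= B ->
  a1 ^+ 2 + a2 ^+ 2 + a3 ^+ 2 <= A ^+ 2 -> b1 ^+ 2 + b2 ^+ 2 + b3 ^+ 2 <= B ^+ 2 ->
  a1 * b1 + a2 * b2 + a3 * b3 <= A * B.
Proof.
move=> A0 B0 hA hB; apply: le_trans (ler_norm _) _.
rewrite -(ler_pXn2r (_ : (0 < 2)%N)) ?nnegrE ?mulr_ge0// real_normK ?num_real// exprMn.
apply: le_trans (_ : (a1 ^+ 2 + a2 ^+ 2 + a3 ^+ 2) * (b1 ^+ 2 + b2 ^+ 2 + b3 ^+ 2) <= _).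
  rewrite -subr_ge0.
  have -> : (a1 ^+ 2 + a2 ^+ 2 + a3 ^+ 2) * (b1 ^+ 2 + b2 ^+ 2 + b3 ^+ 2) -
    (a1 * b1 + a2 * b2 + a3 * b3) ^+ 2 = (a1 * b2 - a2 * b1) ^+ 2 +
    (a1 * b3 - a3 * b1) ^+ 2 + (a2 * b3 - a3 * b2) ^+ 2 by ring.
  by rewrite !addr_ge0// sqr_ge0.
by apply: ler_pM => //; rewrite !addr_ge0// sqr_ge0.
Qed.

(** The Hankel form of the symbol [b (z1^2 + z2^2) + c z1 z2] splits according
    to the degrees of the two arguments: its parts of bidegree (0, 2) and (2, 0)
    have norm [sqrt (2 b^2 + c^2)] and the one of bidegree (1, 1) has norm
    [b + c]. *)
Lemma hankel_bound (b c g0 g10 g01 g20 g11 g02 h0 h10 h01 h20 h11 h02 G H : R) :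
  0 <= b -> 0 <= c -> 2 * b ^+ 2 + c ^+ 2 <= 1 -> b + c <= 1 ->
  0 <= g0 -> 0 <= h0 -> 0 <= G -> 0 <= H ->
  g0 ^+ 2 + g10 ^+ 2 + g01 ^+ 2 + g20 ^+ 2 + g11 ^+ 2 + g02 ^+ 2 <= G ^+ 2 ->
  h0 ^+ 2 + h10 ^+ 2 + h01 ^+ 2 + h20 ^+ 2 + h11 ^+ 2 + h02 ^+ 2 <= H ^+ 2 ->
  g0 * (b * h20 + b * h02 + c * h11) + h0 * (b * g20 + b * g02 + c * g11) +
  b * (g10 * h10 + g01 * h01) + c * (g10 * h01 + g01 * h10) <= G * H.
Proof.
move=> b0 c0 bc1 bc2 g00 h00 G0 H0 hG hH.
pose N (x y z : R) := Num.sqrt (x ^+ 2 + y ^+ 2 + z ^+ 2).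
have N0 x y z : 0 <= N x y z := sqrtr_ge0 _.
have N2 x y z : N x y z ^+ 2 = x ^+ 2 + y ^+ 2 + z ^+ 2.
  by rewrite sqr_sqrtr// !addr_ge0// sqr_ge0.
have hg : b * g20 + b * g02 + c * g11 <= 1 * N g20 g02 g11.
  by apply: cauchy_schwarz3 => //; rewrite ?N2// expr1n; lra.
have hh : b * h20 + b * h02 + c * h11 <= 1 * N h20 h02 h11.
  by apply: cauchy_schwarz3 => //; rewrite ?N2// expr1n; lra.
have e1 : g10 * h10 + g01 * h01 + 0 * 0 <= N g10 g01 0 * N h10 h01 0.
  by apply: cauchy_schwarz3 => //; rewrite N2.
have e2 : g10 * h01 + g01 * h10 + 0 * 0 <= N g10 g01 0 * N h10 h01 0.
  by apply: cauchy_schwarz3 => //; rewrite N2; lra.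
have e3 : g0 * N h20 h02 h11 + N g20 g02 g11 * h0 + N g10 g01 0 * N h10 h01 0 <= G * H.
  by apply: cauchy_schwarz3 => //; rewrite !N2; lra.
have n0 := mulr_ge0 (N0 g10 g01 0) (N0 h10 h01 0).
set X := N g10 g01 0 * _ in e1 e2 e3 n0.
have p1 := ler_wpM2l g00 hh; have p2 := ler_wpM2l h00 hg.
have p3 : b * (g10 * h10 + g01 * h01) <= b * X by apply: ler_wpM2l => //; lra.
have p4 : c * (g10 * h01 + g01 * h10) <= c * X by apply: ler_wpM2l => //; lra.
have p5 : (b + c) * X <= X by rewrite ler_piMl.
lra.
Qed.

End CauchySchwarz.

(** * Second differences *)

Section SecondDifference.
Variable R : realType.
Notation C := R[i].
Notation "x %:C" := (real_complex R x).
Implicit Types (x y r : R) (q : nat -> nat -> C) (U V : R -> R -> C).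

Lemma normcD_le (u v : C) (a b : R) : normc u <= a -> normc v <= b -> normc (u + v) <= a + b.
Proof. by move=> ua vb; apply: le_trans (le_normcD _ _) _; exact: lerD. Qed.

Lemma normcB_le (u v : C) (a b : R) : normc u <= a -> normc v <= b -> normc (u - v) <= a + b.
Proof. by move=> ua vb; apply: normcD_le => //; rewrite normcN. Qed.

Lemma normcM_le (u v : C) (a b : R) : normc u <= a -> normc v <= b -> normc (u * v) <= a * b.
Proof. by move=> ua vb; rewrite normcM ler_pM// normc_ge0. Qed.

Lemma normc_pos_real (a : R) : 0 <= a -> normc (a%:C) = a.
Proof. by move=> a0; rewrite normc_real ger0_norm. Qed.

Definition taylor2 q x y : C :=
  q 0%N 0%N + x%:C * q 1%N 0%N + y%:C * q 0%N 1%N +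
  x%:C ^+ 2 * q 2%N 0%N + x%:C * y%:C * q 1%N 1%N + y%:C ^+ 2 * q 0%N 2%N.

(** The combination of second differences that annihilates constants and odd
    functions and reads off [b (q20 + q02) + c q11] from a Taylor polynomial. It involves nine
    values only, so it passes to pointwise limits. *)
Definition second_diff (b c r : R) U : C :=
  (b / 2)%:C * (U r 0 + U (- r) 0 + U 0 r + U 0 (- r) - 4 * U 0 0) +
  (c / 4)%:C * (U r r + U (- r) (- r) - U r (- r) - U (- r) r).

Lemma second_diffD b c r U V :
  second_diff b c r (fun x y => U x y + V x y) = second_diff b c r U + second_diff b c r V.
Proof. rewrite /second_diff; ring. Qed.

Lemma second_diff_sum b c r n (U : nat -> R -> R -> C) :
  second_diff b c r (fun x y => \sum_(j < n) U j x y) = \sum_(j < n) second_diff b c r (U j).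
Proof.
elim: n => [|n IH]; first by rewrite /second_diff !big_ord0; ring.
rewrite big_ord_recr /= -IH -second_diffD; congr second_diff.
by apply/funext => x; apply/funext => y; rewrite big_ord_recr.
Qed.

Lemma second_diff_bound b c r U (M : R) : 0 <= b -> 0 <= c -> b + c <= 1 ->
  0 <= M ->
  (forall x y, x \in [:: r; - r; 0] -> y \in [:: r; - r; 0] -> normc (U x y) <= M) ->
  normc (second_diff b c r U) <= 4 * M.
Proof.
move=> b0 c0 bc M0 H.
have i1 : r \in [:: r; - r; 0] by rewrite !inE eqxx.
have i2 : - r \in [:: r; - r; 0] by rewrite !inE eqxx orbT.
have i3 : 0 \in [:: r; - r; 0] by rewrite !inE eqxx !orbT.
have UM := (H _ _ i1 i1, H _ _ i1 i2, H _ _ i1 i3, H _ _ i2 i1, H _ _ i2 i2,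
  H _ _ i2 i3, H _ _ i3 i1, H _ _ i3 i2, H _ _ i3 i3).
have b2 : 0 <= b / 2 by lra. have c4 : 0 <= c / 4 by lra.
apply: le_trans (_ : b / 2 * (M + M + M + M + 4 * M) + c / 4 * (M + M + M + M) <= _).
  apply: normcD_le; apply: normcM_le; rewrite ?normc_pos_real//.
    apply: normcB_le; first by repeat apply: normcD_le; rewrite UM.
    apply: normcM_le; last by rewrite UM.
    by rewrite (_ : 4 = (4 : R)%:C) ?normc_pos_real ?rmorph_nat.
  by do 2 (apply: normcB_le; last by rewrite UM); apply: normcD_le; rewrite UM.
have : (b + c) * M <= M by rewrite ler_piMl.
have : 0 <= c * M by rewrite mulr_ge0.
lra.
Qed.

Lemma second_diff_taylor2 b c r q : second_diff b c r (taylor2 q) =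
  (r ^+ 2)%:C * (b%:C * (q 2%N 0%N + q 0%N 2%N) + c%:C * q 1%N 1%N).
Proof.
have b2 : b%:C = 2 * (b / 2)%:C.
  by rewrite -[2 in RHS](rmorph_nat (real_complex R)) -rmorphM; congr (real_complex R _); field.
have c4 : c%:C = 4 * (c / 4)%:C.
  by rewrite -[4 in RHS](rmorph_nat (real_complex R)) -rmorphM; congr (real_complex R _); field.
rewrite b2 c4 /second_diff /taylor2 !rmorphN rmorphXn rmorph0; ring.
Qed.

Definition hankel b c (g h : nat -> nat -> C) : C :=
  g 0%N 0%N * (b%:C * h 2%N 0%N + b%:C * h 0%N 2%N + c%:C * h 1%N 1%N) +
  h 0%N 0%N * (b%:C * g 2%N 0%N + b%:C * g 0%N 2%N + c%:C * g 1%N 1%N) +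
  b%:C * (g 1%N 0%N * h 1%N 0%N + g 0%N 1%N * h 0%N 1%N) +
  c%:C * (g 1%N 0%N * h 0%N 1%N + g 0%N 1%N * h 1%N 0%N).

(** Symmetry under [(x, y) -> (- x, - y)] cancels the terms of odd degree, so the
    error beyond the Hankel form is of degree four. *)
Lemma second_diff_taylor2M b c r g h :
  second_diff b c r (fun x y => taylor2 g x y * taylor2 h x y) =
  (r ^+ 2)%:C * hankel b c g h + (r ^+ 4)%:C *
   (b%:C * (g 2%N 0%N * h 2%N 0%N + g 0%N 2%N * h 0%N 2%N) +
    c%:C * (g 2%N 0%N * h 1%N 1%N + g 1%N 1%N * h 2%N 0%N +
            g 0%N 2%N * h 1%N 1%N + g 1%N 1%N * h 0%N 2%N)).
Proof.
have b2 : b%:C = 2 * (b / 2)%:C.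
  by rewrite -[2 in RHS](rmorph_nat (real_complex R)) -rmorphM; congr (real_complex R _); field.
have c4 : c%:C = 4 * (c / 4)%:C.
  by rewrite -[4 in RHS](rmorph_nat (real_complex R)) -rmorphM; congr (real_complex R _); field.
rewrite /hankel b2 c4 /second_diff /taylor2 !rmorphN !rmorphXn rmorph0; ring.
Qed.

Lemma taylor2_bound q x y (M : R) : 0 <= M -> `|x| <= 1 -> `|y| <= 1 ->
  (forall k l, normc (q k l) <= M) -> normc (taylor2 q x y) <= 6 * M.
Proof.
move=> M0 x1 y1 qM.
apply: le_trans (_ : M + 1 * M + 1 * M + 1 ^+ 2 * M + 1 * 1 * M + 1 ^+ 2 * M <= _); last lra.
have nx : normc x%:C <= 1 by rewrite normc_real.
have ny : normc y%:C <= 1 by rewrite normc_real.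
have sq (u : C) : normc u <= 1 -> normc (u ^+ 2) <= 1 ^+ 2.
  by move=> u1; rewrite !expr2; exact: normcM_le.
repeat apply: normcD_le; rewrite ?qM//; apply: normcM_le => //; try exact: sq.
exact: normcM_le.
Qed.

End SecondDifference.

(** * Lower bounds for the weak product norm *)

Section WeakNormLower.
Variable R : realType.
Notation C := R[i].
Notation T := (measurableTypeR R * measurableTypeR R)%type.
Notation "x %:C" := (real_complex R x).
Implicit Types (f g h : C * C -> C) (x y r b c : R).

Definition L2 f : R := Num.sqrt (sqnorm (f \o @torus_point R)).
Definition fcoef f := coef (f \o @torus_point R).

Lemma L2_ge0 f : 0 <= L2 f. Proof. exact: sqrtr_ge0. Qed.

Lemma L2_sqr f : L2 f ^+ 2 = sqnorm (f \o @torus_point R).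
Proof. by rewrite sqr_sqrtr// sqnorm_ge0. Qed.

Lemma fcoef_le f k l : sq_integrable (f \o @torus_point R) -> normc (fcoef f k l) <= L2 f.
Proof.
move=> f2; have := @bessel R [:: (k, l)] _ isT f2; rewrite big_seq1 -L2_sqr.
by rewrite ler_pXn2r ?nnegrE ?normc_ge0 ?L2_ge0.
Qed.

Lemma fcoef_bessel f : sq_integrable (f \o @torus_point R) ->
  normc (fcoef f 0 0) ^+ 2 + normc (fcoef f 1 0) ^+ 2 + normc (fcoef f 0 1) ^+ 2 +
  normc (fcoef f 2 0) ^+ 2 + normc (fcoef f 1 1) ^+ 2 + normc (fcoef f 0 2) ^+ 2 <= L2 f ^+ 2.
Proof.
move=> f2.
have := @bessel R [:: (0, 0); (1, 0); (0, 1); (2, 0); (1, 1); (0, 2)]%N _ isT f2.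
by rewrite !big_cons big_nil -L2_sqr addr0 !addrA.
Qed.

Definition hol_real f x y : C := hol_ext f (x%:C, y%:C).

(** For [r <= 1/2] the truncation of the kernel at order 3 costs [24 r^3]; the three
    terms of degree three and four that it keeps cost [r^3] each. *)
Lemma hol_real_taylor2 f x y r : sq_integrable (f \o @torus_point R) ->
  r <= 1 / 2 -> `|x| <= r -> `|y| <= r ->
  normc (hol_real f x y - taylor2 (fcoef f) x y) <= 27 * r ^+ 3 * L2 f.
Proof.
move=> f2 r12 xr yr.
have r0 : 0 <= r := le_trans (normr_ge0 _) xr.
have r1 : r < 1 by lra.
have [z [z1 z2 zE]] : exists z : C * C,
    [/\ z.1 = x%:C, z.2 = y%:C & hol_real f x y = hol_ext f z].
  by exists (x%:C, y%:C).
have nx : normc x%:C <= r by rewrite normc_real.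
have ny : normc y%:C <= r by rewrite normc_real.
have := @hol_ext_trunc _ f 3 z r f2; rewrite z1 z2 -zE => /(_ nx ny r1).
rewrite -/(L2 f) -/(fcoef f).
have -> : \sum_(k < 3) \sum_(l < 3) (x%:C ^+ k * y%:C ^+ l * fcoef f k l) =
    taylor2 (fcoef f) x y + (x%:C ^+ 2 * y%:C * fcoef f 2 1 +
    x%:C * y%:C ^+ 2 * fcoef f 1 2 + x%:C ^+ 2 * y%:C ^+ 2 * fcoef f 2 2).
  by rewrite !big_ord_recr !big_ord0 /= /taylor2; ring.
set S := (X in taylor2 _ _ _ + X) => e1.
have -> : hol_real f x y - taylor2 (fcoef f) x y =
    (hol_real f x y - (taylor2 (fcoef f) x y + S)) + S by ring.
have cb k l := fcoef_le k l f2.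
have sq (u : C) : normc u <= r -> normc (u ^+ 2) <= r ^+ 2.
  by move=> u1; rewrite !expr2; exact: normcM_le.
have r3 : 0 <= r ^+ 3 by rewrite exprn_ge0.
have L0 := L2_ge0 f.
have rL := mulr_ge0 r3 L0.
have e2 : 6 * r ^+ 3 / (1 - r) ^+ 2 * L2 f <= 24 * (r ^+ 3 * L2 f).
  have i4 : (1 - r) ^- 2 <= 4.
    rewrite -[leRHS]invrK lef_pV2 ?posrE ?invr_gt0 ?exprn_gt0 ?subr_gt0//.
    have : 0 <= (1 / 2 - r) * (3 / 2 - r) by apply: mulr_ge0; lra.
    rewrite !expr2; lra.
  have -> : 6 * r ^+ 3 / (1 - r) ^+ 2 * L2 f = (6 * (r ^+ 3 * L2 f)) * (1 - r) ^- 2 by ring.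
  have -> : 24 * (r ^+ 3 * L2 f) = 6 * (r ^+ 3 * L2 f) * 4 by ring.
  by apply: ler_wpM2l => //; rewrite mulr_ge0.
have t1 : normc (x%:C ^+ 2 * y%:C * fcoef f 2 1) <= r ^+ 2 * r * L2 f.
  by apply: normcM_le => //; apply: normcM_le => //; exact: sq.
have t2 : normc (x%:C * y%:C ^+ 2 * fcoef f 1 2) <= r * r ^+ 2 * L2 f.
  by apply: normcM_le => //; apply: normcM_le => //; exact: sq.
have t3 : normc (x%:C ^+ 2 * y%:C ^+ 2 * fcoef f 2 2) <= r ^+ 2 * r ^+ 2 * L2 f.
  by apply: normcM_le => //; apply: normcM_le => //; exact: sq.
have rr : r ^+ 2 * r ^+ 2 * L2 f <= r ^+ 3 * L2 f.
  have -> : r ^+ 2 * r ^+ 2 * L2 f = r * (r ^+ 3 * L2 f) by ring.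
  by rewrite ler_piMl// ltW.
apply: le_trans (normcD_le (le_trans e1 e2) (normcD_le (normcD_le t1 t2) (le_trans t3 rr))) _.
lra.
Qed.

Lemma grid_le x r : 0 <= r -> x \in [:: r; - r; 0] -> `|x| <= r.
Proof.
by move=> r0; rewrite !inE => /or3P[] /eqP ->; rewrite ?normrN ?normr0// ger0_norm.
Qed.

Section Symbol.
Variables b c : R.
Hypotheses (b0 : 0 <= b) (c0 : 0 <= c) (bc1 : 2 * b ^+ 2 + c ^+ 2 <= 1) (bc2 : b + c <= 1).

Definition symbol_pairing f : C :=
  b%:C * (fcoef f 2 0 + fcoef f 0 2) + c%:C * fcoef f 1 1.

Lemma second_diff_hol f r : sq_integrable (f \o @torus_point R) -> 0 <= r <= 1 / 2 ->
  normc (second_diff b c r (hol_real f) - (r ^+ 2)%:C * symbol_pairing f) <=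
  108 * r ^+ 3 * L2 f.
Proof.
move=> f2 /andP[r0 r12].
have -> : second_diff b c r (hol_real f) - (r ^+ 2)%:C * symbol_pairing f =
    second_diff b c r (fun x y => hol_real f x y - taylor2 (fcoef f) x y).
  rewrite -second_diff_taylor2 -[in LHS](_ : second_diff b c r (fun x y =>
    (hol_real f x y - taylor2 (fcoef f) x y) + taylor2 (fcoef f) x y) =
    second_diff b c r (hol_real f)).
    by rewrite second_diffD addrK.
  by congr second_diff; apply/funext => x; apply/funext => y; rewrite subrK.
have -> : 108 * r ^+ 3 * L2 f = 4 * (27 * r ^+ 3 * L2 f) by ring.
apply: second_diff_bound => //; first by rewrite !mulr_ge0 ?exprn_ge0 ?L2_ge0.
by move=> x y /(grid_le r0) xr /(grid_le r0) yr; exact: hol_real_taylor2.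
Qed.

Lemma hankel_le g h : sq_integrable (g \o @torus_point R) ->
  sq_integrable (h \o @torus_point R) ->
  normc (hankel b c (fcoef g) (fcoef h)) <= L2 g * L2 h.
Proof.
move=> g2 h2.
have nb : normc (b%:C) <= b by rewrite normc_pos_real.
have nc : normc (c%:C) <= c by rewrite normc_pos_real.
apply: le_trans (hankel_bound b0 c0 bc1 bc2 (normc_ge0 _) (normc_ge0 _)
  (L2_ge0 g) (L2_ge0 h) (fcoef_bessel g2) (fcoef_bessel h2)).
rewrite /hankel.
apply: normcD_le; first apply: normcD_le; first apply: normcD_le.
- apply: normcM_le => //; apply: normcD_le; first apply: normcD_le; exact: normcM_le.
- apply: normcM_le => //; apply: normcD_le; first apply: normcD_le; exact: normcM_le.
- by apply: normcM_le => //; apply: normcD_le; exact: normcM_le.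
- by apply: normcM_le => //; apply: normcD_le; exact: normcM_le.
Qed.

(** A single constant serves for all pairs of factors; this uniformity lets the
    estimate be summed over a weak factorization. It comes from the remainders
    [27 r^3] against the bound [6] of the Taylor polynomials,
    [6 * 27 + 27 * 6 + 27 * 27 = 27 * 39], from the four-fold loss in
    [second_diff_bound], and from the quartic terms. *)
Lemma second_diff_product g h r : sq_integrable (g \o @torus_point R) ->
  sq_integrable (h \o @torus_point R) -> 0 <= r <= 1 / 2 ->
  normc (second_diff b c r (fun x y => hol_real g x y * hol_real h x y)) <=
  (r ^+ 2 + (4 * (27 * 39) + 4) * r ^+ 3) * (L2 g * L2 h).
Proof.
move=> g2 h2 /andP[r0 r12].
have nb : normc (b%:C) <= b by rewrite normc_pos_real.
have nc : normc (c%:C) <= c by rewrite normc_pos_real.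
have gc k l := fcoef_le k l g2. have hc k l := fcoef_le k l h2.
have G0 := L2_ge0 g; have H0 := L2_ge0 h.
have GH0 := mulr_ge0 G0 H0.
pose E x y := hol_real g x y * hol_real h x y -
  taylor2 (fcoef g) x y * taylor2 (fcoef h) x y.
have -> : second_diff b c r (fun x y => hol_real g x y * hol_real h x y) =
    second_diff b c r E +
    second_diff b c r (fun x y => taylor2 (fcoef g) x y * taylor2 (fcoef h) x y).
  rewrite -second_diffD; congr second_diff; apply/funext => x; apply/funext => y.
  by rewrite /E subrK.
have r3 : 0 <= r ^+ 3 by rewrite exprn_ge0.
have r31 : r ^+ 3 <= 1 by rewrite exprn_ile1//; lra.
have eE : normc (second_diff b c r E) <= 4 * (27 * 39 * (r ^+ 3 * (L2 g * L2 h))).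
  apply: second_diff_bound => //; first by rewrite !mulr_ge0.
  move=> x y /(grid_le r0) xr /(grid_le r0) yr; have xr1 : `|x| <= 1 by lra. have yr1 : `|y| <= 1 by lra.
  have eg := hol_real_taylor2 g2 r12 xr yr; have eh := hol_real_taylor2 h2 r12 xr yr.
  have tg := taylor2_bound G0 xr1 yr1 gc; have th := taylor2_bound H0 xr1 yr1 hc.
  have -> : E x y = (hol_real g x y - taylor2 (fcoef g) x y) * taylor2 (fcoef h) x y +
     taylor2 (fcoef g) x y * (hol_real h x y - taylor2 (fcoef h) x y) +
     (hol_real g x y - taylor2 (fcoef g) x y) * (hol_real h x y - taylor2 (fcoef h) x y).
    rewrite /E; ring.
  apply: le_trans (normcD_le (normcD_le (normcM_le eg th) (normcM_le tg eh)) (normcM_le eg eh)) _.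
  have -> : 27 * r ^+ 3 * L2 g * (6 * L2 h) + 6 * L2 g * (27 * r ^+ 3 * L2 h) +
    27 * r ^+ 3 * L2 g * (27 * r ^+ 3 * L2 h) =
    27 * 12 * (r ^+ 3 * (L2 g * L2 h)) + 27 * 27 * (r ^+ 3 * (r ^+ 3 * (L2 g * L2 h))) by ring.
  have : r ^+ 3 * (r ^+ 3 * (L2 g * L2 h)) <= r ^+ 3 * (L2 g * L2 h).
    by rewrite ler_piMl// mulr_ge0.
  lra.
rewrite second_diff_taylor2M.
have nr2 : normc (r ^+ 2)%:C <= r ^+ 2 by rewrite normc_pos_real// exprn_ge0.
have nr4 : normc (r ^+ 4)%:C <= r ^+ 4 by rewrite normc_pos_real// exprn_ge0.
set E4 := (b%:C * _ + c%:C * _).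
have e4 : normc E4 <= b * (L2 g * L2 h + L2 g * L2 h) +
    c * (L2 g * L2 h + L2 g * L2 h + L2 g * L2 h + L2 g * L2 h).
  apply: normcD_le; apply: normcM_le => //; repeat apply: normcD_le; exact: normcM_le.
apply: le_trans (normcD_le eE (normcD_le (normcM_le nr2 (hankel_le g2 h2)) (normcM_le nr4 e4))) _.
set X := L2 g * L2 h in GH0 *.
have bcX : b * (X + X) + c * (X + X + X + X) <= 4 * X.
  have : (b + c) * X <= X by rewrite ler_piMl.
  have : 0 <= b * X by rewrite mulr_ge0.
  lra.
have r4 : r ^+ 4 * (b * (X + X) + c * (X + X + X + X)) <= r ^+ 3 * (4 * X).
  have r43 : r ^+ 4 <= r ^+ 3 by rewrite exprS ler_piMl//; lra.
  apply: ler_pM => //; first by rewrite exprn_ge0.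
  by rewrite addr_ge0// mulr_ge0// !addr_ge0.
lra.
Qed.

End Symbol.
End WeakNormLower.

Section WeakNormLowerBound.
Variable R : realType.
Notation C := R[i].
Notation T := (measurableTypeR R * measurableTypeR R)%type.
Notation "x %:C" := (real_complex R x).
Implicit Types (f g h : C * C -> C) (x y r b c : R).

Lemma conjcD (u v : C) : conjc (u + v) = conjc u + conjc v.
Proof. by apply: complex_ext; rewrite ?(ReD, ImD, Re_conj, Im_conj, opprD). Qed.

Lemma symbol_pairingE b c f : sq_integrable (f \o @torus_point R) ->
  symbol_pairing b c f = inner f (sym_quad b c).
Proof.
move=> f2; set F := f \o _ in f2 *.
have fi := sq_integrable_cintegrable f2.
have ift k l : cintegrable (fun t => F t * trig k l t).
  under [X in cintegrable X]eq_fun do rewrite mulrC.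
  by apply: cintegrableM => //; exact: cbounded_trig.
have ic (u : C) (G : T -> C) : cintegrable G -> cintegrable (fun t => u * G t).
  by move=> iG; apply: cintegrableM => //; exact: cbounded_cst.
have i1 := cintegrableD (ift (- 2%:Z) (- 0%:Z)) (ift (- 0%:Z) (- 2%:Z)).
rewrite /symbol_pairing /fcoef -/F /coef -cintD// -!cintZ// -cintD; try exact: ic.
congr cint; apply/funext => t.
rewrite -!conj_trig -!monomial_trig /sym_quad.
rewrite !(conjcD, conjcM, conjcX, conjc_real).
rewrite /F /= !expr0 !expr1 !mulr1 !mul1r; ring.
Qed.

(** Pointwise convergence is uniform on a finite set. *)
Lemma exists_common_index (S : nat -> C * C -> C) (F : C * C -> C) (s : seq (C * C)) (e : R) :
  0 < e -> (forall z, z \in s -> (S n z : C^o) @[n --> \oo] --> (F z : C^o)) ->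
  exists n, forall z, z \in s -> normc (F z - S n z) <= e.
Proof.
move=> e0 cv; suff : \forall n \near \oo, forall z, z \in s -> normc (F z - S n z) <= e.
  by move=> /filter_ex.
elim: s cv => [|z s IH] cv; first by apply: nearW => n z; rewrite in_nil.
have H : \forall n \near \oo, normc (F z - S n z) <= e.
  have /cvgrPdist_le/(_ (e%:C)) := cv z (mem_head _ _).
  rewrite ltcR => /(_ e0); apply: filterS => n.
  rewrite normc_def lecR; case: (F z - S n z) => //.
have {}IH := IH (fun w ws => cv w (mem_behead (s := z :: s) ws)).
apply: filterS2 H IH => n h1 h2 w; rewrite in_cons => /orP[/eqP -> //|]; exact: h2.
Qed.

(** Apply the second difference to a partial sum of the factorization, compare with
    the function itself at the nine grid points, divide by [r^2] and let [r] tend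
    to 0. *)
Lemma weak_norm_lower b c f : 0 <= b -> 0 <= c ->
  2 * b ^+ 2 + c ^+ 2 <= 1 -> b + c <= 1 -> in_Lp 2 f ->
  ((normc (inner f (sym_quad b c)))%:E <= W_norm f)%E.
Proof.
move=> b0 c0 bc1 bc2 /in_Lp2P f2; rewrite -symbol_pairingE//.
apply: le_ereal_inf_tmp => _ [g [h [[hg hh fin cv] ->]]].
have g2 j : sq_integrable (g j \o @torus_point R) by apply/in_Lp2P; case: (hg j).
have h2 j : sq_integrable (h j \o @torus_point R) by apply/in_Lp2P; case: (hh j).
have costE : weak_cost g h = (\sum_(0 <= j <oo) (L2 (g j) * L2 (h j))%:E)%E.
  by apply: eq_eseriesr => j _; rewrite !Lp_norm2E// -EFinM.
have terms0 j : 0 <= L2 (g j) * L2 (h j) by rewrite mulr_ge0// L2_ge0.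
have cost0 : (0 <= weak_cost g h)%E.
  by rewrite costE; apply: nneseries_ge0 => j _ _; rewrite lee_fin.
have costfin : weak_cost g h \is a fin_num by rewrite ge0_fin_numE.
set K := fine (weak_cost g h).
have KE : weak_cost g h = K%:E by rewrite /K fineK.
have K0 : 0 <= K by rewrite fine_ge0.
have partial n : \sum_(j < n) L2 (g j) * L2 (h j) <= K.
  rewrite -lee_fin -KE costE -sumEFin -(big_mkord xpredT (fun j => (L2 (g j) * L2 (h j))%:E)).
  by apply: nneseries_lim_ge => j _ _; rewrite lee_fin.
rewrite KE lee_fin.
pose B : R := 4 * (27 * 39) + 4.
have B0 : 0 <= B by rewrite addr_ge0// !mulr_ge0.
have L0 := L2_ge0 f.
have main r : 0 < r <= 1 / 2 ->
    normc (symbol_pairing b c f) <= K + r * (B * K + 108 * L2 f).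
  move=> /andP[r0 r12]; have r01 : 0 <= r <= 1 / 2 by rewrite (ltW r0).
  apply/ler_addgt0Pl => e e0.
  pose pts := [seq ((x%:C, y%:C) : C * C) | x <- [:: r; - r; 0], y <- [:: r; - r; 0]].
  have ptsb z : z \in pts -> bidisc z.
    move=> /allpairsP[[x y] [/= xin yin ->]]; apply/bidisc_normc.
    have lt1 (w : R) : w \in [:: r; - r; 0] -> normc w%:C < 1.
      by rewrite normc_real; move/(grid_le (ltW r0)) => wr; lra.
    by split; exact: lt1.
  pose S n (z : C * C) := series (fun j => hol_ext (g j) z * hol_ext (h j) z : C^o) n.
  have e1 : 0 < r ^+ 2 * e / 4 by rewrite divr_gt0// mulr_gt0// exprn_gt0.
  have [n Sn] := @exists_common_index S (hol_ext f) pts _ e1 (fun z zin => cv z (ptsb z zin)).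
  pose V j x y := hol_real (g j) x y * hol_real (h j) x y.
  have Vb : normc (second_diff b c r (fun x y => \sum_(j < n) V j x y)) <=
      (r ^+ 2 + B * r ^+ 3) * K.
    rewrite second_diff_sum.
    apply: le_trans (_ : \sum_(j < n) (r ^+ 2 + B * r ^+ 3) * (L2 (g j) * L2 (h j)) <= _).
      have nsum (u : nat -> C) (v : nat -> R) : (forall j, normc (u j) <= v j) ->
          normc (\sum_(j < n) u j) <= \sum_(j < n) v j.
        move=> uv; elim: (n) => [|m IH]; first by rewrite !big_ord0 normc0.
        by rewrite !big_ord_recr; exact: normcD_le.
      apply: (nsum (fun j => second_diff b c r (V j))
        (fun j => (r ^+ 2 + B * r ^+ 3) * (L2 (g j) * L2 (h j)))) => j.
      exact: second_diff_product.
    rewrite -mulr_sumr ler_wpM2l//.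
    by rewrite addr_ge0 ?mulr_ge0// ?exprn_ge0// ltW.
  pose W x y := hol_real f x y - \sum_(j < n) V j x y.
  have Wb : normc (second_diff b c r W) <= 4 * (r ^+ 2 * e / 4).
    have nW x y : x \in [:: r; - r; 0] -> y \in [:: r; - r; 0] -> normc (W x y) <= r ^+ 2 * e / 4.
      move=> xin yin; have := Sn (x%:C, y%:C) (allpairs_f _ xin yin).
      rewrite /S seriesEord => H; exact: H.
    by apply: second_diff_bound => //; exact: ltW.
  have fE : second_diff b c r (hol_real f) =
      second_diff b c r W + second_diff b c r (fun x y => \sum_(j < n) V j x y).
    rewrite -second_diffD; congr second_diff; apply/funext => x; apply/funext => y.
    by rewrite /W subrK.
  have fb := second_diff_hol b0 c0 bc2 f2 r01.
  have r2 : 0 < r ^+ 2 by rewrite exprn_gt0.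
  rewrite -(ler_pM2l r2).
  have -> : r ^+ 2 * normc (symbol_pairing b c f) =
      normc (second_diff b c r (hol_real f) -
       (second_diff b c r (hol_real f) - (r ^+ 2)%:C * symbol_pairing b c f)).
    by rewrite subKr normcM normc_pos_real ?ltW.
  apply: le_trans (normcB_le _ fb) _.
    by rewrite fE; exact: normcD_le Wb Vb.
  rewrite [r ^+ 3]exprSr.
  have -> : 108 * (r ^+ 2 * r) * L2 f = r ^+ 2 * (r * (108 * L2 f)) by ring.
  have -> : (r ^+ 2 + B * (r ^+ 2 * r)) * K = r ^+ 2 * (K + r * (B * K)) by ring.
  have -> : 4 * (r ^+ 2 * e / 4) = r ^+ 2 * e by field.
  by rewrite -!mulrDr ler_pM2l//; lra.
apply/ler_addgt0Pl => e e0.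
pose D := B * K + 108 * L2 f.
have D0 : 0 <= D by rewrite addr_ge0// mulr_ge0.
pose r := Num.min (1 / 2) (e / (D + 1)).
have D1 : 0 < D + 1 by rewrite ltr_wpDl.
have r0 : 0 < r by rewrite lt_min !divr_gt0.
apply: le_trans (main r _) _; first by rewrite r0 ge_min lexx.
rewrite addrC lerD2r -/D.
apply: le_trans (_ : r * (D + 1) <= _); first by rewrite ler_pM2l// lerDl.
by rewrite -ler_pdivlMr// ge_min lexx orbT.
Qed.

End WeakNormLowerBound.

(** * Upper bounds from explicit factorizations *)

Section WeakNormUpperBound.
Variable R : realType.
Notation C := R[i].
Notation T := (measurableTypeR R * measurableTypeR R)%type.
Notation "x %:C" := (real_complex R x).
Implicit Types (f g h : C * C -> C) (a b c k : R).

Lemma polynomial_hol_ext f z : polynomial_fun f -> bidisc z -> hol_ext f z = f z.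
Proof. by move=> [P fP] bz; exact: hol_ext_poly fP bz. Qed.

Lemma polynomial_cst (k : C) : polynomial_fun (fun=> k).
Proof. by exists (k%:P%:P) => z; rewrite !hornerE. Qed.

Definition lin_form k (z : C * C) : C := k%:C * (z.1 + z.2).

Lemma polynomial_lin_form k : polynomial_fun (lin_form k).
Proof.
exists (k%:C%:P%:P * ('X + 'X%:P)) => z.
by rewrite !hornerE /lin_form.
Qed.

Lemma Lp_norm2_cst (k : C) : Lp_norm 2 (fun=> k) = (normc k)%:E.
Proof.
rewrite Lp_norm2E; last exact/cbounded_sq_integrable/cbounded_cst.
rewrite (_ : sqnorm _ = normc k ^+ 2) ?sqrtr_sqr ?ger0_norm ?normc_ge0//.
exact: (torus_int_cst (normc k ^+ 2)).
Qed.

Lemma Lp_norm2_lin_form k : 0 <= k -> Lp_norm 2 (lin_form k) = (k * Num.sqrt 2)%:E.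
Proof.
move=> k0; rewrite Lp_norm2E; last first.
  apply/cbounded_sq_integrable/cboundedM; first exact: cbounded_cst.
  by apply: cboundedD; [exact: cbounded_z1|exact: cbounded_z2].
congr EFin; rewrite -[in RHS](ger0_norm k0) -sqrtr_sqr -sqrtrM ?sqr_ge0//.
congr Num.sqrt.
transitivity (arc_int (fun x : R => k ^+ 2 * (2 + 2 * 1 * cos x))).
  rewrite -torus_int_diff.
  - congr torus_int; apply/funext => t; rewrite /lin_form [normc _]normcM exprMn.
    rewrite normc_real real_normK ?num_real// normc_sqr ReD ImD /= cosB.
    congr (_ * _).
    transitivity ((cos t.1 ^+ 2 + sin t.1 ^+ 2) + (cos t.2 ^+ 2 + sin t.2 ^+ 2)
      + 2 * (cos t.1 * cos t.2 + sin t.1 * sin t.2)); first by ring.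
    by rewrite !cos2Dsin2; ring.
  - apply: bounded_measurableM; first exact: bounded_measurable_cst.
    exact: bounded_measurable_affine_cos.
  - by move=> x; rewrite cos_2pi.
rewrite arc_intZ; last exact: bounded_measurable_affine_cos.
by rewrite arc_int_affine_cos.
Qed.

(** A weak factorization with two terms, padded with zeros. *)
Lemma weak_norm_le2 f g0 h0 g1 h1 : polynomial_fun f ->
  polynomial_fun g0 -> polynomial_fun h0 -> polynomial_fun g1 -> polynomial_fun h1 ->
  (forall z, f z = g0 z * h0 z + g1 z * h1 z) ->
  (W_norm f <= Lp_norm 2 g0 * Lp_norm 2 h0 + Lp_norm 2 g1 * Lp_norm 2 h1)%E.
Proof.
move=> pf pg0 ph0 pg1 ph1 fE.
pose pad (u v : C * C -> C) (j : nat) : C * C -> C :=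
  match j with 0%N => u | 1%N => v | _ => fun=> 0 end.
have ppad u v j : polynomial_fun u -> polynomial_fun v -> polynomial_fun (pad u v j).
  by move=> pu pv; case: j => [//|[//|j]]; exact: polynomial_cst.
have costE : weak_cost (pad g0 g1) (pad h0 h1) =
    (Lp_norm 2 g0 * Lp_norm 2 h0 + Lp_norm 2 g1 * Lp_norm 2 h1)%E.
  rewrite /weak_cost (@nneseries_split _ _ 0 2); last first.
    by move=> k _; rewrite mule_ge0// Lnorm_ge0.
  rewrite eseries0 ?adde0.
    by rewrite add0n !big_nat_recr//= big_geq// add0e.
  by move=> [|[|j]]//= _ _; rewrite Lp_norm2_cst normc0 mul0e.
have fin u : polynomial_fun u -> exists2 r : R, Lp_norm 2 u = r%:E & 0 <= r.
  move=> /polynomial_hardy[/in_Lp2P u2 _].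
  by exists (Num.sqrt (sqnorm (u \o @torus_point R))); [exact: Lp_norm2E|exact: sqrtr_ge0].
rewrite -costE; apply: ereal_inf_lbound; exists (pad g0 g1), (pad h0 h1); split=> //; split.
- by move=> j; apply/polynomial_hardy/ppad.
- by move=> j; apply/polynomial_hardy/ppad.
- rewrite costE; have [x -> _] := fin _ pg0; have [y -> _] := fin _ ph0.
  by have [u -> _] := fin _ pg1; have [v -> _] := fin _ ph1; rewrite -!EFinM -EFinD ltry.
move=> z bz; apply: cvg_near_cst.
exists 2%N => // n n2.
transitivity (\sum_(0 <= j < n) hol_ext (pad g0 g1 j) z * hol_ext (pad h0 h1 j) z) => //.
rewrite (@big_cat_nat _ _ _ 2)//= [X in _ + X]big1_seq /=.
  rewrite big_ltn// big_ltn// big_geq// addr0 addr0 /=.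
  by rewrite !polynomial_hol_ext// fE.
move=> [|[|j]]//=; rewrite mem_index_iota// => _.
by rewrite polynomial_hol_ext ?mul0r//; exact: polynomial_cst.
Qed.

End WeakNormUpperBound.

(** * Hilbert points and norm attaining forms in the weak product *)

Section WeakProduct.
Variable R : realType.
Notation C := R[i].
Implicit Types (a b c k : R).

(** [phi_a] interpolates between the factorization [1 * phi_(1/2)] and
    [(z1 + z2)^2], which are optimal at [a = 1/2] and [a = 2]. *)
Lemma W_norm_phi_mid a : 1 / 2 <= a <= 2 -> (W_norm (@phi_ R a) <= ((4 + a) / 3)%:E)%E.
Proof.
move=> /andP[a1 a2]; rewrite phiE.
(* the weight for which [a = s / 2 + 2 (1 - s)] *)
pose s := (2 - a) * 2 / 3; have s0 : 0 <= s by rewrite /s; lra.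
have s1 : 0 <= 1 - s by rewrite /s; lra.
apply: le_trans (_ : (Lp_norm 2 (fun=> 1%R) * Lp_norm 2 (sym_quad s (s / 2)%R) +
  Lp_norm 2 (lin_form (1 - s)%R) * Lp_norm 2 (@lin_form R 1%R) <= _)%E).
  apply: weak_norm_le2; try exact: polynomial_sym_quad; try exact: polynomial_lin_form;
    try exact: polynomial_cst.
  move=> z; rewrite /sym_quad /lin_form rmorph1 !mul1r.
  have -> : real_complex R a = real_complex R (s / 2) + 2 * real_complex R (1 - s).
    rewrite -[X in _ + X * _](rmorph_nat (real_complex R)) -rmorphM -rmorphD.
    by congr (real_complex R _); rewrite /s; field.
  by rewrite rmorphB rmorph1; ring.
rewrite Lp_norm2_cst normc1 mul1e Lp_norm2_sym_quad !Lp_norm2_lin_form// mul1r.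
rewrite -EFinM -EFinD lee_fin.
rewrite -[X in _ + X]mulrA -expr2 sqr_sqrtr//.
have -> : (s / 2) ^+ 2 + 2 * s ^+ 2 = (3 / 2 * s) ^+ 2 by field.
rewrite sqrtr_sqr ger0_norm; last by rewrite mulr_ge0// divr_ge0.
rewrite /s; lra.
Qed.

(** The form is [(z1 + z2)^2 + (a - 2) z1 z2]. *)
Lemma W_norm_phi_large a : 2 <= a -> (W_norm (@phi_ R a) <= a%:E)%E.
Proof.
move=> a2; rewrite phiE.
apply: le_trans (_ : (Lp_norm 2 (@lin_form R 1%R) * Lp_norm 2 (@lin_form R 1%R) +
  Lp_norm 2 (fun=> 1%R) * Lp_norm 2 (sym_quad 0%R (a - 2)%R) <= _)%E).
  apply: weak_norm_le2; try exact: polynomial_sym_quad; try exact: polynomial_lin_form;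
    try exact: polynomial_cst.
  move=> z; rewrite /sym_quad /lin_form rmorph1 rmorph0 rmorphB rmorph_nat; ring.
rewrite Lp_norm2_cst normc1 mul1e Lp_norm2_sym_quad !Lp_norm2_lin_form// mul1r.
rewrite -EFinM -EFinD lee_fin -expr2 sqr_sqrtr//.
rewrite expr0n mulr0 addr0 sqrtr_sqr ger0_norm; lra.
Qed.

Lemma W_norm_le_L2 b c : (W_norm (@sym_quad R b c) <= Lp_norm 2 (@sym_quad R b c))%E.
Proof.
apply: le_trans (_ : (Lp_norm 2 (fun=> 1%R) * Lp_norm 2 (@sym_quad R b c) +
  Lp_norm 2 (fun=> 0%R) * Lp_norm 2 (fun=> 0%R) <= _)%E).
  apply: weak_norm_le2; try exact: polynomial_sym_quad; try exact: polynomial_cst.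
  by move=> z; rewrite mul1r mul0r addr0.
by rewrite !Lp_norm2_cst normc1 normc0 mul1e mul0e adde0.
Qed.

Lemma W_norm_square k : 0 <= k -> (W_norm (@sym_quad R k (2 * k)) <= (2 * k)%:E)%E.
Proof.
move=> k0; apply: le_trans (_ : (Lp_norm 2 (@lin_form R k) * Lp_norm 2 (@lin_form R 1%R) +
  Lp_norm 2 (fun=> 0%R) * Lp_norm 2 (fun=> 0%R) <= _)%E).
  apply: weak_norm_le2; try exact: polynomial_sym_quad; try exact: polynomial_lin_form;
    try exact: polynomial_cst.
  by move=> z; rewrite /sym_quad /lin_form rmorph1 rmorphM rmorph_nat; ring.
rewrite Lp_norm2_cst normc0 mul0e adde0 !Lp_norm2_lin_form// mul1r -EFinM lee_fin.
by rewrite -mulrA -expr2 sqr_sqrtr// mulrC.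
Qed.

Lemma W_norm_sym_quad_lower a d b c : 0 <= b -> 0 <= c ->
  2 * b ^+ 2 + c ^+ 2 <= 1 -> b + c <= 1 ->
  ((d * c + 2 * b * a)%:E <= W_norm (@sym_quad R a d))%E.
Proof.
move=> b0 c0 bc1 bc2.
have [hL _] := hardy_sym_quad a d.
apply: le_trans (weak_norm_lower b0 c0 bc1 bc2 hL).
by rewrite inner_sym_quad normc_real lee_fin ler_norm.
Qed.

Let phi_norm a : R := Num.sqrt (a ^+ 2 + 2).

Lemma phi_norm_sqr a : phi_norm a ^+ 2 = a ^+ 2 + 2.
Proof. by rewrite sqr_sqrtr// addr_ge0// sqr_ge0. Qed.

Lemma phi_norm_gt0 a : 0 < phi_norm a.
Proof. by rewrite sqrtr_gt0 ltr_wpDl// sqr_ge0. Qed.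

Lemma Lp_norm2_phi a : Lp_norm 2 (@phi_ R a) = (phi_norm a)%:E.
Proof. by rewrite phiE Lp_norm2_sym_quad expr1n mulr1. Qed.

Lemma phi_nonzero a : ~ torus_zero (@phi_ R a).
Proof. rewrite phiE; apply: sym_quad_nonzero; have := sqr_ge0 a; rewrite expr1n; lra. Qed.

Lemma hardy_phi a : hardy 2 (@phi_ R a).
Proof. by rewrite phiE; exact: hardy_sym_quad. Qed.

(** The functional given by a multiple of [phi] bounds the weak norm from
    below on the hyperplane through [phi] orthogonal to it. *)
Lemma hilbert_point_W_of_symbol a b c k :
  0 <= b -> 0 <= c -> 2 * b ^+ 2 + c ^+ 2 <= 1 -> b + c <= 1 ->
  b = k -> c = k * a -> (W_norm (@phi_ R a) <= (k * (a ^+ 2 + 2))%:E)%E ->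
  hilbert_point (@W_norm R) (phi_ a).
Proof.
move=> b0 c0 bc1 bc2 bk ck Wphi.
split; [exact: hardy_phi|exact: phi_nonzero|move=> f hf fphi].
apply: le_trans Wphi _.
have [fL _] := hf; have [pL _] := hardy_phi a.
have fpL : in_Lp 2 (fun z => phi_ a z + f z).
  apply/in_Lp2P; have := sq_integrableD ((in_Lp2P _).1 pL) ((in_Lp2P _).1 fL).
  by [].
apply: le_trans (weak_norm_lower b0 c0 bc1 bc2 fpL).
rewrite lee_fin.
pose q t : C := sym_quad 1 a (@torus_point R t).
have bq : cbounded q := cbounded_sym_quad 1 a.
have ip g : in_Lp 2 g -> cintegrable (fun t => g (torus_point t) * conjc (q t)).
  move=> /in_Lp2P/sq_integrable_cintegrable ig.
  under [X in cintegrable X]eq_fun do rewrite mulrC.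
  by apply: cintegrableM => //; exact: cbounded_conj.
have kq z : sym_quad b c z = real_complex R k * sym_quad 1 a z.
  by rewrite /sym_quad bk ck rmorphM rmorph1; ring.
have -> : inner (fun z => phi_ a z + f z) (sym_quad b c) =
    real_complex R k * (inner (phi_ a) (phi_ a) + inner f (phi_ a)).
  rewrite -[inner (phi_ a) (phi_ a) + _]cintD; [|by rewrite phiE; apply: ip; rewrite -phiE|
    by rewrite phiE; exact: ip].
  rewrite -cintZ; last first.
    by rewrite phiE; apply: cintegrableD; apply: ip => //; rewrite -phiE.
  congr cint; apply/funext => t; rewrite kq phiE conjcM conjc_real; ring.
rewrite fphi addr0 phiE inner_sym_quad -rmorphM normc_real.
by apply: le_trans (ler_norm _); rewrite !mulr1 -expr2.
Qed.

(** The symbol [phi / ||phi||] satisfies the second constraint because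
    [(1 + a)^2 <= a^2 + 2] for [a <= 1/2]. *)
Lemma phi_W_small a : 0 <= a <= 1 / 2 ->
  W_norm (@phi_ R a) = (phi_norm a)%:E /\ hilbert_point (@W_norm R) (phi_ a).
Proof.
move=> /andP[a0 a12]; have n0 := phi_norm_gt0 a; have n2 := phi_norm_sqr a.
have b0 : 0 <= (phi_norm a)^-1 by rewrite invr_ge0 ltW.
have c0 : 0 <= (phi_norm a)^-1 * a by rewrite mulr_ge0.
have nV : (phi_norm a)^-1 ^+ 2 * (a ^+ 2 + 2) = 1.
  by rewrite -n2 -exprMn mulVf ?expr1n// gt_eqF.
have bc1 : 2 * (phi_norm a)^-1 ^+ 2 + ((phi_norm a)^-1 * a) ^+ 2 <= 1 by rewrite exprMn; lra.
have an : 1 + a <= phi_norm a.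
  rewrite -(ler_pXn2r (_ : (0 < 2)%N)) ?nnegrE ?addr_ge0 ?(ltW n0)// n2 sqrrD; lra.
have bc2 : (phi_norm a)^-1 + (phi_norm a)^-1 * a <= 1.
  by rewrite -[X in X + _]mulr1 -mulrDr mulrC ler_pdivrMr// mul1r.
have nE : (phi_norm a)^-1 * (a ^+ 2 + 2) = phi_norm a.
  by rewrite -n2 expr2 mulKf// gt_eqF.
have Wle : (W_norm (@phi_ R a) <= (phi_norm a)%:E)%E.
  by rewrite -Lp_norm2_phi phiE; exact: W_norm_le_L2.
split; last first.
  by apply: (hilbert_point_W_of_symbol b0 c0 bc1 bc2 erefl erefl); rewrite nE.
apply/eqP; rewrite eq_le Wle /= phiE.
apply: le_trans (W_norm_sym_quad_lower 1 a b0 c0 bc1 bc2).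
by rewrite lee_fin -[leLHS]nE; lra.
Qed.

(** For [1/2 < a <= 2] the factorization bound is below the L^2 norm because
    [9 (a^2 + 2) - (4 + a)^2 = 2 (2 a - 1)^2]. *)
Lemma phi_norm_attaining_W a : 0 <= a ->
  norm_attaining (@W_norm R) (phi_ a) <-> 0 <= a <= 1 / 2.
Proof.
move=> a0; split=> [[_ _]|a12]; last first.
  by split; [exact: hardy_phi|exact: phi_nonzero|rewrite (phi_W_small a12).1 Lp_norm2_phi].
rewrite Lp_norm2_phi a0 /= => e; rewrite leNgt; apply/negP => a12.
have n0 := phi_norm_gt0 a; have n2 := phi_norm_sqr a.
have [a2|a2] := leP a 2.
  have : (W_norm (@phi_ R a) <= ((4 + a) / 3)%:E)%E by apply: W_norm_phi_mid; lra.
  rewrite e lee_fin leNgt => /negP; apply.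
  rewrite -(ltr_pXn2r (_ : (0 < 2)%N)) ?nnegrE ?(ltW n0)//; last by lra.
  have : 0 < (2 * a - 1) ^+ 2 by rewrite exprn_gt0//; lra.
  rewrite n2 exprMn; lra.
have : (W_norm (@phi_ R a) <= a%:E)%E by apply: W_norm_phi_large; lra.
rewrite e lee_fin leNgt => /negP; apply.
by rewrite -(ltr_pXn2r (_ : (0 < 2)%N)) ?nnegrE ?(ltW n0)// n2 ltrDl.
Qed.

(** Off the exceptional values the multiple of [(z1 + z2)^2] whose difference
    with [phi] is orthogonal to [phi] has a smaller norm. *)
Lemma phi_hilbert_point_W a : 0 <= a ->
  hilbert_point (@W_norm R) (phi_ a) <-> 0 <= a <= 1 / 2 \/ a = 2.
Proof.
move=> a0; split=> [[_ _ hp]|[a12|->]]; last 2 first.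
- exact: (phi_W_small a12).2.
- have b1 : 0 <= 1 / 3 :> R by lra.
  have c1 : 0 <= 2 / 3 :> R by lra.
  have bc1 : 2 * (1 / 3) ^+ 2 + (2 / 3) ^+ 2 <= 1 :> R by lra.
  have bc2 : 1 / 3 + 2 / 3 <= 1 :> R by lra.
  have ck : 2 / 3 = 1 / 3 * 2 :> R by lra.
  apply: (hilbert_point_W_of_symbol b1 c1 bc1 bc2 erefl ck).
  by apply: le_trans (W_norm_phi_large (lexx 2)) _; rewrite lee_fin; lra.
rewrite a0 /=; have [a12|a12] := leP a (1 / 2); [by left|right].
apply/eqP/negP => /negP a2.
pose k := (a ^+ 2 + 2) / (2 * (1 + a)).
have a1 : 0 < 1 + a by lra.
have kE : 2 * k * (1 + a) = a ^+ 2 + 2 by rewrite /k; field; lra.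
have k0 : 0 <= k by rewrite divr_ge0 ?addr_ge0 ?sqr_ge0 ?mulr_ge0// ltW.
have := hp (sym_quad (k - 1) (2 * k - a)) (hardy_sym_quad _ _).
rewrite phiE inner_sym_quad => /(_ _)/wrap[].
  rewrite (_ : _ + _ = 0) ?rmorph0//.
  have -> : (2 * k - a) * a + 2 * 1 * (k - 1) = 2 * k * (1 + a) - (a ^+ 2 + 2) by ring.
  by rewrite kE subrr.
have -> : (fun z => sym_quad 1 a z + sym_quad (k - 1) (2 * k - a) z) = sym_quad k (2 * k) :> (C * C -> C).
  by apply/funext => z; rewrite /sym_quad !rmorphB rmorph1; ring.
move=> /le_trans/(_ (W_norm_square k0)).
have [a2'|a2'] := ltP a 2.
  have b1 : 2 * (2 / 3) ^+ 2 + (1 / 3) ^+ 2 <= 1 :> R by lra.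
  have := @W_norm_sym_quad_lower 1 a (2 / 3) (1 / 3) ltac:(lra) ltac:(lra) b1 ltac:(lra).
  move=> /le_trans h /h; rewrite lee_fin.
  have : 0 < (2 * a - 1) * (2 - a) by rewrite mulr_gt0//; lra.
  nra.
have {}a2 : 2 < a by rewrite lt_neqAle eq_sym a2.
have := @W_norm_sym_quad_lower 1 a 0 1 ltac:(lra) ltac:(lra) ltac:(lra) ltac:(lra).
move=> /le_trans h /h; rewrite lee_fin; nra.
Qed.

End WeakProduct.

Theorem theorem4 (R : realType) :
  exists alpha0 : R,
    [/\ 0 < alpha0 < 2,
        alpha_eq alpha0,
        forall a : R, 0 < a < 2 -> alpha_eq a -> a = alpha0 &
        162 * 10 ^+ 3 + 420 <= alpha0 * 10 ^+ 5 < 162 * 10 ^+ 3 + 421] /\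
    forall alpha : R, 0 <= alpha ->
      [/\ ~ norm_attaining (@H1_norm R) (phi_ alpha),
          hilbert_point (@H1_norm R) (phi_ alpha) <->
            alpha = 0 \/ alpha = alpha0,
          norm_attaining (@W_norm R) (phi_ alpha) <->
            0 <= alpha <= 1 / 2 &
          hilbert_point (@W_norm R) (phi_ alpha) <->
            0 <= alpha <= 1 / 2 \/ alpha = 2].
Proof.
have [t [tb ts [a0b a0e a0u a0n]]] := exists_alpha0 R.
exists (2 * sin t); split; first by split.
have double (u : R) : sin (2 * u) = 2 * sin u * cos u.
  by rewrite mulr_natl sin_mulr2n -mulr_natl; ring.
move=> a a0; split.
- exact: phi_not_norm_attaining_H1.
- split=> [hp|[->|->]].
  + have [->|an0] := eqVneq a 0; [by left|right].
    have {an0} ap : 0 < a by rewrite lt_neqAle eq_sym an0.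
    have [u [ub -> us]] := hilbert_point_H1_only ap hp.
    by rewrite (sin_double_uniq ub us tb ts).
  + have := @phi_hilbert_point_H1 R 0; rewrite sin0 mulr0; apply.
      by rewrite lexx divr_gt0 ?pi_gt0.
    by rewrite mul0r.
  + have [t0 tpi] := andP tb.
    by apply: phi_hilbert_point_H1; [rewrite (ltW t0)|rewrite -double].
- exact: phi_norm_attaining_W.
- exact: phi_hilbert_point_W.
Qed.
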